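(* Let $\lambda_2$ be the canonical representation of $\mathcal{Q}_2$ on $\ell^2(\mathbb{Z})$, let $\pi$ be the canonical representation of $C_0(\mathbb{R})\rtimes_{\lambda^{\mathrm{aff}}}(\mathbb{Z}[\tfrac12]\rtimes\langle2\rangle)$ on $L^2(\mathbb{R})$, and let $X$ be the $C_0(\mathbb{R})\rtimes_{\lambda^{\mathrm{aff}}}(\mathbb{Z}[\tfrac12]\rtimes\langle2\rangle)$--$\mathcal{Q}_2$-imprimitivity bimodule described in the context. Then the representations $\pi$ and $X\text{--}\mathrm{Ind}(\lambda_2)$ are unitarily equivalent.
   Context: **Notation.** $\mathrm{e}(t)=\exp(2\pi it)$; $[2\rangle=\{1,2,2^2,\dots\}$; $\langle2\rangle=\{2^i:i\in\mathbb{Z}\}$; $\mathbb{Z}[\tfrac12]=\{l/2^i\}$; $p:\mathbb{Q}_2\to\mathbb{Q}_2/\mathbb{Z}_2\cong\mathbb{Z}[\tfrac12]/\mathbb{Z}$ is the canonical map; $1_Y$ is a characteristic function; $\langle\xi_1,\xi_2\rangle_{L^2(\mathbb{R})}=\int\overline{\xi_1}\xi_2\,dt$; $F_{\mathbb{R}}$ is the Fourier transform $\hat g(x)=\int_{\mathbb{R}}\mathrm{e}(tx)g(t)dt$ and $\check f=F_{\mathbb{R}}^{-1}f$. **Algebras.** $\mathcal{Q}_2$ is the universal unital $C^*$-algebra generated by a unitary $u$ and an isometry $s_2$ with $s_2u=u^2s_2$ and $s_2s_2^*+us_2s_2^*u^{-1}=1$; $s_{2^i}=(s_2)^i$, $e_{2^i}=s_{2^i}s_{2^i}^*$.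 The discrete group $\mathbb{Z}[\tfrac12]\rtimes\langle2\rangle$, with $(b,a)(d,c)=(b+ad,ac)$, acts on $C_0(\mathbb{R})$ by $\lambda^{\mathrm{aff}}_{(b,a)}f=f(a^{-1}(\cdot-b))$. The element $f\otimes1_{\{(d,c)\}}$ of the crossed product is the function with value $f\in C_0(\mathbb{R})$ at $(d,c)$ and $0$ elsewhere. **Representations.** $\lambda_2(u)\varepsilon_n=\varepsilon_{n+1}$ and $\lambda_2(s_2)\varepsilon_n=\varepsilon_{2n}$, where $\{\varepsilon_n\}_{n\in\mathbb{Z}}$ is the canonical orthonormal basis of $\ell^2(\mathbb{Z})$. $\pi$ is given by $(\pi(f\otimes1_{\{(b,a)\}})\xi)(x)=f(x)a^{-1/2}\xi(a^{-1}(x-b))$ for $f\in C_0(\mathbb{R})$, $\xi\in L^2(\mathbb{R})$. **The bimodule $X$.** $\mathbb{R}\rtimes\langle2\rangle$ is, as a topological space, $\mathbb{R}\times\langle2\rangle$ with $\langle2\rangle$ discrete. Let $X_0=C_c(\mathbb{Z}_2\times(\mathbb{R}\rtimes\langle2\rangle))$; the linear span of the functions $1_{l+k\mathbb{Z}_2}\otimes\xi\otimes1_{\{m\}}$ ($k\in[2\rangle$, $l\in\mathbb{Z}$, $\xi\in C_c(\mathbb{R})$, $m\in\langle2\rangle$) is dense in $X_0$ for the inductive limit topology. The right inner product is determined on such functions $\varphi_i=1_{l_i+k_i\mathbb{Z}_2}\otimes\xi_i\otimes1_{\{m_i\}}$ by: if $m_1\le m_2$, $$\langle\varphi_1,\varphi_2\rangle=m_1\sum_{b\in\mathbb{Z}}\big\langle\xi_1,\xi_2((\cdot+b)\tfrac{m_1}{m_2})\big\rangle_{L^2(\mathbb{R})}u^{l_1}e_{k_1}u^{-l_1}u^{-b}s_{m_2/m_1}u^{l_2}e_{k_2}u^{-l_2};$$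 if $m_1\ge m_2$, $$\langle\varphi_1,\varphi_2\rangle=m_1\sum_{b\in\frac{m_2}{m_1}\mathbb{Z}}\big\langle\xi_1,\xi_2((\cdot+b)\tfrac{m_1}{m_2})\big\rangle_{L^2(\mathbb{R})}u^{l_1}e_{k_1}u^{-l_1}s^*_{m_1/m_2}u^{-\frac{m_1}{m_2}b}u^{l_2}e_{k_2}u^{-l_2}.$$ The right action of $\mathcal{Q}_2$ is determined by $(\varphi\cdot u)(\mathbf{z},(t,a))=\varphi(\mathbf{z}+1,(t+1,a))$ and $(\varphi\cdot s_2)(\mathbf{z},(t,a))=\varphi(2\mathbf{z},(2t,2^{-1}a))$, and the left action of the crossed product by $$((f\otimes1_{\{(d,c)\}})\cdot\varphi)(\mathbf{z},(t,a))=c^{1/2}\mathrm{e}(-p(\mathbf{z}ad))\mathrm{e}(tad)\int_{\mathbb{R}}\mathrm{e}(sd)\check f(s)\varphi(\mathbf{z},(t+sa^{-1},ac))\,ds$$ for $f\in F_{\mathbb{R}}(C_c(\mathbb{R}))$, $(d,c)\in\mathbb{Z}[\tfrac12]\rtimes\langle2\rangle$. $X$ is the completion of $X_0$; it is an imprimitivity bimodule, whose left inner product is determined by ${}\langle x,y\rangle_{\mathrm{left}}\cdot z=x\cdot\langle y,z\rangle$. **Induction.** $X\text{--}\mathrm{Ind}(\lambda_2)$ is the representation of the crossed product on the Hilbert space $X\otimes_{\mathcal{Q}_2,\lambda_2}\ell^2(\mathbb{Z})$ (inner product $\langle x\otimes h,y\otimes k\rangle=\langle h,\lambda_2(\langle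 x,y\rangle)k\rangle$) given by $A(x\otimes h)=(A\cdot x)\otimes h$. *)

(* Defs.v *)
From HB Require Import structures.
From mathcomp Require Import all_boot all_order all_algebra.
From mathcomp Require Import all_classical all_reals all_analysis.
From mathcomp Require Import complex.

Set Implicit Arguments.
Unset Strict Implicit.
Unset Printing Implicit Defensive.
Import Order.TTheory GRing.Theory Num.Theory.
Import numFieldNormedType.Exports.

Local Open Scope classical_set_scope.
Local Open Scope ring_scope.

(* The objects of the theorem that are given by a universal property, a
   completion or a space of equivalence classes (the C*-algebras, the bimodule,
   the Hilbert spaces) are handled through models: a carrier together with the
   structure maps and the properties that determine it up to a unique
   structure-preserving isomorphism.  The theorem is stated for all models. *)

(* The inner product is linear in its second variable. *)
Record hilbert (R : realType) := Hilbert {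
  hcar :> completeNormedModType R[i];
  hip : hcar -> hcar -> R[i];
  hip_linear : forall (c : R[i]) (x y z : hcar),
    hip x (c *: y + z) = c * hip x y + hip x z;
  hip_sym : forall x y : hcar, hip x y = (hip y x)^*;
  hip_norm : forall x : hcar, `|x| ^+ 2 = hip x x }.

(* Not necessarily unital. *)
Record cstar (R : realType) := Cstar {
  ccar :> completeNormedModType R[i];
  cmul : ccar -> ccar -> ccar;
  cadj : ccar -> ccar;
  cmulA : forall x y z : ccar, cmul x (cmul y z) = cmul (cmul x y) z;
  cmul_linear_l : forall (c : R[i]) (x y z : ccar),
    cmul (c *: x + y) z = c *: cmul x z + cmul y z;
  cmul_linear_r : forall (c : R[i]) (x y z : ccar),
    cmul z (c *: x + y) = c *: cmul z x + cmul z y;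
  cadj_antilinear : forall (c : R[i]) (x y : ccar),
    cadj (c *: x + y) = c^* *: cadj x + cadj y;
  cadjK : forall x : ccar, cadj (cadj x) = x;
  cadjM : forall x y : ccar, cadj (cmul x y) = cmul (cadj y) (cadj x);
  cnormM : forall x y : ccar, `|cmul x y| <= `|x| * `|y|;
  cnorm_cstar : forall x : ccar, `|cmul (cadj x) x| = `|x| ^+ 2 }.

Declare Scope cstar_scope.
Delimit Scope cstar_scope with A.
Notation "x ** y" := (cmul x y) (at level 40, left associativity) : cstar_scope.
Notation "x ^†" := (cadj x) (at level 1, left associativity, format "x ^†") :
  cstar_scope.
Local Open Scope cstar_scope.

Definition cpositive (R : realType) (A : cstar R) (a : A) : Prop :=
  exists b : A, a = b^† ** b.

Definition star_hom (R : realType) (A B : cstar R) (f : A -> B) : Prop :=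
  [/\ forall (c : R[i]) (x y : A), f (c *: x + y) = c *: f x + f y,
      forall x y : A, f (x ** y) = f x ** f y &
      forall x : A, f x^† = (f x)^†].

Record rep (R : realType) (A : cstar R) (H : hilbert R) := Rep {
  rfun :> A -> H -> H;
  rep_linear : forall (a : A) (c : R[i]) (x y : H),
    rfun a (c *: x + y) = c *: rfun a x + rfun a y;
  rep_bounded : forall a : A, continuous (rfun a);
  rep_linear_alg : forall (c : R[i]) (a b : A) (x : H),
    rfun (c *: a + b) x = c *: rfun a x + rfun b x;
  rep_mul : forall (a b : A) (x : H), rfun (a ** b) x = rfun a (rfun b x);
  rep_adj : forall (a : A) (x y : H), hip (rfun a^† x) y = hip x (rfun a y) }.

Definition unitarily_equivalent (R : realType) (A : cstar R) (H K : hilbert R)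
    (rho : rep A H) (sigma : rep A K) : Prop :=
  exists U : H -> K,
    [/\ forall (c : R[i]) (x y : H), U (c *: x + y) = c *: U x + U y,
        forall x y : H, hip (U x) (U y) = hip x y,
        forall z : K, exists x : H, U x = z &
        forall (a : A) (x : H), U (rho a x) = sigma a (U x)].

Definition lspan (K : numFieldType) (V : lmodType K) (S : set V) : set V :=
  [set v | exists (n : nat) (c : 'I_n -> K) (x : 'I_n -> V),
     (forall i, S (x i)) /\ v = \sum_(i < n) c i *: x i].

(* The left inner product is linear in its first variable, the right inner
   product in its second one. *)
Record imprimitivity (R : realType) (B A : cstar R) := Imprimitivity {
  xcar :> completeNormedModType R[i];
  lact : B -> xcar -> xcar;
  ract : xcar -> A -> xcar;
  lip : xcar -> xcar -> B;
  rip : xcar -> xcar -> A;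
  lact_linear : forall (b : B) (c : R[i]) (x y : xcar),
    lact b (c *: x + y) = c *: lact b x + lact b y;
  lact_linear_alg : forall (c : R[i]) (b b' : B) (x : xcar),
    lact (c *: b + b') x = c *: lact b x + lact b' x;
  lact_mul : forall (b b' : B) (x : xcar),
    lact (b ** b') x = lact b (lact b' x);
  ract_linear : forall (a : A) (c : R[i]) (x y : xcar),
    ract (c *: x + y) a = c *: ract x a + ract y a;
  ract_linear_alg : forall (c : R[i]) (a a' : A) (x : xcar),
    ract x (c *: a + a') = c *: ract x a + ract x a';
  ract_mul : forall (a a' : A) (x : xcar),
    ract x (a ** a') = ract (ract x a) a';
  lract : forall (b : B) (a : A) (x : xcar),
    ract (lact b x) a = lact b (ract x a);
  lip_linear : forall (c : R[i]) (x y z : xcar),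
    lip (c *: x + y) z = c *: lip x z + lip y z;
  lip_sym : forall x y : xcar, (lip x y)^† = lip y x;
  lip_lact : forall (b : B) (x y : xcar), lip (lact b x) y = b ** lip x y;
  lip_pos : forall x : xcar, cpositive (lip x x);
  lip_norm : forall x : xcar, `|x| ^+ 2 = `|lip x x|;
  lip_full : closure (lspan [set b | exists x y, b = lip x y]) = setT;
  rip_linear : forall (c : R[i]) (x y z : xcar),
    rip x (c *: y + z) = c *: rip x y + rip x z;
  rip_sym : forall x y : xcar, (rip x y)^† = rip y x;
  rip_ract : forall (a : A) (x y : xcar), rip x (ract y a) = rip x y ** a;
  rip_pos : forall x : xcar, cpositive (rip x x);
  rip_norm : forall x : xcar, `|x| ^+ 2 = `|rip x x|;
  rip_full : closure (lspan [set a | exists x y, a = rip x y]) = setT;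
  rip_lact : forall (b : B) (x y : xcar),
    rip (lact b x) y = rip x (lact b^† y);
  lip_ract : forall (a : A) (x y : xcar),
    lip (ract x a) y = lip x (ract y a^†);
  lip_rip : forall x y z : xcar, lact (lip x y) z = ract x (rip y z) }.

(* T, with the bilinear map tens, is the Hilbert space X (x)_{A,rho} H. *)
Definition is_interior_tensor (R : realType) (B A : cstar R)
    (X : imprimitivity B A) (H : hilbert R) (rho : rep A H)
    (T : hilbert R) (tens : X -> H -> T) : Prop :=
  [/\ forall (c : R[i]) (x y : X) (h : H),
        tens (c *: x + y) h = c *: tens x h + tens y h,
      forall (c : R[i]) (x : X) (h k : H),
        tens x (c *: h + k) = c *: tens x h + tens x k,
      forall (x y : X) (h k : H),
        hip (tens x h) (tens y k) = hip h (rho (rip x y) k) &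
      closure (lspan [set v | exists x h, v = tens x h]) = setT].

(* sigma is the representation of B on T = X (x)_{A,rho} H induced from rho
   via X. *)
Definition is_induced (R : realType) (B A : cstar R)
    (X : imprimitivity B A) (H T : hilbert R) (tens : X -> H -> T)
    (sigma : rep B T) : Prop :=
  forall (b : B) (x : X) (h : H), sigma b (tens x h) = tens (lact b x) h.

Definition Cint (d : measure_display) (T : measurableType d) (R : realType)
    (mu : {measure set T -> \bar R}) (f : T -> R[i]) : R[i] :=
  Complex (\int[mu]_x complex.Re (f x)) (\int[mu]_x complex.Im (f x)).

Notation leb R := (@lebesgue_measure R).

Definition normsq (R : realType) (z : R[i]) : R :=
  complex.Re z ^+ 2 + complex.Im z ^+ 2.

Definition square_integrable (R : realType) (f : R -> R[i]) : Prop :=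
  [/\ measurable_fun [set: R] (fun x => complex.Re (f x)),
      measurable_fun [set: R] (fun x => complex.Im (f x)) &
      (\int[leb R]_x (normsq (f x))%:E < +oo)%E].

Definition L2ip (R : realType) (f g : R -> R[i]) : R[i] :=
  Cint (leb R) (fun x => (f x)^* * g x).

(* H is L^2(R), cls sending a square-integrable function to its class. *)
Definition is_L2R (R : realType) (H : hilbert R) (cls : (R -> R[i]) -> H) :
    Prop :=
  [/\ forall (c : R[i]) (f g : R -> R[i]),
        square_integrable f -> square_integrable g ->
        cls (fun x => c * f x + g x) = c *: cls f + cls g,
      forall f g : R -> R[i], square_integrable f -> square_integrable g ->
        hip (cls f) (cls g) = L2ip f g &
      forall v : H, exists2 f, square_integrable f & cls f = v].

Definition square_summable (R : realType) (a : int -> R[i]) : Prop :=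
  (\esum_(n in [set: int]) (normsq (a n))%:E < +oo)%E.

(* H is l^2(Z), vec being the identification of square-summable families with
   vectors. *)
Definition is_l2Z (R : realType) (H : hilbert R) (vec : (int -> R[i]) -> H) :
    Prop :=
  [/\ forall (c : R[i]) (a b : int -> R[i]),
        square_summable a -> square_summable b ->
        vec (fun n => c * a n + b n) = c *: vec a + vec b,
      forall a b : int -> R[i], square_summable a -> square_summable b ->
        (\sum_(0 <= n < N) ((a n%:Z)^* * b n%:Z
           + (a (- n.+1%:Z))^* * b (- n.+1%:Z)) : R[i]^o) @[N --> \oo]
        --> (hip (vec a) (vec b) : R[i]^o) &
      forall v : H, exists2 a, square_summable a & vec a = v].

Definition delta_seq (R : realType) (n : int) : int -> R[i] :=
  fun k => (k == n)%:R.

Definition C0 (R : realType) (f : R -> R[i]) : Prop :=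
  [/\ continuous (f : R -> R[i]^o),
      f x @[x --> +oo] --> (0 : R[i]^o) &
      f x @[x --> -oo] --> (0 : R[i]^o)].

Definition Cc (R : realType) (T : topologicalType) (f : T -> R[i]) : Prop :=
  continuous (f : T -> R[i]^o) /\ compact (closure [set x | f x != 0]).

Definition expi (R : realType) (t : R) : R[i] :=
  Complex (cos (2 * pi * t)) (sin (2 * pi * t)).

Definition fourier (R : realType) (g : R -> R[i]) : R -> R[i] :=
  fun x => Cint (leb R) (fun t => expi (t * x) * g t).

Definition is_half (q : rat) : Prop :=
  exists (l : int) (i : nat), q = l%:~R / 2 ^+ i.

Lemma is_halfD q r : is_half q -> is_half r -> is_half (q + r).
Proof.
move=> [l [i ->]] [m [j ->]].
exists (l * 2 ^+ j + m * 2 ^+ i), (i + j)%N.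
have n0 k : (2 : rat) ^+ k != 0 by rewrite expf_neq0.
by rewrite rmorphD !rmorphM !rmorphXn /= addf_div // exprD.
Qed.

Lemma is_halfN q : is_half q -> is_half (- q).
Proof. by move=> [l [i ->]]; exists (- l), i; rewrite rmorphN mulNr. Qed.

Lemma is_halfZ (k : int) q : is_half q -> is_half (2 ^ k * q).
Proof.
move=> [l [i ->]]; case: k => k.
  by exists (2 ^+ k * l), i; rewrite rmorphM rmorphXn /= mulrA.
exists l, (k.+1 + i)%N.
by rewrite NegzE -exprnN exprD invfM mulrCA.
Qed.

Definition Zhalf : Type := set_type [set q : rat | is_half q].

Lemma Zhalf_is_half (q : Zhalf) : is_half (val q).
Proof. by have := valP q; rewrite inE. Qed.

Definition mkZhalf (q : rat) (hq : is_half q) : Zhalf := SigSub (mem_set hq).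

(* The pair (b, i) stands for the element (b, 2^i) of Z[1/2] x| <2>. *)
Definition aff : choiceType := (Zhalf * int)%type.

Definition aff_mul (g h : aff) : aff :=
  (mkZhalf (is_halfD (Zhalf_is_half g.1) (is_halfZ g.2 (Zhalf_is_half h.1))),
   g.2 + h.2).

Definition aff_inv (g : aff) : aff :=
  (mkZhalf (is_halfN (is_halfZ (- g.2) (Zhalf_is_half g.1))), - g.2).

Definition aff_act (R : realType) (g : aff) (f : R -> R[i]) : R -> R[i] :=
  fun x => f (2 ^ (- g.2) * (x - ratr (val g.1))).

Definition CcG (R : realType) (F : aff -> R -> R[i]) : Prop :=
  finite_set [set g | exists x, F g x != 0] /\ forall g, C0 (F g).

Definition cp_mul (R : realType) (F F' : aff -> R -> R[i]) : aff -> R -> R[i] :=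
  fun g x => \sum_(h \in [set: aff])
    F h x * aff_act h (F' (aff_mul (aff_inv h) g)) x.

Definition cp_adj (R : realType) (F : aff -> R -> R[i]) : aff -> R -> R[i] :=
  fun g => aff_act g (fun x => (F (aff_inv g) x)^*).

Definition cp_hom (R : realType) (B : cstar R)
    (j : (aff -> R -> R[i]) -> B) : Prop :=
  [/\ forall (c : R[i]) F F', CcG F -> CcG F' ->
        j (fun g x => c * F g x + F' g x) = c *: j F + j F',
      forall F F', CcG F -> CcG F' -> j (cp_mul F F') = j F ** j F' &
      forall F, CcG F -> j (cp_adj F) = (j F)^†].

(* With G = Z[1/2] x| <2>, B is the enveloping C*-algebra of the *-algebra
   C_c(G, C_0(R)) (CcG, cp_mul, cp_adj): the full crossed product, which is
   also the reduced one since G is amenable.  A *-homomorphism from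
   C_c(G, C_0(R)) to a C*-algebra is automatically bounded for the l^1-norm,
   since it is contractive on each copy of the C*-algebra C_0(R). *)
Definition is_crossed_product (R : realType) (B : cstar R)
    (j : (aff -> R -> R[i]) -> B) : Prop :=
  [/\ cp_hom j,
      closure [set b | exists2 F, CcG F & b = j F] = setT &
      forall (D : cstar R) (k : (aff -> R -> R[i]) -> D), cp_hom k ->
        exists2 Phi : B -> D, star_hom Phi & forall F, CcG F -> Phi (j F) = k F].

Definition cp_elem (R : realType) (f : R -> R[i]) (g : aff) :
    aff -> R -> R[i] :=
  fun h x => if h == g then f x else 0.

Definition Q2_relations (R : realType) (A : cstar R) (one u s : A) : Prop :=
  [/\ forall a : A, one ** a = a /\ a ** one = a,
      u^† ** u = one /\ u ** u^† = one,
      s^† ** s = one,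
      s ** u = u ** u ** s &
      s ** s^† + u ** s ** s^† ** u^† = one].

Definition is_Q2 (R : realType) (A : cstar R) (one u s : A) : Prop :=
  [/\ Q2_relations one u s,
      forall S : set A, closed S -> S u -> S s ->
        (forall (c : R[i]) (x y : A), S x -> S y -> S (c *: x + y)) ->
        (forall x y : A, S x -> S y -> S (x ** y)) ->
        (forall x : A, S x -> S x^†) -> S = setT &
      forall (D : cstar R) (one' u' s' : D), Q2_relations one' u' s' ->
        exists2 Phi : A -> D, star_hom Phi &
          [/\ Phi one = one', Phi u = u' & Phi s = s']].

Definition cpow (R : realType) (A : cstar R) (one x : A) (n : nat) : A :=
  iter n (cmul x) one.

Definition upow (R : realType) (A : cstar R) (one u : A) (n : int) : A :=
  match n with
  | Posz k => cpow one u k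
  | Negz k => cpow one u^† k.+1
  end.

Definition Q2proj (R : realType) (A : cstar R) (one u s : A)
    (l : int) (k : nat) : A :=
  upow one u l ** cpow one s k ** (cpow one s k)^† ** upow one u (- l).

(* z n is the residue of z modulo 2^n. *)
Definition Z2set : set (prod_topology (fun _ : nat => nat)) :=
  [set z | forall n, z n = (z n.+1 %% 2 ^ n)%N].

Definition Z2 : topologicalType := set_type Z2set.

Definition Z2res (z : Z2) (n : nat) : nat := val z n.

Lemma Z2resE (z : Z2) n : Z2res z n = (Z2res z n.+1 %% 2 ^ n)%N.
Proof. by have := valP z; rewrite inE; exact. Qed.

Lemma modn_exp2 m n : (m %% 2 ^ n.+1 = m %[mod 2 ^ n])%N.
Proof. by rewrite modn_dvdm // dvdn_exp2l. Qed.

Definition mkZ2 (f : nat -> nat) (hf : forall n, f n = (f n.+1 %% 2 ^ n)%N) :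
  Z2 := SigSub (mem_set (hf : Z2set f)).

Lemma Z2add_subproof (z w : Z2) n :
  ((Z2res z n + Z2res w n) %% 2 ^ n
   = ((Z2res z n.+1 + Z2res w n.+1) %% 2 ^ n.+1) %% 2 ^ n)%N.
Proof. by rewrite modn_exp2 (Z2resE z) (Z2resE w) modnDm. Qed.

Definition Z2add (z w : Z2) : Z2 := mkZ2 (Z2add_subproof z w).

Lemma Z2mul_subproof (z w : Z2) n :
  ((Z2res z n * Z2res w n) %% 2 ^ n
   = ((Z2res z n.+1 * Z2res w n.+1) %% 2 ^ n.+1) %% 2 ^ n)%N.
Proof. by rewrite modn_exp2 (Z2resE z) (Z2resE w) modnMm. Qed.

Definition Z2mul (z w : Z2) : Z2 := mkZ2 (Z2mul_subproof z w).

Lemma Z2int_subproof (l : int) n :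
  (`|(l %% (2 ^ n)%N)%Z| = `|(l %% (2 ^ n.+1)%N)%Z| %% 2 ^ n)%N.
Proof.
have p k : (2 ^ k)%N%:Z != 0 by rewrite -lt0n expn_gt0.
apply/eqP; rewrite -eqz_nat -modz_nat !gez0_abs ?modz_ge0 //; apply/eqP.
rewrite {1}(divz_eq l (2 ^ n.+1)%N) expnSr mulnC PoszM mulrA.
by rewrite modzMDl.
Qed.

Definition Z2int (l : int) : Z2 := mkZ2 (Z2int_subproof l).

Definition Z2coset (l : int) (k : nat) : set Z2 :=
  [set z | exists w : Z2, z = Z2add (Z2int l) (Z2mul (Z2int (2 ^+ k)) w)].

(* A representative in Z[1/2] of p(z q), for z in Z_2 and q in Z[1/2].  With
   q = l / 2^i in lowest terms, z q = w / 2^i where w = l z is in Z_2, and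
   Q_2/Z_2 = Z[1/2]/Z identifies the class of w / 2^i with that of
   (w mod 2^i) / 2^i. *)
Definition p2 (z : Z2) (q : rat) : rat :=
  let i := logn 2 `|denq q|%N in
  (Z2res (Z2mul (Z2int (numq q)) z) i)%:R / 2 ^+ i.

(* Z_2 x (R x| <2>), the element (t, 2^i) of R x| <2> being the pair (t, i). *)
Definition Xdom (R : realType) : topologicalType :=
  (Z2 * (R * discrete_topology int))%type.

Definition X0_elem (R : realType) (l : int) (k : nat) (xi : R -> R[i])
    (m : int) : Xdom R -> R[i] :=
  fun q => \1_(Z2coset l k) q.1 * xi q.2.1 * (q.2.2 == m)%:R.

Definition X0_u (R : realType) (phi : Xdom R -> R[i]) : Xdom R -> R[i] :=
  fun q => phi (Z2add q.1 (Z2int 1), (q.2.1 + 1, q.2.2)).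

Definition X0_s (R : realType) (phi : Xdom R -> R[i]) : Xdom R -> R[i] :=
  fun q => phi (Z2mul (Z2int 2) q.1, (2 * q.2.1, (q.2.2 : int) - 1)).

(* The left action of f (x) 1_{(d,c)}, where c = 2^g.2 and fc is the inverse
   Fourier transform of f. *)
Definition X0_left (R : realType) (fc : R -> R[i]) (g : aff)
    (phi : Xdom R -> R[i]) : Xdom R -> R[i] :=
  fun q =>
    let z := q.1 in let t := q.2.1 in let i : int := q.2.2 in
    let d : rat := val g.1 in
    Complex (Num.sqrt (2 ^ g.2)) 0 * expi (- ratr (p2 z (2 ^ i * d)))
    * expi (t * 2 ^ i * ratr d)
    * Cint (leb R) (fun s =>
        expi (s * ratr d) * fc s * phi (z, (t + s * 2 ^ (- i), i + g.2))).

(* The right inner product of the functions 1_{l_i + 2^{k_i} Z_2} (x) xi_i (x)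
   1_{2^{m_i}}; in the second one b = 2^(m2 - m1) n runs through
   2^(m2 - m1) Z, and 2^(m1 - m2) b = n. *)
Definition X0_ip_le (R : realType) (A : cstar R) (one u s : A)
    (l1 : int) (k1 : nat) (xi1 : R -> R[i]) (m1 : int)
    (l2 : int) (k2 : nat) (xi2 : R -> R[i]) (m2 : int) : A :=
  (2 ^ m1 : R[i]) *: \sum_(b \in [set: int])
    L2ip xi1 (fun t => xi2 ((t + b%:~R) * 2 ^ (m1 - m2))) *:
    (Q2proj one u s l1 k1 ** upow one u (- b) ** cpow one s `|m2 - m1|%N
     ** Q2proj one u s l2 k2).

Definition X0_ip_ge (R : realType) (A : cstar R) (one u s : A)
    (l1 : int) (k1 : nat) (xi1 : R -> R[i]) (m1 : int)
    (l2 : int) (k2 : nat) (xi2 : R -> R[i]) (m2 : int) : A :=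
  (2 ^ m1 : R[i]) *: \sum_(n \in [set: int])
    L2ip xi1 (fun t => xi2 ((t + 2 ^ (m2 - m1) * n%:~R) * 2 ^ (m1 - m2))) *:
    (Q2proj one u s l1 k1 ** (cpow one s `|m1 - m2|%N)^† ** upow one u (- n)
     ** Q2proj one u s l2 k2).

(* X is the completion of X_0, iota being the canonical map.  The
   clause [X_indlim] says that iota is continuous for the inductive limit
   topology of X_0 = C_c(Z_2 x (R x| <2>)), so that the values of the right
   inner product on the functions [X0_elem] determine it on X_0. *)
Record is_bimodule_X (R : realType) (B Q : cstar R)
    (j : (aff -> R -> R[i]) -> B) (one u s : Q) (X : imprimitivity B Q)
    (iota : (Xdom R -> R[i]) -> X) : Prop := {
  X_linear : forall (c : R[i]) phi psi, Cc phi -> Cc psi ->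
    iota (fun q => c * phi q + psi q) = c *: iota phi + iota psi;
  X_indlim : forall K : set (Xdom R), compact K ->
    exists M : R[i], forall (phi : Xdom R -> R[i]) (C : R[i]), Cc phi ->
      (forall q, phi q != 0 -> K q) -> (forall q, `|phi q| <= C) ->
      `|iota phi| <= M * C;
  X_dense : closure [set x | exists2 phi, Cc phi & x = iota phi] = setT;
  X_rip_le : forall l1 k1 xi1 m1 l2 k2 xi2 m2, Cc xi1 -> Cc xi2 ->
    m1 <= m2 ->
    rip (iota (X0_elem l1 k1 xi1 m1)) (iota (X0_elem l2 k2 xi2 m2))
    = X0_ip_le one u s l1 k1 xi1 m1 l2 k2 xi2 m2;
  X_rip_ge : forall l1 k1 xi1 m1 l2 k2 xi2 m2, Cc xi1 -> Cc xi2 ->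
    m2 <= m1 ->
    rip (iota (X0_elem l1 k1 xi1 m1)) (iota (X0_elem l2 k2 xi2 m2))
    = X0_ip_ge one u s l1 k1 xi1 m1 l2 k2 xi2 m2;
  X_ract_u : forall phi, Cc phi -> ract (iota phi) u = iota (X0_u phi);
  X_ract_s : forall phi, Cc phi -> ract (iota phi) s = iota (X0_s phi);
  X_lact : forall (f fc : R -> R[i]) (g : aff) phi,
    Cc fc -> f = fourier fc -> Cc phi ->
    lact (j (cp_elem f g)) (iota phi) = iota (X0_left fc g phi) }.

Definition is_lambda2 (R : realType) (Q : cstar R) (u s : Q)
    (H : hilbert R) (vec : (int -> R[i]) -> H) (lambda2 : rep Q H) : Prop :=
  forall n : int,
    lambda2 u (vec (delta_seq R n)) = vec (delta_seq R (n + 1)) /\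
    lambda2 s (vec (delta_seq R n)) = vec (delta_seq R (2 * n)).

Definition is_pi (R : realType) (B : cstar R) (j : (aff -> R -> R[i]) -> B)
    (H : hilbert R) (cls : (R -> R[i]) -> H) (pi : rep B H) : Prop :=
  forall (f : R -> R[i]) (g : aff) (xi : R -> R[i]),
    C0 f -> square_integrable xi ->
    pi (j (cp_elem f g)) (cls xi)
    = cls (fun x => f x * Complex (Num.sqrt (2 ^ (- g.2))) 0
                    * xi (2 ^ (- g.2) * (x - ratr (val g.1)))).

(* Main.v *)
Require Import Defs.
From HB Require Import structures.
From mathcomp Require Import all_boot all_order all_algebra.
From mathcomp Require Import all_classical all_reals all_analysis.
From mathcomp Require Import complex.
From mathcomp Require Import measurable_realfun.
From mathcomp Require Import ring lra zify.

(** Write [w eta = (1_{Z_2} (x) eta (x) 1_{1}) (x) eps_0] for [eta] in [C_c(R)].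
    The formula for the right inner product shows that [w] is isometric for the
    [L^2]-norm and that the tensor of [1_{l + k Z_2} (x) xi (x) 1_{m}] with
    [eps_n] is either 0 or [w (y |-> xi (n + y / m))], so that the vectors
    [w eta] are dense in the induced space.  The left action maps [w eta] to
    [w zeta], where [zeta] arises from [eta] by translations, dilations and
    multiplication by characters; on the Fourier side these become dilations,
    translations and multiplication by a function of [C_0(R)], which is the
    action of [pi].  Hence [F^{-1} eta |-> w eta] extends to the required
    unitary.  The Fourier inversion is only used up to a positive constant,
    the integral of the Fejér kernel. *)

Set Implicit Arguments.
Unset Strict Implicit.
Unset Printing Implicit Defensive.
Import Order.TTheory GRing.Theory Num.Theory.
Import numFieldNormedType.Exports.
Import ComplexField.Normc.

Local Open Scope classical_set_scope.
Local Open Scope complex_scope.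
Local Open Scope ring_scope.

Local Notation Re := complex.Re.
Local Notation Im := complex.Im.


(** * Complex numbers, Hilbert spaces and isometries *)

Section complex_numbers.
Context {R : realType}.
Implicit Types (z w : R[i]).

(** The spaces and algebras are known only through models, so the unitary is built as a relation:
    the closure of the pairs [(C^{-1/2} F^{-1} eta, w eta)], with [eta] in [C_c(R)] and [C] the
    integral of the kernel. Norm preservation makes it functional, completeness makes it total, and
    its symmetry yields surjectivity. The main obstacle is the crossed product. The left action is
    given only for [f] whose inverse transform has compact support, whereas the algebra is the
    closure of finite sums with coefficients anywhere in [C_0(R)], and no norm estimate for [j] is
    part of the model. Both representations therefore have to be bounded by the sup norm of [f] at a
    fixed group element. The bound is algebraic: if [a^† a = 2 M b - b^2] with [b] self-adjoint,
    then every representation satisfies [|a x| <= M |x|], and such a [b] is found inside [C_0(R)].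
    The same device, run in a C*-algebra that may lack a unit, makes all representations
    contractive. The 2-adic phase of the left action disappears on the vectors [w eta], because
    [eps_0] selects the coset of 0 in [Z_2]. *)

Lemma conjE (z : R[i]) : (Num.conj z) = Complex (Re z) (- Im z).
Proof. by case: z. Qed.

Lemma complex_eqP z w : Re z = Re w -> Im z = Im w -> z = w.
Proof. by case: z w => [a b] [c d] /= -> ->. Qed.

Lemma cReD z w : Re (z + w) = Re z + Re w. Proof. by case: z w => ? ? [? ?]. Qed.
Lemma cImD z w : Im (z + w) = Im z + Im w. Proof. by case: z w => ? ? [? ?]. Qed.
Lemma cReN z : Re (- z) = - Re z. Proof. by case: z. Qed.
Lemma cImN z : Im (- z) = - Im z. Proof. by case: z. Qed.
Lemma cReM z w : Re (z * w) = Re z * Re w - Im z * Im w.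
Proof. by case: z w => ? ? [? ?]. Qed.
Lemma cImM z w : Im (z * w) = Re z * Im w + Im z * Re w.
Proof. by case: z w => ? ? [? ?]. Qed.
Lemma cReJ z : Re (Num.conj z) = Re z. Proof. by case: z. Qed.
Lemma cImJ z : Im (Num.conj z) = - Im z. Proof. by case: z. Qed.

Lemma conj_real (a : R) : Num.conj (a%:C) = a%:C :> R[i].
Proof. by rewrite conjE /= oppr0. Qed.

Lemma sqr_normc_normsq z : normc z ^+ 2 = normsq z.
Proof.
by case: z => a b; rewrite /normc /normsq sqr_sqrtr // addr_ge0 ?sqr_ge0.
Qed.

Lemma mulJ_normsq z : Num.conj z * z = (normsq z)%:C.
Proof. case: z => a b; rewrite /normsq; simpc; congr Complex; rewrite /=; ring. Qed.

Lemma normc_ge0 z : 0 <= normc z.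
Proof. by case: z => a b; rewrite sqrtr_ge0. Qed.

Lemma normsq_ge0 z : 0 <= normsq z.
Proof. by rewrite addr_ge0 ?sqr_ge0. Qed.

Lemma normRe_le z : `|Re z| <= normc z.
Proof. by rewrite -lecR; exact: normc_ge_Re. Qed.

Lemma normIm_le z : `|Im z| <= normc z.
Proof.
case: z => a b /=; rewrite -sqrtr_sqr ler_wsqrtr // lerDr sqr_ge0 //.
Qed.

Lemma normc_le z : normc z <= `|Re z| + `|Im z|.
Proof.
case: z => a b; rewrite /normc /= -(ler_sqr _) ?nnegrE ?addr_ge0 ?sqrtr_ge0 //.
rewrite sqr_sqrtr ?addr_ge0 ?sqr_ge0 // sqrrD !real_normK ?num_real //.
by rewrite lerD2r lerDl mulrn_wge0 ?mulr_ge0.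
Qed.

Lemma normc_real (a : R) : normc a%:C = `|a|.
Proof. by rewrite /normc /= expr0n addr0 sqrtr_sqr. Qed.

End complex_numbers.

Section real_norm.
Context {R : realType}.

(** Norms over [R[i]] take values in [R[i]]. The real part loses nothing, by [nmE], and gives access
    to real order arguments. *)
Definition nm (V : normedModType R[i]) (x : V) : R := Re `|x|.

Context {V : normedModType R[i]}.
Implicit Types (x y : V).

Lemma nmE x : `|x| = (nm x)%:C.
Proof. by rewrite /nm RRe_real // ger0_real. Qed.

Lemma nm_ge0 x : 0 <= nm x.
Proof. by rewrite -lecR -nmE; exact: normr_ge0. Qed.

Lemma nm_eq0 x : nm x = 0 -> x = 0.
Proof. by move=> h; apply/normr0_eq0; rewrite nmE h. Qed.

Lemma nm0 : nm (0 : V) = 0. Proof. by rewrite /nm normr0. Qed.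

Lemma nmD x y : nm (x + y) <= nm x + nm y.
Proof. by rewrite -lecR rmorphD /= -!nmE ler_normD. Qed.

Lemma nmN x : nm (- x) = nm x. Proof. by rewrite /nm normrN. Qed.

Lemma nmB x y : nm (x - y) = nm (y - x).
Proof. by rewrite -nmN opprB. Qed.

Lemma nmZ (c : R[i]) x : nm (c *: x) = normc c * nm x.
Proof. by apply: complexI; rewrite rmorphM /= -!nmE normrZ. Qed.

Lemma nm_triangle y x z : nm (x - z) <= nm (x - y) + nm (y - z).
Proof. by rewrite -(subrKA y x) nmD. Qed.

Lemma closure_nmP (S : set V) x :
  closure S x <-> forall e : R, 0 < e -> exists2 y, S y & nm (y - x) < e.
Proof.
split=> [cl e e0|h B /nbhs_ballP[e /= e0 eB]].
- have e0' : 0 < e%:C by rewrite ltcR.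
  have [y [Sy]] := cl _ (nbhsx_ballx x e%:C e0').
  by rewrite -ball_normE /= => xy; exists y => //; rewrite -ltcR nmB -nmE.
- have e1 : 0 < Re e by move: e0; rewrite ltcE => /andP[].
  have [y Sy yx] := h _ e1; exists y; split => //; apply: eB.
  rewrite -ball_normE /= nmE; have -> : e = (Re e)%:C.
    by rewrite RRe_real // gtr0_real.
  by rewrite ltcR nmB.
Qed.

Lemma cvg_nmP (T : Type) (F : set_system T) {FF : Filter F} (f : T -> V) (l : V) :
  f @ F --> l <-> forall e : R, 0 < e -> \forall t \near F, nm (l - f t) < e.
Proof.
split=> [/cvgrPdist_lt h e e0|h].
- have e0' : 0 < e%:C by rewrite ltcR.
  have := h _ e0'; apply: filterS => t.
  by rewrite nmE ltcR.
- apply/cvgrPdist_lt => e e0.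
  have e1 : 0 < Re e by move: e0; rewrite ltcE => /andP[].
  have := h _ e1; apply: filterS => t.
  have {2}-> : e = (Re e)%:C by rewrite RRe_real // gtr0_real.
  by rewrite nmE ltcR.
Qed.

End real_norm.

Section real_limit.
Context {R : realType} {V : completeNormedModType R[i]}.

Lemma nm_complete (v : nat -> V) :
  (forall e : R, 0 < e -> exists N, forall n, (N <= n)%N -> nm (v n - v N) < e) ->
  exists l, forall e : R, 0 < e ->
    exists N, forall n, (N <= n)%N -> nm (l - v n) < e.
Proof.
move=> h; have : cauchy (v @ \oo).
  apply: cauchy_exP => e e0.
  have e1 : 0 < Re e by move: e0; rewrite ltcE => /andP[].
  have [N hN] := h _ e1; exists (v N); exists N => // n /= Nn.
  rewrite -ball_normE /= nmE; have -> : e = (Re e)%:C.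
    by rewrite RRe_real // gtr0_real.
  by rewrite ltcR nmB hN.
move=> /cauchy_cvgP /cvg_nmP vl; exists (lim (v @ \oo)) => e e0.
by have [N _ hN] := vl _ e0; exists N => n Nn; apply: hN.
Qed.

End real_limit.

Section hilbert_theory.
Context {R : realType} {H : hilbert R}.
Implicit Types (x y z : H) (c : R[i]).

Lemma hipDr x y z : hip x (y + z) = hip x y + hip x z.
Proof. by have := hip_linear 1 x y z; rewrite scale1r mul1r. Qed.
Lemma hip0r x : hip x 0 = 0.
Proof. by apply: (addIr (hip x 0)); rewrite -hipDr !add0r. Qed.
Lemma hipZr c x y : hip x (c *: y) = c * hip x y.
Proof. by have := hip_linear c x y 0; rewrite addr0 hip0r addr0. Qed.
Lemma hipDl x y z : hip (x + y) z = hip x z + hip y z.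
Proof. by rewrite hip_sym hipDr rmorphD /= -!hip_sym. Qed.
Lemma hipZl c x y : hip (c *: x) y = Num.conj c * hip x y.
Proof. by rewrite hip_sym hipZr rmorphM /= -!hip_sym. Qed.
Lemma hip0l x : hip 0 x = 0.
Proof. by rewrite hip_sym hip0r rmorph0. Qed.
Lemma hipNr x y : hip x (- y) = - hip x y.
Proof. by rewrite -scaleN1r hipZr mulN1r. Qed.
Lemma hipBr x y z : hip x (y - z) = hip x y - hip x z.
Proof. by rewrite hipDr hipNr. Qed.

Lemma hip_nm x : hip x x = (nm x ^+ 2)%:C.
Proof. by rewrite -hip_norm nmE rmorphXn. Qed.

Lemma Re_hip_sym x y : Re (hip x y) = Re (hip y x).
Proof. by rewrite hip_sym cReJ. Qed.

Lemma nmD_sqr x y : nm (x + y) ^+ 2 = nm x ^+ 2 + nm y ^+ 2 + 2 * Re (hip x y).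
Proof.
apply: complexI; rewrite -hip_nm hipDl !hipDr !hip_nm.
apply: complex_eqP; rewrite !(cReD, cImD) /=.
  by rewrite (Re_hip_sym y x); ring.
by rewrite (hip_sym y x) cImJ; ring.
Qed.

Lemma nmB_sqr x y : nm (x - y) ^+ 2 = nm x ^+ 2 + nm y ^+ 2 - 2 * Re (hip x y).
Proof. by rewrite nmD_sqr nmN hipNr cReN mulrN. Qed.

Lemma CauchySchwarz_Re x y : Re (hip x y) <= nm x * nm y.
Proof.
have [x0|x0] := eqVneq (nm x) 0.
  by rewrite (nm_eq0 x0) hip0l nm0 mul0r.
have [y0|y0] := eqVneq (nm y) 0.
  by rewrite (nm_eq0 y0) hip0r nm0 mulr0.
have a0 : 0 < nm x by rewrite lt_def x0 nm_ge0.
have b0 : 0 < nm y by rewrite lt_def y0 nm_ge0.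
(* The squared norm of [|y| x - |x| y] is [2 |x| |y| (|x| |y| - Re <x, y>)]. *)
have := sqr_ge0 (nm ((nm y)%:C *: x - (nm x)%:C *: y)).
rewrite nmB_sqr !nmZ !normc_real !ger0_norm ?nm_ge0 // hipZl hipZr.
rewrite -(conjc_real (nm y)) conjE /= opprK !cReM !cImM /= => h.
have : 0 <= 2 * (nm x * nm y) * (nm x * nm y - Re (hip x y)) by nra.
by rewrite pmulr_rge0 ?subr_ge0 // !mulr_gt0.
Qed.

(** The expansion of [|x - y|^2] vanishes. Vectors of the induced space are accessible only through
    inner products, and this is how two of them are identified. *)
Lemma hip_eq_nm x y : hip x x = hip x y -> hip y y = hip x y -> x = y.
Proof.
move=> h1 h2; apply/eqP; rewrite -subr_eq0; apply/eqP; apply: nm_eq0.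
have : nm (x - y) ^+ 2 = 0.
  have := congr1 (@complex.Re R) (hip_nm x); have := congr1 (@complex.Re R) (hip_nm y).
  by rewrite /= nmB_sqr h1 h2 => <- <-; ring.
by move/eqP; rewrite expf_eq0 => /andP[_ /eqP].
Qed.

End hilbert_theory.

(** * Extension of densely defined isometries *)

Section isometry_extension.
Context {R : realType} {H K : hilbert R} (I : Type) (a : I -> H) (w : I -> K).
Hypothesis lin : forall (c : R[i]) i k, exists m,
  a m = c *: a i + a k /\ w m = c *: w i + w k.
Hypothesis iso : forall i, nm (a i) = nm (w i).
Hypothesis dense : forall x (e : R), 0 < e -> exists i, nm (a i - x) < e.

(** The closure of the set of pairs [(a i, w i)] in the product. As a relation it involves no choice
    of a preimage under [a], and exchanging [a] and [w] gives the inverse. *)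
Definition graph_closure (x : H) (z : K) : Prop :=
  forall e : R, 0 < e -> exists i, nm (a i - x) < e /\ nm (w i - z) < e.

Lemma isoB i k : nm (a i - a k) = nm (w i - w k).
Proof.
have [m [am wm]] := lin (-1) k i.
by rewrite addrC -scaleN1r -am iso wm scaleN1r addrC.
Qed.

Lemma graph_closure_nm x z : graph_closure x z -> nm x = nm z.
Proof.
move=> g; apply/eqP; rewrite eq_le; apply/andP; split; apply/ler_addgt0Pl => e e0.
- have e2 : 0 < e / 2 by rewrite divr_gt0.
  have [i [h1 h2]] := g _ e2.
  have := nmD (x - a i) (a i); rewrite subrK => h3.
  have := nmD (w i - z) z; rewrite subrK => h4.
  rewrite nmB in h1; rewrite iso in h3; lra.
- have e2 : 0 < e / 2 by rewrite divr_gt0.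
  have [i [h1 h2]] := g _ e2.
  have := nmD (a i - x) x; rewrite subrK => h3.
  have := nmD (z - w i) (w i); rewrite subrK => h4.
  rewrite nmB in h2; rewrite iso in h3; lra.
Qed.

Lemma graph_closure_linear (c : R[i]) x y z t :
  graph_closure x z -> graph_closure y t -> graph_closure (c *: x + y) (c *: z + t).
Proof.
move=> g1 g2 e e0; pose d := e / (normc c + 2).
have c0 := normc_ge0 c.
have d0 : 0 < d by rewrite divr_gt0 // ltr_wpDl.
have hd : e = normc c * d + 2 * d by rewrite /d; field; rewrite gt_eqF // ltr_wpDl.
have [i [ai wi]] := g1 _ d0; have [k [ak wk]] := g2 _ d0.
have [m [am wm]] := lin c i k; exists m; rewrite am wm; split.
- rewrite opprD addrACA -scalerBr; apply: le_lt_trans (nmD _ _) _.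
  rewrite nmZ; nra.
- rewrite opprD addrACA -scalerBr; apply: le_lt_trans (nmD _ _) _.
  rewrite nmZ; nra.
Qed.

(** The difference of the two pairs is [(0, z - t)], and related vectors have equal norms. *)
Lemma graph_closure_fun x z t : graph_closure x z -> graph_closure x t -> z = t.
Proof.
move=> g1 g2; have := graph_closure_linear (-1) g2 g1.
rewrite !scaleN1r !(addrC (- _)) subrr => /graph_closure_nm; rewrite nm0 => /esym.
by move=> /nm_eq0 /eqP; rewrite subr_eq0 => /eqP.
Qed.

(** By [isoB], a sequence of vectors [a i] converging to [x] makes the corresponding [w i] a Cauchy
    sequence, and [K] is complete. *)
Lemma graph_closure_total x : exists z, graph_closure x z.
Proof.
have h n : exists i, nm (a i - x) < n.+1%:R^-1 by apply: dense; rewrite invr_gt0.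
have [s hs] := choice h.
have small (e : R) : 0 < e -> exists N, forall n, (N <= n)%N -> n.+1%:R^-1 < e.
  move=> e0; have [N _ hN] := near_infty_natSinv_lt (PosNum e0).
  by exists N => n Nn; apply: hN.
have [e e0|z hz] := @nm_complete _ K (fun n => w (s n)).
  have e2 : 0 < e / 2 by rewrite divr_gt0.
  have [N hN] := small _ e2; exists N => n Nn.
  rewrite -isoB; apply: le_lt_trans (nm_triangle x _ _) _.
  rewrite [X in _ + X]nmB.
  have := lt_trans (hs n) (hN _ Nn); have := lt_trans (hs N) (hN _ (leqnn N)).
  by lra.
exists z => e e0; have [N hN] := hz _ e0; have [M hM] := small _ e0.
exists (s (maxn N M)); split.
  by apply: lt_trans (hs _) _; rewrite hM // leq_maxr.
by rewrite nmB hN // leq_maxl.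
Qed.

End isometry_extension.

(** Polarization: the norm of [x + y] determines the real part, and replacing [x] by [i x] yields
    the imaginary part. *)
Lemma nm_isometry_hip (R : realType) (H K : hilbert R) (U : H -> K) :
  (forall (c : R[i]) x y, U (c *: x + y) = c *: U x + U y) ->
  (forall x, nm (U x) = nm x) -> forall x y, hip (U x) (U y) = hip x y.
Proof.
move=> lin iso x y.
have rr u v : Re (hip (U u) (U v)) = Re (hip u v).
  have := nmD_sqr (U u) (U v); rewrite -[in U u + _](scale1r (U u)) -lin scale1r.
  by rewrite !iso nmD_sqr; lra.
have U0 : U 0 = 0 by apply: nm_eq0; rewrite iso nm0.
apply: complex_eqP; first exact: rr.
have h := rr ((Complex 0 1) *: x) y.
have e := lin (Complex 0 1) x 0; rewrite U0 !addr0 in e.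
by move: h; rewrite e !hipZl !cReM /= !mul0r !sub0r !mulN1r !opprK.
Qed.

Lemma graph_closure_unitary (R : realType) (H K : hilbert R) (I : Type)
    (a : I -> H) (w : I -> K) :
  (forall (c : R[i]) i k, exists m,
    a m = c *: a i + a k /\ w m = c *: w i + w k) ->
  (forall i, nm (a i) = nm (w i)) ->
  (forall x (e : R), 0 < e -> exists i, nm (a i - x) < e) ->
  (forall z (e : R), 0 < e -> exists i, nm (w i - z) < e) ->
  exists U : H -> K, [/\ forall x, graph_closure a w x (U x),
    forall (c : R[i]) (x y : H), U (c *: x + y) = c *: U x + U y,
    forall x y : H, hip (U x) (U y) = hip x y &
    forall z : K, exists x : H, U x = z].
Proof.
move=> lin iso da dw.
have [U hU] := choice (graph_closure_total lin iso da).
have Ulin (c : R[i]) (x y : H) : U (c *: x + y) = c *: U x + U y.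
  by apply: (graph_closure_fun lin iso (hU _)); exact: graph_closure_linear.
exists U; split => //.
- by apply: nm_isometry_hip => // x; rewrite -(graph_closure_nm iso (hU x)).
(* Surjectivity is totality of the relation with the two families exchanged. *)
- move=> z; have [|//|x hx] := graph_closure_total (a := w) (w := a) _ _ dw z.
    by move=> c i k; have [m [? ?]] := lin c i k; exists m.
  exists x; apply: (graph_closure_fun lin iso (hU x)).
  by move=> e e0; have [i [? ?]] := hx _ e0; exists i.
Qed.

(** * Quadratic bounds in C*-algebras *)

Local Open Scope cstar_scope.

Section cstar_theory.
Context {R : realType} {A : cstar R}.
Implicit Types (a b x y z : A) (c : R[i]).

Lemma cmul0l z : 0 ** z = 0.
Proof.
by have := cmul_linear_l (-1) 0 0 z; rewrite scaler0 addr0 scaleN1r addNr.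
Qed.
Lemma cmul0r z : z ** 0 = 0.
Proof.
by have := cmul_linear_r (-1) 0 0 z; rewrite scaler0 addr0 scaleN1r addNr.
Qed.
Lemma cmulDl x y z : (x + y) ** z = x ** z + y ** z.
Proof. by have := cmul_linear_l 1 x y z; rewrite !scale1r. Qed.
Lemma cmulDr x y z : z ** (x + y) = z ** x + z ** y.
Proof. by have := cmul_linear_r 1 x y z; rewrite !scale1r. Qed.
Lemma cmulZl c x z : (c *: x) ** z = c *: (x ** z).
Proof. by have := cmul_linear_l c x 0 z; rewrite cmul0l !addr0. Qed.
Lemma cmulZr c x z : z ** (c *: x) = c *: (z ** x).
Proof. by have := cmul_linear_r c x 0 z; rewrite cmul0r !addr0. Qed.
Lemma cmulBl x y z : (x - y) ** z = x ** z - y ** z.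
Proof. by rewrite cmulDl -scaleN1r cmulZl scaleN1r. Qed.
Lemma cmulBr x y z : z ** (x - y) = z ** x - z ** y.
Proof. by rewrite cmulDr -scaleN1r cmulZr scaleN1r. Qed.
Lemma cadjD x y : (x + y)^† = x^† + y^†.
Proof. by have := cadj_antilinear 1 x y; rewrite rmorph1 !scale1r. Qed.
Lemma cadj0 : (0 : A)^† = 0.
Proof. by apply: (addIr 0^†); rewrite -cadjD !add0r. Qed.
Lemma cadjZ c x : (c *: x)^† = Num.conj c *: x^†.
Proof. by have := cadj_antilinear c x 0; rewrite cadj0 !addr0. Qed.
Lemma cadjB x y : (x - y)^† = x^† - y^†.
Proof. by rewrite cadjD -scaleN1r cadjZ rmorphN rmorph1 scaleN1r. Qed.

Lemma nm_cmul x y : nm (x ** y) <= nm x * nm y.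
Proof. by rewrite -lecR rmorphM /= -!nmE cnormM. Qed.

Lemma nm_cstar x : nm (x^† ** x) = nm x ^+ 2.
Proof. by apply: complexI; rewrite rmorphXn /= -!nmE cnorm_cstar. Qed.

(** Cancel [|y|] in [|y|^2 = |y^† y| <= |y^†| |y|], then use that the adjoint is involutive. *)
Lemma nm_cadj x : nm x^† = nm x.
Proof.
have le y : nm y <= nm y^†.
  have [->|y0] := eqVneq (nm y) 0; first exact: nm_ge0.
  have y1 : 0 < nm y by rewrite lt_def y0 nm_ge0.
  by have := nm_cmul y^† y; rewrite nm_cstar expr2 ler_pM2r.
by apply/eqP; rewrite eq_le le -{2}(cadjK x) le.
Qed.

(* The fixed point of [b |-> (h + b^2) / 2], that is 1 - sqrt (1 - h). *)
Lemma quasi_sqrt (h : A) : h^† = h -> nm h < 1 ->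
  exists2 b : A, b^† = b & h = b + b - b ** b.
Proof.
move=> hh q1; set q := nm h in q1; have q0 : 0 <= q by exact: nm_ge0.
pose half : R[i] := (2^-1)%:C.
have nmh : normc half = 2^-1 by rewrite normc_real ger0_norm // invr_ge0.
pose F (b : A) := half *: (h + b ** b).
pose v n := iter n F 0.
have sub x y : F x - F y = half *: (x ** (x - y) + (x - y) ** y).
  by rewrite -scalerBr opprD addrACA subrr add0r cmulBr cmulBl subrKA.
(* The iterates stay in the ball of radius [q] because [(q + q^2) / 2 <= q], and on that ball [F] is
   [q]-Lipschitz, by the factorization [sub], which does not require [x] and [y] to commute. *)
have bnd n : nm (v n) <= q.
  elim: n => [|n ih]; first by rewrite nm0.
  rewrite /= nmZ nmh; have := nmD h (v n ** v n); have := nm_cmul (v n) (v n).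
  rewrite -/q -/(v n); have := nm_ge0 (v n); nra.
have ctr x y : nm x <= q -> nm y <= q -> nm (F x - F y) <= q * nm (x - y).
  move=> hx hy; rewrite sub nmZ nmh.
  have := nmD (x ** (x - y)) ((x - y) ** y).
  have := nm_cmul x (x - y); have := nm_cmul (x - y) y.
  have := nm_ge0 (x - y); nra.
have cau N k : nm (v (N + k)%N - v N) <= q ^+ N.
  elim: N => [|N ih].
    by rewrite add0n subr0 expr0; apply: le_trans (bnd _) _; exact: ltW.
  rewrite addSn exprS; apply: le_trans (ctr _ _ (bnd _) (bnd _)) _.
  by rewrite ler_wpM2l.
have small (e : R) : 0 < e -> exists N, q ^+ N < e.
  move=> e0; have : q ^+ n @[n --> \oo] --> 0 by apply: cvg_expr; rewrite ger0_norm.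
  move=> /cvgrPdist_lt /(_ _ e0) [N _ hN]; exists N.
  by have := hN N (leqnn N); rewrite sub0r normrN ger0_norm // exprn_ge0.
have [e e0|b hb] := @nm_complete _ A v.
  have [N hN] := small _ e0; exists N => n Nn.
  by rewrite -(subnKC Nn); apply: le_lt_trans (cau _ _) hN.
have appr (e : R) : 0 < e -> exists n, nm (b - v n) < e /\ nm (b - v n.+1) < e.
  move=> e0; have [N hN] := hb _ e0; exists N; split; exact: hN.
have bq : nm b <= q.
  apply/ler_addgt0Pl => e e0; have [n [h1 _]] := appr _ e0.
  have := nmD (b - v n) (v n); rewrite subrK; have := bnd n; lra.
have fix_b : b = F b.
  apply/eqP; rewrite -subr_eq0; apply/eqP; apply: nm_eq0.
  apply/eqP; rewrite eq_le nm_ge0 andbT; apply/ler_addgt0Pl => e e0.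
  have e2 : 0 < e / 2 by rewrite divr_gt0.
  have [n [h1 h2]] := appr _ e2; rewrite addr0.
  have := nm_triangle (v n.+1) b (F b); rewrite [nm (v n.+1 - _)]nmB.
  have := ctr _ _ bq (bnd n); rewrite -/(F (v n)) -[F (v n)]/(v n.+1).
  have := nm_ge0 (b - v n); nra.
exists b.
  have sa n : (v n)^† = v n.
    elim: n => [|n ih]; first exact: cadj0.
    by rewrite /= cadjZ conj_real cadjD cadjM hh -/(v n) ih.
  apply/eqP; rewrite -subr_eq0; apply/eqP; apply: nm_eq0.
  apply/eqP; rewrite eq_le nm_ge0 andbT; apply/ler_addgt0Pl => e e0.
  have e2 : 0 < e / 2 by rewrite divr_gt0.
  have [n [h1 h2]] := appr _ e2; rewrite addr0.
  have := nm_triangle (v n) b^† b; rewrite -{1}(sa n) -cadjB nm_cadj.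
  by rewrite [nm (v n - b)]nmB; lra.
have : b + b = h + b ** b.
  rewrite {1 2}fix_b /F -scalerDl -rmorphD /= (_ : 2^-1 + 2^-1 = 1 :> R); last by field.
  by rewrite scale1r.
by move=> ->; rewrite addrK.
Qed.

End cstar_theory.

(** * Contractivity of representations *)

Section rep_theory.
Context {R : realType} {A : cstar R} {H : hilbert R} (rho : rep A H).
Implicit Types (a b : A) (x y : H) (c : R[i]).

Lemma rep0l x : rho 0 x = 0.
Proof.
by have := rep_linear_alg rho (-1) 0 0 x; rewrite scaler0 addr0 scaleN1r addNr.
Qed.
Lemma rep0r a : rho a 0 = 0.
Proof.
by have := rep_linear rho a (-1) 0 0; rewrite scaler0 addr0 scaleN1r addNr.
Qed.
Lemma repDl a b x : rho (a + b) x = rho a x + rho b x.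
Proof. by have := rep_linear_alg rho 1 a b x; rewrite !scale1r. Qed.
Lemma repDr a x y : rho a (x + y) = rho a x + rho a y.
Proof. by have := rep_linear rho a 1 x y; rewrite !scale1r. Qed.
Lemma repZl c a x : rho (c *: a) x = c *: rho a x.
Proof. by have := rep_linear_alg rho c a 0 x; rewrite rep0l !addr0. Qed.
Lemma repZr c a x : rho a (c *: x) = c *: rho a x.
Proof. by have := rep_linear rho a c x 0; rewrite rep0r !addr0. Qed.
Lemma repBl a b x : rho (a - b) x = rho a x - rho b x.
Proof. by rewrite repDl -scaleN1r repZl scaleN1r. Qed.
Lemma repBr a x y : rho a (x - y) = rho a x - rho a y.
Proof. by rewrite repDr -scaleN1r repZr scaleN1r. Qed.

Lemma rep_nm_sqr a x : (nm (rho a x) ^+ 2)%:C = hip x (rho (a^† ** a) x).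
Proof. by rewrite -hip_nm -{1}(cadjK a) rep_adj rep_mul. Qed.

(* If [m^2 - h = (m - b)^2] with [b] self-adjoint, then [h <= m^2]. *)
Lemma rep_quasi_sqrt (m : R) (h b : A) x : b^† = b ->
  h = (2 * m)%:C *: b - b ** b -> Re (hip x (rho h x)) <= m ^+ 2 * nm x ^+ 2.
Proof.
move=> bb hE; have := sqr_ge0 (nm (m%:C *: x - rho b x)).
rewrite nmB_sqr nmZ normc_real hipZl conj_real.
rewrite cReM /= mul0r subr0.
have := rep_nm_sqr b x; rewrite bb => /(congr1 (@complex.Re R)) /= ->.
rewrite hE repBl repZl hipBr hipZr cReD cReN cReM /= mul0r subr0.
by rewrite exprMn real_normK ?num_real // => h0; lra.
Qed.

(** A [rep] is only assumed continuous at each element of the algebra. For [|d| < 1], [quasi_sqrt]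
    solves [d^† d = 2 b - b^2], so [rep_quasi_sqrt] with [m = 1] gives [|d x| <= |x|]. Apply this to
    [a / t] with [t > |a|] and let [t] decrease to [|a|]. *)
Lemma rep_contractive a x : nm (rho a x) <= nm a * nm x.
Proof.
have lt1 (d : A) : nm d < 1 -> nm (rho d x) <= nm x.
  move=> d1; have [||b bb hb] := @quasi_sqrt _ A (d^† ** d).
  - by rewrite cadjM cadjK.
  - by rewrite nm_cstar expr_lt1 // nm_ge0.
  have hE : d^† ** d = (2 * 1)%:C *: b - b ** b.
    by rewrite hb mulr1 rmorphMn /= scaler_nat mulr2n.
  have := rep_quasi_sqrt x bb hE; rewrite -rep_nm_sqr /= expr1n mul1r.
  by rewrite ler_sqr ?nnegrE ?nm_ge0.
have gt (t : R) : nm a < t -> nm (rho a x) <= t * nm x.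
  move=> at_; have t0 : 0 < t by apply: le_lt_trans at_; exact: nm_ge0.
  have := lt1 (t^-1%:C *: a); rewrite nmZ repZl nmZ normc_real ger0_norm.
    rewrite !ler_pdivrMl // ltr_pdivrMl // mulr1; exact.
  by rewrite invr_ge0 ltW.
apply/ler_addgt0Pr => e e0; pose d := e / (nm x + 1).
have x0 := nm_ge0 x; have x1 : 0 < nm x + 1 by lra.
have d0 : 0 < d by rewrite divr_gt0.
have hd : e = d * (nm x + 1) by rewrite /d divfK // gt_eqF.
have := gt (nm a + d); rewrite ltrDl => /(_ d0); rewrite mulrDl => h.
by rewrite hd; nra.
Qed.

End rep_theory.

(** * Integration on the line *)

Section real_integration.
Context {R : realType}.
Local Notation mu := (leb R).

Definition rint (f : R -> R) : Prop := mu.-integrable setT (EFin \o f).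

Lemma rint_meas f : rint f -> measurable_fun setT f.
Proof. by move=> /integrableP[/measurable_EFinP]. Qed.

Local Notation mR := (measurableTypeR R).

Lemma measurable_affine (a b : R) :
  measurable_fun [set: mR] (fun x : mR => a * x + b : mR).
Proof. by apply: measurable_funD => //; apply: measurable_funM. Qed.

Definition push_leb (phi : mR -> mR) (mphi : measurable_fun setT phi)
  : {measure set mR -> \bar R} :=
  measure_function.measure_function_pushforward__canonical__measure_function_Measure
    mu mphi.

(** The image of Lebesgue measure under the affine map, scaled by [a], agrees with Lebesgue measure
    on half-open intervals, and these determine the measure. *)
Lemma leb_affine (a b : R) (A : set R) : 0 < a -> measurable A ->
  mu A = (a%:E * mu ((fun x : R => a * x + b)%R @^-1` A))%E.
Proof.
move=> a0 mA; pose nu := mscale (NngNum (ltW a0)) (push_leb (measurable_affine a b)).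
rewrite (@lebesgue_measure_unique R nu) // => _ [[c d]] _ <-.
transitivity (a%:E * mu ((fun x : mR => (a * x + b)%R : mR) @^-1` `]c, d]%classic))%E; last by [].
have -> : (fun x : mR => a * x + b) @^-1` `]c, d]%classic =
          `](c - b) / a, (d - b) / a]%classic.
  apply/seteqP; split => x /=; rewrite !in_itv /= ltr_pdivrMr // ler_pdivlMr //;
    rewrite [x * a]mulrC ltrBlDr lerBrDr //.
rewrite !lebesgue_measure_itv /= !lte_fin ltr_pM2r ?invr_gt0 // ltrD2r.
case: ifP => _; last by rewrite mule0.
by rewrite -!EFinB -EFinM; congr EFin; field; rewrite gt_eqF.
Qed.

Lemma ge0_integral_affine (a b : R) (f : R -> \bar R) : 0 < a ->
  measurable_fun setT f -> (forall x, 0 <= f x)%E ->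
  (\int[mu]_x f x = a%:E * \int[mu]_x f (a * x + b)%R)%E.
Proof.
move=> a0 mf f0; pose nu := mscale (NngNum (ltW a0)) (push_leb (measurable_affine a b)).
rewrite (eq_measure_integral nu); last first.
  by move=> A mA _; exact: leb_affine.
rewrite /nu ge0_integral_mscale //; congr (_ * _)%E.
exact: (@ge0_integral_pushforward _ _ _ _ _ _ (measurable_affine a b) mu setT f).
Qed.

Lemma rint_affine (a b : R) f : 0 < a -> rint f -> rint (fun x => f (a * x + b)).
Proof.
move=> a0 /integrableP[mf intf]; apply/integrableP; split.
  exact: (measurableT_comp mf (measurable_affine a b)).
have := @ge0_integral_affine a b (fun x => `|(EFin \o f) x|)%E a0.
rewrite /= => h; move: intf; rewrite h //; last first.
  have mn : measurable_fun [set: mR] (fun x : mR => `|(EFin \o f) x|%E) by exact: measurableT_comp.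
  exact: mn.
by move=> h1; rewrite ltNge leye_eq; apply/negP => /eqP h2; move: h1; rewrite h2 gt0_muley ?lte_fin // ltxx.
Qed.

Lemma Rintegral_affine (a b : R) f : 0 < a -> rint f ->
  \int[mu]_x f x = a * \int[mu]_x f (a * x + b).
Proof.
move=> a0 rf; have rfa := rint_affine b a0 rf.
have [mf _] := integrableP _ _ _ rf.
have fin := integrable_fin_num measurableT rfa.
apply: EFin_inj; rewrite EFinM /Rintegral !fineK //; last exact: integrable_fin_num.
pose g : mR -> \bar R := EFin \o (fun x => f (a * x + b)).
have eP : (\int[mu]_x (EFin \o f)^\+ x = a%:E * \int[mu]_x g^\+ x)%E.
  rewrite (@ge0_integral_affine a b (EFin \o f)^\+%E a0) //; last exact: measurable_funepos.
  by congr (_ * _)%E; apply: eq_integral => x _; rewrite /g !(funeposE, funenegE).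
have eN : (\int[mu]_x (EFin \o f)^\- x = a%:E * \int[mu]_x g^\- x)%E.
  rewrite (@ge0_integral_affine a b (EFin \o f)^\-%E a0) //; last exact: measurable_funeneg.
  by congr (_ * _)%E; apply: eq_integral => x _; rewrite /g !(funeposE, funenegE).
have h : ((\int[mu]_x g^\+ x)%E \is a fin_num) := integrable_pos_fin_num measurableT rfa.
rewrite [LHS]integralE eP eN -muleBr //; last exact: fin_num_adde_defr.
by congr (_ * _)%E; rewrite [RHS]integralE.
Qed.

Lemma ge0_integralN (f : R -> \bar R) : measurable_fun setT f ->
  (forall x, 0 <= f x)%E -> (\int[mu]_x f x = \int[mu]_x f (- x)%R)%E.
Proof.
move=> mf f0.
have mphi : measurable_fun setT (-%R : mR -> mR) by exact: oppr_measurable.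
rewrite (eq_measure_integral (push_leb mphi)); last first.
  by move=> A mA _; rewrite -[LHS]lebesgue_measureN.
exact: (@ge0_integral_pushforward _ _ _ _ _ _ mphi mu setT f).
Qed.

Lemma rint_supp (f : R -> R) (A M : R) : measurable_fun setT f ->
  (forall x, `|f x| <= M) -> (forall x, A < `|x| -> f x = 0) -> rint f.
Proof.
move=> mf fM fA.
have := integrableZl measurableT M (@integrable_indic_itv R (- A) A true false).
apply: le_integrable => //; first exact/measurable_EFinP.
move=> x _ /=; rewrite lee_fin; have M0 : 0 <= M := le_trans (normr_ge0 _) (fM 0).
rewrite indicE; have [xA|xA] := leP `|x| A; last first.
  by rewrite fA // normr0 normr_ge0.
have -> : x \in `[- A, A]%classic by rewrite inE /= in_itv /= -ler_norml.
by rewrite /= mulr1 (ger0_norm M0).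
Qed.

(** The kernels to be exchanged are bounded and live on a square. Domination by [M * I x * I y],
    with [I] the indicator of [[-A, A]], gives integrability on the plane. *)
Lemma Rint_Fubini (G : R -> R -> R) (A M : R) :
  measurable_fun setT (fun p : R * R => G p.1 p.2) ->
  (forall x y, `|G x y| <= M) ->
  (forall x y, A < `|x| \/ A < `|y| -> G x y = 0) ->
  \int[mu]_x \int[mu]_y G x y = \int[mu]_y \int[mu]_x G x y.
Proof.
move=> mG GM GA.
have r1 x : rint (G x).
  apply: (@rint_supp _ A M) => //; last by move=> y yA; rewrite GA //; right.
  have := measurableT_comp mG (pair1_measurable x); exact.
have r2 y : rint (G ^~ y).
  apply: (@rint_supp _ A M) => //; last by move=> x xA; rewrite GA //; left.
  have := measurableT_comp mG (pair2_measurable y); exact.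
pose F (p : R * R) := (G p.1 p.2)%:E.
have mF : measurable_fun setT F by exact/measurable_EFinP.
have iF : (mu \x mu)%E.-integrable setT F.
  apply/(integrable12ltyP mu mu mF).
  pose I (x : R) : R := \1_(`[- A, A]%classic) x.
  have mI : measurable_fun setT I by exact: measurable_indic.
  have rI : rint I := @integrable_indic_itv R (- A) A true false.
  have M0 : 0 <= M := le_trans (normr_ge0 _) (GM 0 0).
  have I0 x : 0 <= I x by rewrite /I indicE.
  have mkI k : measurable_fun [set: mR] (fun x => k%:E * (I x)%:E)%E.
    by under eq_fun do rewrite -EFinM; apply/measurable_EFinP; exact: measurable_funM.
  have GI x y : `|G x y| <= M * I x * I y.
    rewrite /I !indicE; have [xA|xA] := leP `|x| A; last first.
      by rewrite GA ?normr0 ?mulr_ge0 //; left.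
    have [yA|yA] := leP `|y| A; last first.
      by rewrite GA ?normr0 ?mulr_ge0 //; right.
    have -> : x \in `[- A, A]%classic by rewrite inE /= in_itv /= -ler_norml.
    have -> : y \in `[- A, A]%classic by rewrite inE /= in_itv /= -ler_norml.
    by rewrite !mulr1.
  have fI : (\int[mu]_y (I y)%:E)%E \is a fin_num by exact: integrable_fin_num rI.
  pose J := fine (\int[mu]_y (I y)%:E)%E.
  apply: (@le_lt_trans _ _ (\int[mu]_x ((M * J)%:E * (I x)%:E))%E).
    apply: ge0_le_integral => //.
    - by move=> x _; exact: integral_ge0.
    - have mF' : measurable_fun [set: mR * mR] (abse \o F) by exact: measurableT_comp.
      apply: (measurable_fun_fubini_tonelli_F (m2 := mu) (abse \o F)) => // x; exact: abse_ge0.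
    - move=> x _; rewrite EFinM /J fineK // muleAC -EFinM -ge0_integralZl_EFin //; last 3 first.
      + by move=> y _; rewrite lee_fin.
      + exact/measurable_EFinP.
      + by rewrite mulr_ge0.
      apply: ge0_le_integral => //.
      + have := r1 x => /integrable_abse /measurable_int; exact.
      + by move=> y _; rewrite /F /= lee_fin.
  rewrite integralZl //; apply: lte_mul_pinfty => //.
    by rewrite lee_fin mulr_ge0 // /J fine_ge0 // integral_ge0 // => x _; rewrite lee_fin.
  by rewrite -ge0_fin_numE // integral_ge0 // => x _; rewrite lee_fin.
rewrite /Rintegral; congr fine.
have := Fubini iF; rewrite /F /= => e.
transitivity (\int[mu]_x \int[mu]_y (G x y)%:E)%E.
  by apply: eq_integral => x _; rewrite fineK //; exact: integrable_fin_num (r1 x).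
rewrite e; apply: eq_integral => x _; rewrite fineK //.
exact: integrable_fin_num (r2 x).
Qed.

End real_integration.

(** * Componentwise calculus of complex-valued functions *)

Section complex_functions.
Context {R : realType}.

(** Stated on real and imaginary parts so that real limits and real measurability apply directly.
    [ccontP] translates it to continuity into [R[i]^o], the form used by [Cc] and [C0]. *)
Definition ccont (T : topologicalType) (f : T -> R[i]) : Prop :=
  continuous (fun x => Re (f x)) /\ continuous (fun x => Im (f x)).

Definition cmeas d (T : measurableType d) (f : T -> R[i]) : Prop :=
  measurable_fun setT (fun x => Re (f x)) /\ measurable_fun setT (fun x => Im (f x)).

Lemma ccontP (T : topologicalType) (f : T -> R[i]) :
  ccont f <-> continuous (f : T -> R[i]^o).
Proof.
split=> [[cr ci] x|cf].
- apply/cvg_nmP => e e0.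
  have e2 : 0 < e / 2 by rewrite divr_gt0.
  have /cvgrPdist_lt /(_ _ e2) h1 := cr x; have /cvgrPdist_lt /(_ _ e2) h2 := ci x.
  near=> t; apply: le_lt_trans (normc_le (f x - f t)) _.
  rewrite cReD cImD cReN cImN [e]splitr ltrD //; near: t.
  + exact: h1.
  + exact: h2.
- split=> x; apply/cvgrPdist_lt => e e0; have /cvg_nmP /(_ _ e0) := cf x; apply: filterS => t.
  + by apply: le_lt_trans; have := normRe_le (f x - f t); rewrite cReD cReN.
  + by apply: le_lt_trans; have := normIm_le (f x - f t); rewrite cImD cImN.
Unshelve. all: by end_near. Qed.

Lemma ccontD (T : topologicalType) (f g : T -> R[i]) :
  ccont f -> ccont g -> ccont (fun x => f x + g x).
Proof.
move=> [f1 f2] [g1 g2]; split=> x.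
- under eq_fun do rewrite cReD.
  by apply: cvgD; [exact: f1|exact: g1].
- under eq_fun do rewrite cImD.
  by apply: cvgD; [exact: f2|exact: g2].
Qed.

Lemma ccontM (T : topologicalType) (f g : T -> R[i]) :
  ccont f -> ccont g -> ccont (fun x => f x * g x).
Proof.
move=> [f1 f2] [g1 g2]; split=> x.
- under eq_fun do rewrite cReM.
  by apply: cvgB; apply: cvgM; [exact: f1|exact: g1|exact: f2|exact: g2].
- under eq_fun do rewrite cImM.
  by apply: cvgD; apply: cvgM; [exact: f1|exact: g2|exact: f2|exact: g1].
Qed.

Lemma ccontJ (T : topologicalType) (f : T -> R[i]) :
  ccont f -> ccont (fun x => Num.conj (f x)).
Proof.
move=> [f1 f2]; split=> x.
- by under eq_fun do rewrite cReJ; exact: f1.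
- by under eq_fun do rewrite cImJ; apply: continuousN; exact: f2.
Qed.

Lemma ccont_cst (T : topologicalType) (c : R[i]) : ccont (fun _ : T => c).
Proof. by split=> x; exact: cvg_cst. Qed.

Lemma ccont_comp (S T : topologicalType) (g : S -> T) (f : T -> R[i]) :
  continuous g -> ccont f -> ccont (fun x => f (g x)).
Proof.
move=> cg [f1 f2]; split=> x.
- exact: (continuous_comp (cg x) (f1 (g x))).
- exact: (continuous_comp (cg x) (f2 (g x))).
Qed.

Lemma ccont_real (T : topologicalType) (f : T -> R) :
  continuous f -> ccont (fun x => (f x)%:C).
Proof. by move=> cf; split=> x /=; [exact: cf|exact: cvg_cst]. Qed.

Lemma ccont_expi : ccont (@expi R).
Proof.
have c2 : continuous (fun t : R => 2 * pi * t).
  by move=> t; apply: cvgM; [exact: cvg_cst|exact: cvg_id].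
split=> x /=.
- exact: (continuous_comp (c2 x) (@continuous_cos R _)).
- exact: (continuous_comp (c2 x) (@continuous_sin R _)).
Qed.

Lemma cmeasM d (T : measurableType d) (f g : T -> R[i]) :
  cmeas f -> cmeas g -> cmeas (fun x => f x * g x).
Proof.
move=> [f1 f2] [g1 g2]; split.
- under eq_fun do rewrite cReM.
  by apply: measurable_funB; exact: measurable_funM.
- under eq_fun do rewrite cImM.
  by apply: measurable_funD; exact: measurable_funM.
Qed.

Lemma cmeasD d (T : measurableType d) (f g : T -> R[i]) :
  cmeas f -> cmeas g -> cmeas (fun x => f x + g x).
Proof.
move=> [f1 f2] [g1 g2]; split.
- by under eq_fun do rewrite cReD; exact: measurable_funD.
- by under eq_fun do rewrite cImD; exact: measurable_funD.
Qed.

Lemma cmeas_comp d (T : measurableType d) (g : T -> R) (f : R -> R[i]) :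
  measurable_fun setT g -> cmeas f -> cmeas (fun x => f (g x)).
Proof.
move=> mg [f1 f2]; split.
- exact: (measurableT_comp f1 mg).
- exact: (measurableT_comp f2 mg).
Qed.

Lemma ccont_cmeas (f : R -> R[i]) : ccont f -> cmeas f.
Proof. by move=> [f1 f2]; split; exact: continuous_measurable_fun. Qed.

Lemma expiD (s t : R) : expi (s + t) = expi s * expi t.
Proof.
rewrite /expi mulrDr cosD sinD; apply: complex_eqP; rewrite ?cReM ?cImM //=.
by rewrite addrC; congr (_ + _); rewrite mulrC.
Qed.

Lemma expiN (t : R) : expi (- t) = Num.conj (expi t).
Proof. by rewrite /expi mulrN cosN sinN. Qed.

Lemma expi0 : expi (0 : R) = 1.
Proof. by rewrite /expi mulr0 cos0 sin0. Qed.

Lemma normc_expi (t : R) : normc (expi t) = 1.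
Proof. by rewrite /expi /= cos2Dsin2 sqrtr1. Qed.

End complex_functions.

Section complex_integration.
Context {R : realType}.
Local Notation mu := (leb R).
Implicit Types (f g : R -> R[i]) (c : R[i]).

Definition intg f : Prop := rint (fun x => Re (f x)) /\ rint (fun x => Im (f x)).

Lemma rintZ (k : R) (h : R -> R) : rint h -> rint (fun x => k * h x).
Proof. by move=> rh; have := integrableZl measurableT k rh. Qed.

Lemma rintD (h k : R -> R) : rint h -> rint k -> rint (fun x => h x + k x).
Proof. by move=> rh rk; have := integrableD measurableT rh rk. Qed.

Lemma intg_linear c f g : intg f -> intg g -> intg (fun x => c * f x + g x).
Proof.
move=> [f1 f2] [g1 g2]; rewrite /intg; split.
- under eq_fun do rewrite cReD cReM -mulNr.
  by apply: rintD => //; apply: rintD; exact: rintZ.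
- under eq_fun do rewrite cImD cImM.
  by apply: rintD => //; apply: rintD; exact: rintZ.
Qed.

Lemma Cint_linear c f g : intg f -> intg g ->
  Cint mu (fun x => c * f x + g x) = c * Cint mu f + Cint mu g.
Proof.
move=> [f1 f2] [g1 g2]; apply: complex_eqP; rewrite ?cReD ?cReM ?cImD ?cImM /=.
- under eq_Rintegral do rewrite cReD cReM -mulNr.
  rewrite RintegralD //; last by apply: rintD; exact: rintZ.
  rewrite RintegralD //; [|exact: rintZ|exact: rintZ].
  by rewrite !RintegralZl // mulNr.
- under eq_Rintegral do rewrite cImD cImM.
  rewrite RintegralD //; last by apply: rintD; exact: rintZ.
  rewrite RintegralD //; [|exact: rintZ|exact: rintZ].
  by rewrite !RintegralZl // .
Qed.

Lemma intg0 : intg (fun=> 0).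
Proof. by split; exact: integrable0. Qed.

Lemma Cint0 : Cint mu (fun=> 0) = 0.
Proof.
rewrite /Cint /=; apply: complex_eqP => /=; rewrite Rintegral_cst ?mul0r //.
Qed.

Lemma intgZ c f : intg f -> intg (fun x => c * f x).
Proof. by move=> h; have := intg_linear c h intg0; under eq_fun do rewrite addr0. Qed.

Lemma CintZ c f : intg f -> Cint mu (fun x => c * f x) = c * Cint mu f.
Proof.
move=> h; have := Cint_linear c h intg0; rewrite Cint0 addr0.
by under eq_fun do rewrite addr0.
Qed.

Lemma intgB f g : intg f -> intg g -> intg (fun x => f x - g x).
Proof.
move=> hf hg; have := intg_linear (-1) hg hf.
by under eq_fun do rewrite mulN1r addrC.
Qed.

Lemma CintB f g : intg f -> intg g ->
  Cint mu (fun x => f x - g x) = Cint mu f - Cint mu g.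
Proof.
move=> hf hg; have := Cint_linear (-1) hg hf; rewrite mulN1r addrC => <-.
by congr Cint; apply/funext => x; rewrite mulN1r addrC.
Qed.

Lemma CintJ f : intg f -> Cint mu (fun x => Num.conj (f x)) = Num.conj (Cint mu f).
Proof.
move=> [f1 f2]; apply: complex_eqP; rewrite ?cReJ ?cImJ /=.
- by under eq_Rintegral do rewrite cReJ.
- by under eq_Rintegral do rewrite cImJ -mulN1r; rewrite RintegralZl // mulN1r.
Qed.

(** The factor 2 comes from bounding real and imaginary parts separately. The estimate only serves
    to make quantities small, so the loss is harmless. *)
Lemma normc_Cint f (h : R -> R) : intg f -> rint h ->
  (forall x, normc (f x) <= h x) -> normc (Cint mu f) <= 2 * \int[mu]_x h x.
Proof.
move=> [f1 f2] rh fh; apply: le_trans (normc_le _) _; rewrite mulr2n mulrDl !mul1r /=.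
apply: lerD.
- apply: le_trans (le_normr_Rintegral _ f1) _ => //.
  apply: le_Rintegral => //; first exact: integrable_norm.
  by move=> x _; exact: le_trans (normRe_le _) (fh x).
- apply: le_trans (le_normr_Rintegral _ f2) _ => //.
  apply: le_Rintegral => //; first exact: integrable_norm.
  by move=> x _; exact: le_trans (normIm_le _) (fh x).
Qed.

Lemma intg_affine (a b : R) f : 0 < a -> intg f -> intg (fun x => f (a * x + b)).
Proof. by move=> a0 [f1 f2]; split; [have := rint_affine b a0 f1|have := rint_affine b a0 f2]. Qed.

Lemma Cint_affine (a b : R) f : 0 < a -> intg f ->
  Cint mu f = a%:C * Cint mu (fun x => f (a * x + b)).
Proof.
move=> a0 [f1 f2]; apply: complex_eqP; rewrite ?cReM ?cImM /= !mul0r ?subr0 ?addr0.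
- exact: Rintegral_affine.
- exact: Rintegral_affine.
Qed.

Lemma intg_supp f (A M : R) : cmeas f -> (forall x, normc (f x) <= M) ->
  (forall x, A < `|x| -> f x = 0) -> intg f.
Proof.
move=> [m1 m2] fM fA; split.
- apply: (@rint_supp _ _ A M) => // x; last by move=> /fA ->.
  exact: le_trans (normRe_le _) (fM x).
- apply: (@rint_supp _ _ A M) => // x; last by move=> /fA ->.
  exact: le_trans (normIm_le _) (fM x).
Qed.

Lemma Cint_Fubini (G : R -> R -> R[i]) (A M : R) :
  cmeas (fun p : R * R => G p.1 p.2) ->
  (forall x y, normc (G x y) <= M) ->
  (forall x y, A < `|x| \/ A < `|y| -> G x y = 0) ->
  Cint mu (fun x => Cint mu (G x)) = Cint mu (fun y => Cint mu (G ^~ y)).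
Proof.
move=> [m1 m2] GM GA; apply: complex_eqP => /=.
- apply: (@Rint_Fubini _ (fun x y => Re (G x y)) A M) => //.
  + by move=> x y; exact: le_trans (normRe_le _) (GM x y).
  + by move=> x y /GA ->.
- apply: (@Rint_Fubini _ (fun x y => Im (G x y)) A M) => //.
  + by move=> x y; exact: le_trans (normIm_le _) (GM x y).
  + by move=> x y /GA ->.
Qed.

End complex_integration.

(** * Compactly supported functions *)

Section reflection.
Context {R : realType}.
Local Notation mu := (leb R).

Lemma rint_reflect (f : R -> R) : rint f -> rint (fun x => f (- x)).
Proof.
move=> /integrableP[mf intf]; apply/integrableP; split.
  by apply: (measurableT_comp mf); exact: oppr_measurable.
have mn : measurable_fun [set: measurableTypeR R] (fun x : measurableTypeR R => `|(EFin \o f) x|%E).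
  exact: measurableT_comp.
by have := ge0_integralN mn (fun x => abse_ge0 _) => /= <-.
Qed.

Lemma Rintegral_reflect (f : R -> R) : rint f ->
  \int[mu]_x f x = \int[mu]_x f (- x).
Proof.
move=> rf; have rfa := rint_reflect rf.
have [mf _] := integrableP _ _ _ rf.
rewrite /Rintegral; congr fine.
pose g : measurableTypeR R -> \bar R := EFin \o (fun x => f (- x)).
have eP : (\int[mu]_x (EFin \o f)^\+ x = \int[mu]_x g^\+ x)%E.
  rewrite (@ge0_integralN _ (EFin \o f)^\+%E) //; last exact: measurable_funepos.
  by apply: eq_integral => x _; rewrite /g !(funeposE, funenegE).
have eN : (\int[mu]_x (EFin \o f)^\- x = \int[mu]_x g^\- x)%E.
  rewrite (@ge0_integralN _ (EFin \o f)^\-%E) //; last exact: measurable_funeneg.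
  by apply: eq_integral => x _; rewrite /g !(funeposE, funenegE).
by rewrite [LHS]integralE [RHS]integralE eP eN.
Qed.

Lemma Cint_reflect (f : R -> R[i]) : intg f ->
  Cint mu f = Cint mu (fun x => f (- x)).
Proof. by move=> [f1 f2]; apply: complex_eqP => /=; exact: Rintegral_reflect. Qed.

End reflection.

Lemma ccont_near (R : realType) (T : topologicalType) (f : T -> R[i]) (x : T) (e : R) :
  ccont f -> 0 < e -> \forall y \near x, normc (f y - f x) < e.
Proof.
move=> /ccontP cf e0; have /cvg_nmP /(_ _ e0) := cf x; apply: filterS => y.
by rewrite nmB.
Qed.

Section compact_support.
Context {R : realType}.
Local Notation mu := (leb R).
Implicit Types (f g : R -> R[i]).

Lemma CcP f : Cc f <-> ccont f /\ exists A, forall x, A < `|x| -> f x = 0.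
Proof.
split=> [[/ccontP cf /compact_bounded[M [_ hM]]]|[cf [A hA]]].
  split=> //; exists (M + 1) => x xM; apply/eqP/negP => /negP fx.
  have := hM (M + 1); rewrite ltrDl ltr01 => /(_ isT x) h.
  by move: xM; rewrite ltNge h //; apply: subset_closure.
split; first exact/ccontP.
apply: (@subclosed_compact _ _ `[- A, A]%classic); [exact: closed_closure|exact: segment_compact|].
rewrite [X in _ `<=` X](closure_id _).1; last exact: interval_closed.
apply: closure_subset => x /= fx; rewrite in_itv /= -ler_norml leNgt.
by apply/negP => /hA h; rewrite h eqxx in fx.
Qed.

Lemma Cc_ccont f : Cc f -> ccont f. Proof. by move=> /CcP[]. Qed.

Lemma Cc_supp f : Cc f -> exists2 A, 0 < A & forall x, A < `|x| -> f x = 0.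
Proof.
move=> /CcP[_ [A hA]]; exists (`|A| + 1) => [|x hx]; first by rewrite ltr_pwDr.
by apply: hA; apply: le_lt_trans (ler_norm A) _; apply: lt_trans hx; rewrite ltrDl.
Qed.

Lemma Cc_bounded f : Cc f -> exists2 M, 0 < M & forall x, normc (f x) <= M.
Proof.
move=> /CcP[[cr ci] [A hA]].
have AA : - `|A| <= `|A| by rewrite (le_trans (y := 0)) // oppr_le0.
pose h x := `|Re (f x)| + `|Im (f x)|.
have ch : {within `[- `|A|, `|A|], continuous h}.
  apply: continuous_subspaceT => x; apply: cvgD; apply: cvg_norm; [exact: cr|exact: ci].
have [c _ hc] := EVT_max AA ch; exists (h c + 1) => [|x].
  by rewrite ltr_pwDr // addr_ge0.
have [xA|xA] := leP `|x| `|A|.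
  apply: le_trans (normc_le _) _; apply: (@le_trans _ _ (h c)); last by rewrite lerDl.
  by apply: hc; rewrite in_itv /= -ler_norml.
by rewrite hA ?normc0 ?addr_ge0 //; apply: le_lt_trans xA; exact: ler_norm.
Qed.

Lemma Cc_cmeas f : Cc f -> cmeas f.
Proof. by move=> /Cc_ccont /ccont_cmeas. Qed.

Lemma Cc_intg f : Cc f -> intg f.
Proof.
move=> hf; have [A _ hA] := Cc_supp hf; have [M _ hM] := Cc_bounded hf.
by apply: (@intg_supp _ _ A M) => //; exact: Cc_cmeas.
Qed.

Lemma Cc_mull f g : ccont g -> Cc f -> Cc (fun x => g x * f x).
Proof.
move=> cg /CcP[cf [A hA]]; apply/CcP; split; first exact: ccontM.
by exists A => x /hA ->; rewrite mulr0.
Qed.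

Lemma Cc_mulr f g : ccont g -> Cc f -> Cc (fun x => f x * g x).
Proof. by move=> cg hf; under eq_fun do rewrite mulrC; exact: Cc_mull. Qed.

Lemma Cc_linear c f g : Cc f -> Cc g -> Cc (fun x => c * f x + g x).
Proof.
move=> /CcP[cf [A hA]] /CcP[cg [B hB]]; apply/CcP; split.
  by apply: ccontD => //; apply: ccontM => //; exact: ccont_cst.
exists (Num.max A B) => x; rewrite gt_max => /andP[/hA -> /hB ->].
by rewrite mulr0 addr0.
Qed.

Lemma Cc_conj f : Cc f -> Cc (fun x => Num.conj (f x)).
Proof.
move=> /CcP[cf [A hA]]; apply/CcP; split; first exact: ccontJ.
by exists A => x /hA ->; rewrite rmorph0.
Qed.

Lemma continuous_affine (a b : R) : continuous (fun x : R => a * x + b).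
Proof. by move=> x; apply: cvgD; [apply: cvgM; [exact: cvg_cst|exact: cvg_id]|exact: cvg_cst]. Qed.

Lemma Cc_affine (a b : R) f : a != 0 -> Cc f -> Cc (fun x => f (a * x + b)).
Proof.
move=> a0 /CcP[cf [A hA]]; apply/CcP; split.
  by apply: ccont_comp => //; exact: continuous_affine.
exists ((`|A| + `|b|) / `|a|) => x; rewrite ltr_pdivrMr ?normr_gt0 // => h.
apply: hA; apply: le_lt_trans (ler_norm A) _.
have := ler_normB (a * x + b) b; rewrite addrK normrM mulrC; lra.
Qed.

(** Compactness of [[-(A + 1), A + 1]] makes the radius uniform there. Outside this interval a step
    shorter than 1 does not reach the support. *)
Lemma Cc_unif f : Cc f -> forall e : R, 0 < e -> exists2 d, 0 < d &
  forall x y, `|x - y| < d -> normc (f x - f y) < e.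
Proof.
move=> hf e e0; have [A A0 hA] := Cc_supp hf; have [cf1 cf2] := Cc_ccont hf.
have ke : compact `[- (A + 1), A + 1] := @segment_compact R (- (A + 1)) (A + 1).
have e2 : 0 < e / 2 by rewrite divr_gt0.
have [] := (compact_near_coveringP _).1 ke R (nbhs (0 : R))
  (fun h x => normc (f (x + h) - f x) < e).
  move=> x _.
  have cG : ccont (fun p : R * R => f (p.1 + p.2) - f p.1).
    apply: ccontD; first by apply: (ccont_comp (T := R)) => // p; apply: cvgD; [exact: cvg_fst|exact: cvg_snd].
    have -> : (fun p : R * R => - f p.1) = (fun p => -1 * f p.1) by apply/funext => p; rewrite mulN1r.
    by apply: ccontM; [exact: ccont_cst|apply: (ccont_comp (T := R)) => // p; exact: cvg_fst].
  have := ccont_near (x, 0) cG e0; apply: filterS => -[y h] /=.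
  by rewrite addr0 subrr subr0.
move=> d /= d0 hd; exists (Num.min d 1) => [|x y]; first by rewrite lt_min d0 ltr01.
rewrite lt_min => /andP[xd x1].
have [yA|yA] := leP `|y| (A + 1).
  have := hd (x - y); rewrite /= sub0r normrN => /(_ xd y); rewrite /= in_itv /= -ler_norml => /(_ yA).
  by rewrite [y + _]addrC subrK.
have fy : f y = 0 by apply: hA; lra.
have fx : f x = 0.
  by apply: hA; have := ler_distD 0 y x; rewrite !subr0 sub0r normrN (distrC y); have := ler_distD x y 0; rewrite !subr0 (distrC y); lra.
by rewrite fx fy subrr normc0.
Qed.

Definition box (A : R) (x : R) : R := \1_(`[- A, A]%classic) x.

Lemma rint_box A : rint (box A).
Proof. exact: (@integrable_indic_itv R (- A) A true false). Qed.

Lemma box_in A x : `|x| <= A -> box A x = 1.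
Proof.
by move=> xA; rewrite /box indicE mem_set //= in_itv /= -ler_norml.
Qed.

Lemma box_ge0 A x : 0 <= box A x.
Proof. by rewrite /box indicE. Qed.

Lemma Rintegral_box A : 0 <= A -> \int[mu]_x box A x = 2 * A.
Proof.
move=> A0; rewrite /Rintegral integral_indic // setIT.
transitivity (fine (if (- A)%:E < A%:E then A%:E - (- A)%:E else 0)%E).
  by congr fine; exact: (@lebesgue_measure_itv R `[- A, A]).
rewrite lte_fin; case: ltP => [_|h] /=; first by rewrite opprK mulr2n mulrDl !mul1r.
have -> : A = 0 by lra.
by rewrite mulr0.
Qed.

(** The 4 is the factor 2 of [normc_Cint] times the 2 in the length [2 A] of the interval. *)
Lemma Cint_bound f (A e : R) : intg f -> 0 <= A -> 0 <= e ->
  (forall x, A < `|x| -> f x = 0) -> (forall x, `|x| <= A -> normc (f x) <= e) ->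
  normc (Cint mu f) <= 4 * A * e.
Proof.
move=> hf A0 e0 fA fe.
have := normc_Cint hf (rintZ e (rint_box A)); rewrite RintegralZl //; last exact: rint_box.
rewrite Rintegral_box // => h; have {}h := h _; apply: le_trans (h _) _; last by lra.
move=> x; have [xA|xA] := leP `|x| A; first by rewrite box_in // mulr1 fe.
by rewrite fA // normc0 mulr_ge0 // box_ge0.
Qed.

(** Joint continuity at the points [(x, t)] becomes uniform in [t] over the compact interval
    [[-B, B]], so the integrands differ uniformly by little on a set of finite length. *)
Lemma Cint_param (T : topologicalType) (G : T -> R -> R[i]) (A : R) :
  ccont (fun p : T * R => G p.1 p.2) ->
  (forall x t, A < `|t| -> G x t = 0) ->
  ccont (fun x => Cint mu (G x)).
Proof.
move=> cG hA; pose B := `|A| + 1; have B0 : 0 < B by rewrite ltr_pwDr.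
have hB x t : B < `|t| -> G x t = 0.
  move=> h; apply: hA; apply: le_lt_trans (ler_norm A) _; apply: lt_trans h.
  by rewrite ltrDl.
have gC x : Cc (G x).
  apply/CcP; split; last by exists B => t; exact: hB.
  have cx : continuous (fun t : R => (x, t)).
    by move=> t; exact: (cvg_pair (cvg_cst x) cvg_id).
  exact: (ccont_comp cx cG).
apply/ccontP => x; apply/cvg_nmP => e e0.
pose d := e / (4 * B + 1).
have d0 : 0 < d by rewrite divr_gt0 // addr_gt0 // mulr_gt0.
have ke : compact `[- B, B] := @segment_compact R (- B) B.
have : \forall y \near x, forall t, `[- B, B]%classic t -> normc (G x t - G y t) < d.
  apply: ((compact_near_coveringP _).1 ke T (nbhs x)
    (fun y t => normc (G x t - G y t) < d)) => t _.
  have cH : ccont (fun p : R * T => G x p.1 - G p.2 p.1).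
    apply: ccontD; first by apply: (ccont_comp (T := R)); [move=> p; exact: cvg_fst|exact: Cc_ccont].
    have -> : (fun p : R * T => - G p.2 p.1) = (fun p => -1 * G p.2 p.1).
      by apply/funext => p; rewrite mulN1r.
    apply: ccontM; first exact: ccont_cst.
    have cs : continuous (fun p : R * T => (p.2, p.1)).
      by move=> p; exact: (cvg_pair cvg_snd cvg_fst).
    exact: (ccont_comp cs cG).
  have := ccont_near (t, x) cH d0; apply: filterS => -[s y] /=.
  by rewrite subrr subr0.
apply: filterS => y hy.
rewrite /nm -CintB; [|exact: Cc_intg|exact: Cc_intg].
rewrite -[Re _]/(normc _).
apply: (@le_lt_trans _ _ (4 * B * d)).
  apply: Cint_bound; [by apply: intgB; exact: Cc_intg|exact: ltW|exact: ltW| |].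
    by move=> t tB; rewrite !hB // subrr.
  by move=> t tB; apply/ltW/hy; rewrite /= in_itv /= -ler_norml.
have hd : d * (4 * B + 1) = e by rewrite /d divfK // gt_eqF // addr_gt0 // mulr_gt0.
by lra.
Qed.

End compact_support.

(** * Fourier transform and Fejér kernel *)

Section fourier_transform.
Context {R : realType}.
Local Notation mu := (leb R).
Implicit Types (f g : R -> R[i]).

Lemma ccont_expi_mul : ccont (fun p : R * R => expi (p.2 * p.1) : R[i]).
Proof.
apply: (ccont_comp (T := R) _ ccont_expi) => p.
by apply: cvgM; [exact: cvg_snd|exact: cvg_fst].
Qed.

Lemma ccont_expi_affine (a b : R) : ccont (fun t : R => expi (a * t + b) : R[i]).
Proof. by apply: (ccont_comp (T := R) _ ccont_expi) => t; exact: continuous_affine. Qed.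

Lemma ccont_expiM (a : R) : ccont (fun t : R => expi (t * a) : R[i]).
Proof.
have := ccont_expi_affine a 0.
by under eq_fun do rewrite addr0 mulrC.
Qed.

Lemma Cc_expi (a : R) g : Cc g -> Cc (fun t : R => expi (t * a) * g t).
Proof. by move=> hg; apply: Cc_mull => //; exact: ccont_expiM. Qed.

Lemma fourier_ccont g : Cc g -> ccont (fourier g).
Proof.
move=> hg; have [A _ hA] := Cc_supp hg.
apply: (@Cint_param _ _ (fun x t => expi (t * x) * g t) A).
  apply: ccontM; first exact: ccont_expi_mul.
  by apply: (ccont_comp (T := R)); [move=> p; exact: cvg_snd|exact: Cc_ccont].
by move=> x t /hA ->; rewrite mulr0.
Qed.

Lemma fourier_linear (c : R[i]) f g : Cc f -> Cc g ->
  fourier (fun x => c * f x + g x) = fun x => c * fourier f x + fourier g x.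
Proof.
move=> hf hg; apply/funext => x; rewrite /fourier.
rewrite -Cint_linear; [|exact/Cc_intg/Cc_expi|exact/Cc_intg/Cc_expi].
by congr Cint; apply/funext => t; ring.
Qed.

Lemma expi_half : expi (2^-1 : R) = -1.
Proof.
rewrite /expi mulrAC mulfV // mul1r cospi sinpi.
by apply: complex_eqP; rewrite /= ?oppr0.
Qed.

(* Translating by [1 / (2 x)] changes the sign of [e(t x)]. *)
Lemma fourier_vanish g : Cc g -> forall e : R, 0 < e ->
  exists2 B, 0 < B & forall x, B < `|x| -> normc (fourier g x) <= e.
Proof.
move=> hg e e0; have [A A0 hA] := Cc_supp hg.
pose d := e / (2 * (A + 1)); have A1 : 0 < A + 1 by lra.
have d0 : 0 < d by rewrite divr_gt0 // mulr_gt0.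
have [r r0 hr] := Cc_unif hg d0.
(* The bound [1 / (2 r)] makes the half-period [h] shorter than the radius of uniform continuity;
   the bound 1 keeps the support of the translate inside [[-(A + 1), A + 1]]. *)
exists (Num.max (2 * r)^-1 1) => [|x]; first by rewrite lt_max ltr01 orbT.
rewrite gt_max => /andP[xr x1].
have x0 : x != 0 by rewrite -normr_gt0; lra.
pose h := (2 * x)^-1.
have hh : `|h| < r.
  rewrite /h normfV normrM (ger0_norm (ler0n _ 2)) invf_plt ?posrE ?mulr_gt0 //; last by lra.
  by move: xr; rewrite invfM; lra.
have h1 : `|h| <= 1.
  rewrite /h normfV normrM (ger0_norm (ler0n _ 2)) invf_le1 ?mulr_gt0 //; lra.
have hE : fourier g x = - Cint mu (fun t => expi (t * x) * g (t + h)).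
  rewrite /fourier (@Cint_affine _ 1 h) //; last exact/Cc_intg/Cc_expi.
  rewrite mul1r -mulN1r -CintZ; last first.
    apply/Cc_intg/Cc_expi; have := Cc_affine h (oner_neq0 R) hg.
    by under eq_fun do rewrite mul1r.
  congr Cint; apply/funext => t; rewrite mul1r mulrDl expiD.
  have -> : h * x = 2^-1 by rewrite /h invfM mulfVK.
  by rewrite expi_half mulrN1 mulNr mulN1r.
have gh : Cc (fun t => g (t + h)).
  by have := Cc_affine h (oner_neq0 R) hg; under eq_fun do rewrite mul1r.
have i1 : intg (fun t => expi (t * x) * g t) by exact/Cc_intg/Cc_expi.
have i2 : intg (fun t => expi (t * x) * g (t + h)) by exact/Cc_intg/Cc_expi.
have e2 : 2 * fourier g x = Cint mu (fun t => expi (t * x) * g t - expi (t * x) * g (t + h)).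
  by rewrite CintB // mulrDl !mul1r {2}hE.
have : normc (2 * fourier g x) <= 4 * (A + 1) * d.
  rewrite e2; apply: Cint_bound; [exact: intgB|lra|exact: ltW| |].
  - move=> t tA; rewrite !hA ?mulr0 ?subrr //; last by lra.
    by have := ler_normB (t + h) h; rewrite addrK; lra.
  - move=> t _; rewrite -mulrBr normcM normc_expi mul1r; apply/ltW/hr.
    by rewrite opprD addNKr normrN.
rewrite normcM -[2]/(2%:R) -(rmorph_nat (real_complex R)) normc_real ger0_norm // => le.
have hd : d * (2 * (A + 1)) = e by rewrite /d divfK // gt_eqF // mulr_gt0.
by lra.
Qed.

Lemma fourier_C0 g : Cc g -> C0 (fourier g).
Proof.
move=> hg; split; first exact/ccontP/fourier_ccont.
- apply/(@cvg_nmP R R[i]^o) => e e0; have e2 : 0 < e / 2 by rewrite divr_gt0.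
  have [B B0 hB] := fourier_vanish hg e2.
  near=> x; rewrite sub0r nmN; apply: le_lt_trans (hB x _) _; last by lra.
  have xB : B < x by near: x; apply: nbhs_pinfty_gt; exact: num_real.
  by rewrite gtr0_norm //; lra.
- apply/(@cvg_nmP R R[i]^o) => e e0; have e2 : 0 < e / 2 by rewrite divr_gt0.
  have [B B0 hB] := fourier_vanish hg e2.
  near=> x; rewrite sub0r nmN; apply: le_lt_trans (hB x _) _; last by lra.
  have xB : x < - B by near: x; apply: nbhs_ninfty_lt; exact: num_real.
  by rewrite ltr0_norm; lra.
Unshelve. all: by end_near. Qed.

(** Both sides are the double integral of [e(s (a - t)) f(s) g(t)]. With the triangle as [f] this
    formula produces Fejér means; with [a = 0] and [g] a conjugate it produces the Plancherel
    identity. *)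
Lemma fourier_Fubini f g : Cc f -> Cc g -> forall a : R,
  Cint mu (fun s => expi (s * a) * f s * fourier g (- s)) =
  Cint mu (fun t => fourier f (a - t) * g t).
Proof.
move=> hf hg a; have [A A0 hA] := Cc_supp hf; have [B B0 hB] := Cc_supp hg.
have [M M0 hM] := Cc_bounded hf; have [L L0 hL] := Cc_bounded hg.
pose G (s t : R) := expi (s * (a - t)) * (f s * g t).
transitivity (Cint mu (fun s => Cint mu (G s))).
  congr Cint; apply/funext => s; rewrite /fourier -CintZ; last exact/Cc_intg/Cc_expi.
  congr Cint; apply/funext => t; rewrite /G mulrBr mulrN (mulrC t s) expiD; ring.
rewrite (@Cint_Fubini _ G (Num.max A B) (M * L)).
- congr Cint; apply/funext => t; rewrite /fourier mulrC -CintZ; last exact/Cc_intg/Cc_expi.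
  by congr Cint; apply/funext => s; rewrite /G; ring.
- apply: cmeasM; last first.
    by apply: cmeasM; apply: cmeas_comp => //; exact: Cc_cmeas.
  apply: cmeas_comp; last exact/ccont_cmeas/ccont_expi.
  by apply: measurable_funM => //; apply: measurable_funB.
- move=> s t; rewrite /G !normcM normc_expi mul1r.
  by apply: ler_pM => //; exact: normc_ge0.
- move=> s t; rewrite !gt_max => -[|] /andP[h1 h2].
  + by rewrite /G hA // mul0r mulr0.
  + by rewrite /G hB // !mulr0.
Qed.

End fourier_transform.

Section fejer.
Context {R : realType}.
Local Notation mu := (leb R).

(** The triangle window. Its transform, the Fejér kernel, is nonnegative and integrable, so it can
    serve as an approximate identity. *)
Definition tri (N x : R) : R := Num.max 0 (1 - `|x| / N).

Lemma tri_ge0 N x : 0 <= tri N x. Proof. by rewrite /tri le_max lexx. Qed.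

Lemma tri_le1 N x : 0 < N -> tri N x <= 1.
Proof. by move=> N0; rewrite /tri ge_max ler01 /= lerBlDr lerDl divr_ge0 // ltW. Qed.

Lemma continuous_tri N : continuous (tri N).
Proof.
move=> x; apply: (@continuous_max _ _ (cst 0) (fun x => 1 - `|x| / N)); first exact: cvg_cst.
apply: cvgB; first exact: cvg_cst.
by apply: cvgM; [apply: cvg_norm; exact: cvg_id|exact: cvg_cst].
Qed.

Lemma tri_out N x : 0 < N -> N <= `|x| -> tri N x = 0.
Proof.
move=> N0 h; apply/max_idPl; rewrite subr_le0 ler_pdivlMr ?mul1r //.
Qed.

Lemma tri_in N x : 0 < N -> `|x| <= N -> tri N x = 1 - `|x| / N.
Proof.
by move=> N0 h; apply/max_idPr; rewrite subr_ge0 ler_pdivrMr ?mul1r.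
Qed.

Lemma Cc_tri N : 0 < N -> Cc (fun x => (tri N x)%:C).
Proof.
move=> N0; apply/CcP; split; first exact/ccont_real/continuous_tri.
by exists N => x h; rewrite tri_out // ltW.
Qed.

Definition fejer (x : R) : R := Re (fourier (fun t => (tri 1 t)%:C) x).

(** The triangle is real and even, so the substitution [t -> - t] shows that its transform equals
    its own conjugate. *)
Lemma fourier_tri1 x : fourier (fun t => (tri 1 t)%:C) x = (fejer x)%:C.
Proof.
apply: complex_eqP; first by [].
set z := fourier _ _; rewrite [RHS]/=.
have ci := Cc_intg (Cc_expi x (Cc_tri (ltr01 : 0 < 1 :> R))).
have : Num.conj (fourier (fun t => (tri 1 t)%:C) x) = fourier (fun t => (tri 1 t)%:C) x.
  rewrite /fourier -CintJ // [RHS]Cint_reflect //; congr Cint; apply/funext => t.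
  by rewrite rmorphM /= conj_real -expiN mulNr /tri normrN.
by move/(congr1 (@complex.Im R)); rewrite -/z cImJ => h; lra.
Qed.

Lemma fourier_tri N x : 0 < N ->
  fourier (fun t => (tri N t)%:C) x = (N * fejer (N * x))%:C.
Proof.
move=> N0; rewrite /fourier (@Cint_affine _ N 0) //; last exact/Cc_intg/Cc_expi/Cc_tri.
rewrite rmorphM /= -fourier_tri1 /fourier; congr (_ * Cint _ _); apply/funext => t.
rewrite addr0; congr (expi _ * _); first by ring.
rewrite /tri normrM (gtr0_norm N0) divr1; congr (Num.max _ (_ - _))%:C.
by rewrite mulrAC mulfV ?mul1r // gt_eqF.
Qed.

Lemma FTC2_global (f F : R -> R) a b : a < b -> continuous f ->
  (forall x : R, is_derive x (1 : R) F (f x)) -> \int[mu]_(x in `[a, b]) f x = F b - F a.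
Proof.
move=> ab cf dF.
have cF : continuous F.
  by move=> x; apply: differentiable_continuous; apply/derivable1_diffP; have [] := dF x.
rewrite /Rintegral (@continuous_FTC2 _ f F) //.
- exact: continuous_subspaceT.
- split.
  + by move=> x _; have [] := dF x.
  + by apply: cvg_at_right_filter; exact: cF.
  + by apply: cvg_at_left_filter; exact: cF.
- by move=> x _; rewrite derive1E; apply: derive_val.
Qed.

(** This is [(sin (pi x) / (pi x))^2]. The closed form is needed for two facts that the definition
    as a Fourier integral hides: nonnegativity and quadratic decay. *)
Lemma fejerE x : x != 0 ->
  fejer x = 2 * (1 - cos (2 * pi * x)) / (2 * pi * x) ^+ 2.
Proof.
move=> x0; set a := 2 * pi * x.
have a0 : a != 0 by rewrite !mulf_neq0 // gt_eqF // pi_gt0.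
pose phi t : R := cos (a * t) * tri 1 t.
have -> : fejer x = \int[mu]_t phi t.
  rewrite /fejer /fourier /=; apply: eq_Rintegral => t _.
  by rewrite mulr0 subr0 /phi /a; congr (cos _ * _); ring.
have da (s : R) : is_derive s (1 : R) (fun s : R => a * s) a.
  by have := is_deriveZ a (is_derive_id s (1 : R)); rewrite /GRing.scale /= mulr1.
have dc (s : R) : is_derive s (1 : R) (fun s : R => cos (a * s)) (- sin (a * s) * a).
  exact: (@is_derive1_comp _ (@cos R) (fun s => a * s) s _ _ (is_derive_cos _) (da s)).
have ds (s : R) : is_derive s (1 : R) (fun s : R => sin (a * s)) (cos (a * s) * a).
  exact: (@is_derive1_comp _ (@sin R) (fun s => a * s) s _ _ (is_derive_sin _) (da s)).
(* Integration by parts on the right half of the triangle: [(1 - s) sin (a s) / a - cos (a s) / a^2]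
   is a primitive of [(1 - s) cos (a s)]. The left half is handled by [dQ]. *)
have dP (s : R) : is_derive s (1 : R)
    (((cst 1 - id) : R -> R) * (a^-1 \*: (fun s : R => sin (a * s)))
     - (a^-2 \*: (fun s : R => cos (a * s)))) ((1 - s) * cos (a * s)).
  apply: is_derive_eq; rewrite /GRing.scale /=.
  rewrite -[(cst 1 - id) s]/(1 - s) -[_ *: sin _]/(_ * sin _); field.
  exact: a0.
have dQ (s : R) : is_derive s (1 : R)
    (((cst 1 + id) : R -> R) * (a^-1 \*: (fun s : R => sin (a * s)))
     + (a^-2 \*: (fun s : R => cos (a * s)))) ((1 + s) * cos (a * s)).
  apply: is_derive_eq; rewrite /GRing.scale /=.
  rewrite -[(cst 1 + id) s]/(1 + s) -[_ *: sin _]/(_ * sin _); field.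
  exact: a0.
have ccos : continuous (fun s : R => cos (a * s)).
  move=> s; apply: (continuous_comp (f := fun s : R => a * s) (g := @cos R)).
    by apply: cvgM; [exact: cvg_cst|exact: cvg_id].
  exact: continuous_cos.
have cphi : continuous phi.
  by move=> s; apply: cvgM; [exact: ccos|exact: continuous_tri].
have rphi : rint phi.
  apply: (@rint_supp _ _ 1 1); first exact: continuous_measurable_fun.
  - move=> s; rewrite /phi normrM -[leRHS]mulr1; apply: ler_pM => //.
      by rewrite ler_norml cos_geN1 cos_le1.
    by rewrite ger0_norm ?tri_ge0 // tri_le1.
  - by move=> s s1; rewrite /phi tri_out ?mulr0 // ltW.
have -> : \int[mu]_t phi t = \int[mu]_(t in `[-1, 1]) phi t.
  rewrite [RHS]Rintegral_mkcond; apply: eq_Rintegral => t _; rewrite patchE.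
  case: ifPn => // /negP tN; rewrite /phi tri_out ?mulr0 // leNgt; apply/negP => t1; apply: tN.
  by rewrite inE /= in_itv /= -ler_norml ltW.
have rphi1 : mu.-integrable `[-1, 1] (EFin \o phi).
  exact: (integrableS measurableT _ _ rphi).
have := @Rintegral_itvB R phi (BLeft (-1)) (BRight 1) 0 rphi1.
rewrite !bnd_simp lerN10 ler01 => /(_ isT isT) /eqP.
rewrite subr_eq => /eqP ->.
rewrite Rintegral_itv_obnd_cbnd; last exact: (integrableS measurableT _ _ rphi).
have -> : \int[mu]_(t in `[0, 1]) phi t = (1 - cos a) / a ^+ 2.
  rewrite (@eq_Rintegral _ _ R mu _ (fun s : R => (1 - s) * cos (a * s)) phi); last first.
    move=> s; rewrite inE /= in_itv /= => /andP[s0 s1].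
    by rewrite /phi tri_in // (ger0_norm s0) // divr1 mulrC.
  rewrite (FTC2_global _ _ dP) //; last first.
    by move=> s; apply: cvgM; [apply: cvgB; [exact: cvg_cst|exact: cvg_id]|exact: ccos].
  rewrite !fctE /= !mulr1 !mulr0 sin0 cos0 /GRing.scale /=; field.
  exact: a0.
have -> : \int[mu]_(t in `[-1, 0]) phi t = (1 - cos a) / a ^+ 2.
  rewrite (@eq_Rintegral _ _ R mu _ (fun s : R => (1 + s) * cos (a * s)) phi); last first.
    move=> s; rewrite inE /= in_itv /= => /andP[s1 s0].
    by rewrite /phi tri_in // (ler0_norm s0) ?divr1 ?opprK 1?mulrC //; lra.
  rewrite (FTC2_global _ _ dQ) //; last first.
    by move=> s; apply: cvgM; [apply: cvgD; [exact: cvg_cst|exact: cvg_id]|exact: ccos].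
  rewrite !fctE /= !mulrN1 !mulr0 sin0 cos0 cosN /GRing.scale /=; field.
  exact: a0.
by field.
Qed.

Lemma fejer_ge0 x : 0 <= fejer x.
Proof.
have [->|x0] := eqVneq x 0.
  apply: Rintegral_ge0 => t _; rewrite mulr0 expi0 /= mul1r mul0r subr0; exact: tri_ge0.
by rewrite fejerE // divr_ge0 ?sqr_ge0 // mulr_ge0 // subr_ge0 cos_le1.
Qed.

Lemma continuous_fejer : continuous fejer.
Proof. by have [] := fourier_ccont (Cc_tri (ltr01 : 0 < 1 :> R)). Qed.

(** The kernel is at most 2, by integrating over [[-1, 1]], and [x^2] times it is at most 4, by the
    closed form; 8 is a round bound for the sum. The right side is an integrable majorant. *)
Lemma fejer_le x : fejer x <= 8 * (1 + x ^+ 2)^-1.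
Proof.
have x2 : 0 < 1 + x ^+ 2 by rewrite ltr_pwDl // sqr_ge0.
rewrite ler_pdivlMr //.
have le1 : fejer x <= 2.
  have := normRe_le (fourier (fun t => (tri 1 t)%:C) x); rewrite -/(fejer x) => h.
  have hr : rint (tri 1) by have [] := Cc_intg (Cc_tri (ltr01 : 0 < 1 :> R)).
  have : fejer x <= \int[mu]_t box 1 t.
    apply: le_Rintegral => //; [|exact: rint_box|].
      by have [] := Cc_intg (Cc_expi x (Cc_tri (ltr01 : 0 < 1 :> R))).
    move=> t _; rewrite /= mulr0 subr0.
    have [t1|t1] := leP `|t| 1; last by rewrite tri_out ?mulr0 ?box_ge0 // ltW.
    rewrite box_in //; apply: le_trans (tri_le1 t ltr01).
    by rewrite ler_piMl ?tri_ge0 // cos_le1.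
  by rewrite Rintegral_box // mulr1.
have f0 := fejer_ge0 x.
have le2 : fejer x * x ^+ 2 <= 4.
  have [->|x0] := eqVneq x 0; first by rewrite expr0n mulr0.
  have p0 := pi_gt0 R; have p1 := pi_ge2 R.
  have a0 : (2 * pi * x) ^+ 2 != 0 by rewrite expf_neq0 // !mulf_neq0 // gt_eqF.
  have h : fejer x * (2 * pi * x) ^+ 2 = 2 * (1 - cos (2 * pi * x)).
    by rewrite fejerE // divfK.
  have c1 := cos_geN1 (2 * pi * x).
  have xx : x ^+ 2 <= (2 * pi * x) ^+ 2.
    by rewrite [leRHS]exprMn ler_peMl ?sqr_ge0 //; nra.
  by have := ler_wpM2l f0 xx; lra.
by rewrite mulrDr mulr1; lra.
Qed.

Lemma rint_oneDsqrV : rint (fun x : R => (1 + x ^+ 2)^-1).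
Proof.
have c1 : continuous (fun x : R => (1 + x ^+ 2)^-1).
  move=> x; apply: cvgV; first by rewrite gt_eqF // ltr_pwDl // sqr_ge0.
  by apply: cvgD; [exact: cvg_cst|exact: exprn_continuous].
have g0 (x : R) : 0 <= (1 + x ^+ 2)^-1.
  by rewrite invr_ge0 addr_ge0 // sqr_ge0.
apply/integrableP; split.
  by apply/measurable_EFinP; exact: continuous_measurable_fun.
under eq_integral do rewrite /= ger0_norm //.
rewrite (ge0_symfun_integralT (f := fun x => (1 + x ^+ 2)^-1)) //; last first.
  by move=> x; rewrite /= sqrrN.
rewrite -set_itvcy (@ge0_continuous_FTC2y R _ (@atan R) 0 (pi / 2)) //.
- by rewrite -EFinB -EFinM ltry.
- exact: continuous_subspaceT.
- exact: cvgy_atan.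
- by apply: cvg_at_right_filter; exact: continuous_atan.
- by move=> x _; rewrite derive1_atan.
Qed.

Lemma rint_fejer : rint fejer.
Proof.
apply: le_integrable (rintZ 8 rint_oneDsqrV) => //.
  have m := continuous_measurable_fun continuous_fejer.
  by apply/measurable_EFinP; exact: m.
move=> x _; rewrite /= lee_fin ger0_norm ?fejer_ge0 //.
by apply: le_trans (fejer_le x) (ler_norm _).
Qed.

Definition fejerC : R := \int[mu]_x fejer x.

(** The triangle is at least 1/2 on [[-1/2, 1/2]], so the kernel is at least 1/2 at 0. By continuity
    it exceeds 1/4 near 0, and it is nonnegative elsewhere. *)
Lemma fejerC_gt0 : 0 < fejerC.
Proof.
have f0 : 2^-1 <= fejer 0.
  have : \int[mu]_t (2^-1 * box 2^-1 t) <= fejer 0.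
    apply: le_Rintegral => //; [exact/rintZ/rint_box| |].
      by have [] := Cc_intg (Cc_expi 0 (Cc_tri (ltr01 : 0 < 1 :> R))).
    move=> t _; rewrite mulr0 expi0 mul1r /=.
    have [t1|t1] := leP `|t| 2^-1.
      by rewrite box_in // tri_in ?divr1 ?mulr1; lra.
    rewrite /box indicE memNset ?mulr0 ?tri_ge0 //= in_itv /= -ler_norml.
    by apply/negP; rewrite -ltNge.
  by rewrite RintegralZl //; [rewrite Rintegral_box //; lra|exact: rint_box].
have [d d0 hd] : exists2 d : R, 0 < d & forall x, `|x| <= d -> 4^-1 <= fejer x.
  have q0 : 0 < 4^-1 :> R by [].
  have /cvgrPdist_lt /(_ _ q0) [d /= d0 hd] := @continuous_fejer 0.
  exists (d / 2) => [|x xd]; first by rewrite divr_gt0.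
  have := hd x; rewrite /= sub0r normrN => h.
  have : `|x| < d by lra.
  by move=> /h; rewrite ltr_norml => /andP[_ h2]; lra.
have : \int[mu]_t (4^-1 * box d t) <= fejerC.
  apply: le_Rintegral => //; [exact/rintZ/rint_box|exact: rint_fejer|].
  move=> t _; have [td|td] := leP `|t| d; first by rewrite box_in // mulr1 hd.
  rewrite /box indicE memNset ?mulr0 ?fejer_ge0 //= in_itv /= -ler_norml.
  by apply/negP; rewrite -ltNge.
by rewrite RintegralZl //; [rewrite Rintegral_box; [lra|exact: ltW]|exact: rint_box].
Qed.

End fejer.

(** * Plancherel identity *)

Section approximate_identity.
Context {R : realType}.
Local Notation mu := (leb R).
Implicit Types (f g : R -> R[i]).

Lemma Rdominated_cvg (f_ : nat -> R -> R) (f g : R -> R) :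
  (forall n, measurable_fun setT (f_ n)) -> measurable_fun setT f ->
  (forall x, f_ ^~ x @ \oo --> f x) -> rint g ->
  (forall n x, `|f_ n x| <= g x) ->
  \int[mu]_x f_ n x @[n --> \oo] --> \int[mu]_x f x.
Proof.
move=> mf_ mf ff rg fg.
have [||||| rf _ h] := @dominated_convergence _ _ R mu setT measurableT
    (fun n => EFin \o f_ n) (EFin \o f) (EFin \o g).
- by move=> n; apply/measurable_EFinP; exact: mf_.
- by apply/measurable_EFinP; exact: mf.
- by apply: aeW => x _; apply: cvg_EFin; [exact: nearW|exact: ff].
- exact: rg.
- by apply: aeW => x n _; rewrite /= lee_fin.
apply: fine_cvg; rewrite -/(Rintegral _ _ _).
rewrite fineK; last exact: integrable_fin_num rf.
exact: h.
Qed.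

(** Dominated convergence, the kernel itself dominating, as the boxes exhaust the line. *)
Lemma fejer_tail (e : R) : 0 < e ->
  exists2 B, 0 < B & \int[mu]_x (fejer x * (1 - box B x)) <= e.
Proof.
move=> e0; have mfe := rint_meas (@rint_fejer R).
have mb A : measurable_fun setT (@box R A) := rint_meas (rint_box A).
have box1 A (x : R) : box A x <= 1.
  by rewrite /box indicE; case: (_ \in _); rewrite // ler01.
have := @Rdominated_cvg (fun n x => fejer x * (1 - box n.+1%:R x)) (cst 0) fejer.
move=> /(_ _ _ _ (@rint_fejer R) _) h.
have {h}/cvgrPdist_lt : \int[mu]_x (fejer x * (1 - box n.+1%:R x)) @[n --> \oo] -->
  \int[mu]_x (cst 0 : R -> R) x.
  apply: h => [n|//|x|n x].
  - by apply: measurable_funM => //; apply: measurable_funB.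
  - apply/cvgrPdist_lt => d d0; exists (Num.truncn `|x|) => // n /= nx.
    rewrite box_in ?subrr ?mulr0 ?subr0 ?normr0 //.
    apply/ltW; apply: lt_le_trans (truncnS_gt _) _.
    by rewrite ler_nat ltnS.
  - rewrite normrM (ger0_norm (fejer_ge0 x)) ler_piMr ?fejer_ge0 //.
    rewrite ger0_norm ?subr_ge0 // lerBlDr lerDl; exact: box_ge0.
move=> /(_ _ e0) [N _ hN]; exists N.+1%:R => //.
have := hN N (leqnn N); rewrite /= Rintegral_cst // mul0r sub0r normrN => /ltW.
by apply: le_trans; exact: ler_norm.
Qed.

Lemma fejer_even (x : R) : fejer (- x) = fejer x.
Proof.
rewrite /fejer /fourier [in RHS]Cint_reflect; last exact/Cc_intg/Cc_expi/Cc_tri.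
congr (complex.Re (Cint _ _)); apply/funext => t.
by rewrite mulrN mulNr /tri normrN.
Qed.

(** The windowed transform, whose inverse transform is a Fejér mean of [f]. The window brings
    [fourier f] back into [Cc], where all transforms are taken. *)
Definition fejer_sum (N : R) f : R -> R[i] := fun s => (tri N s)%:C * fourier f s.

Lemma Cc_fejer_sum N f : 0 < N -> Cc f -> Cc (fejer_sum N f).
Proof. by move=> N0 hf; apply: Cc_mulr; [exact: fourier_ccont|exact: Cc_tri]. Qed.

Lemma fourier_reflect f s : Cc f -> fourier (fun t => f (- t)) s = fourier f (- s).
Proof.
move=> hf; rewrite /fourier [RHS]Cint_reflect; last exact/Cc_intg/Cc_expi.
by congr Cint; apply/funext => t; rewrite mulrNN.
Qed.

Lemma Cc_reflect f : Cc f -> Cc (fun t => f (- t)).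
Proof.
move=> hf; have := @Cc_affine R (-1) 0 f; rewrite oppr_eq0 oner_eq0 => /(_ isT hf).
by under eq_fun do rewrite mulN1r addr0.
Qed.

(** [fourier_Fubini] for the triangle and the reflection of [f], followed by the substitution
    [t = y / N - x]. *)
Lemma fourier_fejer_sum N f x : 0 < N -> Cc f ->
  fourier (fejer_sum N f) (- x) = Cint mu (fun y => (fejer y)%:C * f (x - y / N)).
Proof.
move=> N0 hf; have hg := Cc_reflect hf; have ht := Cc_tri N0.
have := fourier_Fubini ht hg (- x).
have -> : (fun s : R => expi (s * - x) * (tri N s)%:C * fourier (fun t => f (- t)) (- s)) =
          (fun t => expi (t * - x) * fejer_sum N f t).
  by apply/funext => s; rewrite fourier_reflect // opprK /fejer_sum mulrA.
rewrite -/(fourier _ _) => ->.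
have hh : Cc (fun t => fourier (fun t => (tri N t)%:C) (- x - t) * f (- t)).
  apply: Cc_mull => //; apply: (ccont_comp (T := R)); last exact: fourier_ccont.
  by move=> t; apply: cvgB; [exact: cvg_cst|exact: cvg_id].
rewrite (@Cint_affine _ N^-1 (- x)) ?invr_gt0 //; last exact: Cc_intg.
rewrite -CintZ; last first.
  apply: Cc_intg; have := Cc_affine (a := N^-1) (- x) _ hh; apply.
  by rewrite gt_eqF // invr_gt0.
congr Cint; apply/funext => y.
rewrite fourier_tri // mulrA -rmorphM /= mulrA mulVf ?gt_eqF // mul1r.
congr (_%:C * f _); last by rewrite opprD opprK addrC mulrC.
by rewrite -fejer_even; congr fejer; field; rewrite gt_eqF.
Qed.

(** For [|y| <= B] the translate by [y / N] is controlled by uniform continuity; for larger [|y|]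
    the tail of the kernel is small and [f] is bounded. The convergence is uniform in [x]. *)
Lemma fejer_sum_cvg f (e : R) : Cc f -> 0 < e -> exists2 N0, 0 < N0 &
  forall N x, N0 <= N ->
    normc (fourier (fejer_sum N f) (- x) - fejerC%:C * f x) <= e.
Proof.
move=> hf e0; have [M M0 hM] := Cc_bounded hf; have c0 := @fejerC_gt0 R.
(* The budget is [2 * (e1 * fejerC + 2 * M * e2) = e], the outer 2 being that of [normc_Cint]. *)
pose e1 := e / (4 * fejerC).
have e10 : 0 < e1 by rewrite divr_gt0 // mulr_gt0.
have e1E : e1 * fejerC = e / 4 by rewrite /e1; field; rewrite gt_eqF.
pose e2 := e / (8 * M).
have e20 : 0 < e2 by rewrite divr_gt0 // mulr_gt0.
have e2E : e2 * M = e / 8 by rewrite /e2; field; rewrite gt_eqF.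
have [d d0 hd] := Cc_unif hf e10.
have [B B0 hB] := fejer_tail e20.
have rfe := @rint_fejer R.
have mb A : measurable_fun setT (@box R A) := rint_meas (rint_box A).
have box1 A (x : R) : box A x <= 1.
  by rewrite /box indicE; case: (_ \in _); rewrite // ler01.
have rtail : rint (fun x => fejer x * (1 - box B x)).
  apply: le_integrable rfe => //.
    have m : measurable_fun setT (fun x : R => fejer x * (1 - box B x)).
      by apply: measurable_funM; [exact: rint_meas (@rint_fejer R)|apply: measurable_funB].
    by apply/measurable_EFinP; exact: m.
  move=> x _; rewrite /= lee_fin normrM ler_piMr //.
  by rewrite ger0_norm ?subr_ge0 // lerBlDr lerDl; exact: box_ge0.
exists (2 * B / d) => [|N x hN]; first by rewrite divr_gt0 // mulr_gt0.
have N0 : 0 < N by apply: lt_le_trans hN; rewrite divr_gt0 // mulr_gt0.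
have cK : ccont (fun y => (@fejer R y)%:C) by exact/ccont_real/continuous_fejer.
have h1 : intg (fun y => (fejer y)%:C * f (x - y / N)).
  apply/Cc_intg/Cc_mull => //; have := Cc_affine (a := - N^-1) x _ hf.
  rewrite oppr_eq0 invr_eq0 gt_eqF // => /(_ isT).
  by under eq_fun do rewrite mulNr addrC mulrC.
have ik : intg (fun y => (fejer y)%:C) by split; [exact: rint_fejer|exact: integrable0].
have h2 : intg (fun y => f x * (fejer y)%:C) by exact: intgZ.
rewrite fourier_fejer_sum //.
have -> : fejerC%:C * f x = Cint mu (fun y => f x * (fejer y)%:C).
  rewrite CintZ // mulrC; congr (_ * _); apply: complex_eqP => //=.
  by rewrite Rintegral_cst // mul0r.
rewrite -CintB //.
pose h y := e1 * fejer y + 2 * M * (fejer y * (1 - box B y)).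
have rh : rint h by apply: rintD; exact: rintZ.
apply: (@le_trans _ _ (2 * \int[mu]_y h y)).
  apply: normc_Cint => //; first exact: intgB.
  move=> y; have fy := fejer_ge0 y.
  have -> : (fejer y)%:C * f (x - y / N) - f x * (fejer y)%:C =
            (fejer y)%:C * (f (x - y / N) - f x) by ring.
  rewrite normcM normc_real ger0_norm // /h.
  have [yB|yB] := leP `|y| B.
    rewrite box_in // subrr !mulr0 addr0 mulrC ler_wpM2r //; apply/ltW/hd.
    rewrite addrAC subrr sub0r normrN normrM normfV (gtr0_norm N0) ltr_pdivrMr //.
    apply: le_lt_trans yB _; move: hN; rewrite ler_pdivrMr // => hN.
    by rewrite mulrC; lra.
  have -> : box B y = 0.
    by rewrite /box indicE memNset //= in_itv /= -ler_norml; apply/negP; rewrite -ltNge.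
  rewrite subr0 mulr1.
  have := le_normcD (f (x - y / N)) (- f x); rewrite normcN.
  have := hM (x - y / N); have := hM x; nra.
rewrite RintegralD //; [|exact: rintZ|exact: rintZ].
rewrite !RintegralZl // -/fejerC.
have : M * \int[mu]_x (fejer x * (1 - box B x)) <= M * e2 by rewrite ler_wpM2l // ltW.
lra.
Qed.

End approximate_identity.

Section plancherel.
Context {R : realType}.
Local Notation mu := (leb R).
Implicit Types (f g : R -> R[i]).

Lemma continuous_normsq f : ccont f -> continuous (fun x => normsq (f x)).
Proof.
move=> [cr ci] x; rewrite /normsq.
apply: cvgD; apply: cvgM; [exact: cr|exact: cr|exact: ci|exact: ci].
Qed.

Lemma measurable_normsq f : ccont f -> measurable_fun setT (fun x => normsq (f x)).
Proof. by move=> cf; apply: continuous_measurable_fun; exact: continuous_normsq. Qed.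

Lemma Cc_normsq_rint f : Cc f -> rint (fun x => normsq (f x)).
Proof.
move=> hf; have [A _ hA] := Cc_supp hf; have [M M0 hM] := Cc_bounded hf.
apply: (@rint_supp _ _ A (M ^+ 2)).
- by apply: measurable_normsq; exact: Cc_ccont.
- move=> x; rewrite ger0_norm ?normsq_ge0 // -sqr_normc_normsq.
  by rewrite ler_sqr ?nnegrE ?normc_ge0 // ltW.
- by move=> x /hA ->; rewrite /normsq /= expr0n addr0.
Qed.

Lemma Cc_square_integrable f : Cc f -> square_integrable f.
Proof.
move=> hf; have [m1 m2] := Cc_cmeas hf; split => //.
have := Cc_normsq_rint hf => /integrableP[_]; apply: le_lt_trans.
have m := measurable_normsq (Cc_ccont hf).
apply: ge0_le_integral => //.
- by move=> x _; rewrite lee_fin normsq_ge0.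
- by apply/measurable_EFinP; exact: m.
- by apply/measurableT_comp => //; apply/measurable_EFinP; exact: m.
- by move=> x _; rewrite /= lee_fin ler_norm.
Qed.

(** [fourier_Fubini] at [a = 0] for the windowed transform and the conjugate of [f], using that
    conjugating a function conjugates and reflects its transform. *)
Lemma fejer_sum_normsq N f : 0 < N -> Cc f ->
  Cint mu (fun s => (tri N s * normsq (fourier f s))%:C) =
  Cint mu (fun t => Num.conj (f t) * fourier (fejer_sum N f) (- t)).
Proof.
move=> N0 hf; have := fourier_Fubini (Cc_fejer_sum N0 hf) (Cc_conj hf) 0.
have -> : (fun s : R => expi (s * 0) * fejer_sum N f s *
    fourier (fun x => Num.conj (f x)) (- s)) =
    (fun s => (tri N s * normsq (fourier f s))%:C).
  apply/funext => s; rewrite mulr0 expi0 mul1r /fejer_sum rmorphM /= -mulJ_normsq.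
  have -> : fourier (fun x => Num.conj (f x)) (- s) = Num.conj (fourier f s).
    rewrite /fourier -CintJ; last exact/Cc_intg/Cc_expi.
    by congr Cint; apply/funext => t; rewrite rmorphM; congr (_ * _); rewrite mulrN expiN.
  by rewrite -mulrA; congr (_ * _); rewrite mulrC.
by move=> ->; congr Cint; apply/funext => t; rewrite sub0r mulrC.
Qed.

(** Pairing with [f] confines the integral to the support of [f], so uniform convergence of the
    Fejér means is enough. *)
Lemma fejer_sum_ip_cvg f (e : R) : Cc f -> 0 < e -> exists2 N0, 0 < N0 &
  forall N, N0 <= N ->
    normc (Cint mu (fun t => Num.conj (f t) * fourier (fejer_sum N f) (- t))
           - (fejerC * \int[mu]_x normsq (f x))%:C) <= e.
Proof.
move=> hf e0; have [A A0 hA] := Cc_supp hf; have [M M0 hM] := Cc_bounded hf.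
pose e1 := e / (4 * A * M).
have e10 : 0 < e1 by rewrite divr_gt0 // !mulr_gt0.
have e1E : 4 * A * (M * e1) = e by rewrite /e1; field; rewrite !gt_eqF.
have [N0 N00 hN] := fejer_sum_cvg hf e10.
exists N0 => // N nN0; have n0 : 0 < N by exact: lt_le_trans nN0.
have hs := Cc_fejer_sum n0 hf.
have i1 : intg (fun t => Num.conj (f t) * fourier (fejer_sum N f) (- t)).
  apply/Cc_intg/Cc_mulr; last exact: Cc_conj.
  by apply: (ccont_comp (T := R)); [exact: opp_continuous|exact: fourier_ccont].
have i2 : intg (fun t => Num.conj (f t) * (fejerC%:C * f t)).
  by apply/Cc_intg/Cc_mull; [exact/ccontJ/Cc_ccont|apply: Cc_mull => //; exact: ccont_cst].
have -> : (fejerC * \int[mu]_x normsq (f x))%:C = Cint mu (fun t => Num.conj (f t) * (fejerC%:C * f t)).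
  have -> : (fun t => Num.conj (f t) * (fejerC%:C * f t)) = (fun t => fejerC%:C * (normsq (f t))%:C).
    by apply/funext => t; rewrite -mulJ_normsq mulrCA.
  rewrite CintZ; last by split; [exact: Cc_normsq_rint|exact: integrable0].
  rewrite rmorphM; congr (_ * _).
  by apply: complex_eqP => //=; rewrite Rintegral_cst // mul0r.
rewrite -CintB // -e1E.
apply: Cint_bound; [exact: intgB|exact: ltW|by rewrite mulr_ge0 // ltW| |].
  by move=> t tA; rewrite hA // rmorph0 !mul0r subrr.
move=> t _; rewrite -mulrBr normcM.
apply: ler_pM; [exact: normc_ge0|exact: normc_ge0| |exact: hN].
by have := hM t; rewrite conjE /normc /= sqrrN; case: (f t).
Qed.

(** The windowed integrals of [|fourier f|^2] increase to the left side by monotone convergence, and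
    by [fejer_sum_normsq] they converge to the right side. As an equality in the extended reals it
    also provides the square-integrability of [fourier f]. *)
Lemma Plancherel f : Cc f ->
  (\int[mu]_x (normsq (fourier f x))%:E =
   (fejerC * \int[mu]_x normsq (f x))%:E)%E.
Proof.
move=> hf; have cF := fourier_ccont hf.
pose u (n : nat) : R := \int[mu]_s (tri n.+1%:R s * normsq (fourier f s)).
have rn n : rint (fun s => tri n.+1%:R s * normsq (fourier f s)).
  have [+ _] : intg (fun s => (tri n.+1%:R s * normsq (fourier f s))%:C).
    under eq_fun do rewrite rmorphM /=.
    apply/Cc_intg/Cc_mulr; first exact/ccont_real/continuous_normsq.
    exact: Cc_tri.
  exact.
have u_real : u n @[n --> \oo] --> fejerC * \int[mu]_x normsq (f x).
  apply/cvgrPdist_le => e e0; have [N0 N00 hN] := fejer_sum_ip_cvg hf e0.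
  exists (Num.truncn N0) => // n /= nN.
  have nN0 : N0 <= n.+1%:R.
    by apply/ltW; apply: lt_le_trans (truncnS_gt _) _; rewrite ler_nat ltnS.
  have uE : (u n)%:C = Cint mu (fun s => (tri n.+1%:R s * normsq (fourier f s))%:C).
    by apply: complex_eqP => //=; rewrite Rintegral_cst // mul0r.
  have := hN _ nN0; rewrite -fejer_sum_normsq // -uE.
  by rewrite -rmorphB normc_real distrC.
have mF := measurable_normsq cF.
have mt n : measurable_fun setT (tri (n.+1%:R : R)).
  by apply: continuous_measurable_fun; exact: continuous_tri.
have tri_mono (x : R) : {homo (fun n => tri n.+1%:R x) : n m / (n <= m)%N >-> n <= m}.
  move=> n m nm; rewrite /tri.
  have : `|x| / m.+1%:R <= `|x| / n.+1%:R.
    by rewrite ler_wpM2l // lef_pV2 ?posrE ?ltr0n // ler_nat ltnS.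
  by move=> h; rewrite ge_max le_max lexx /= le_max; apply/orP; right; rewrite lerD2l lerN2.
have tri_cvg (x : R) : tri n.+1%:R x @[n --> \oo] --> (1 : R).
  apply/cvgrPdist_lt => e e0; have [N _ hN] := near_infty_natSinv_lt (PosNum (divr_gt0 e0 (ltr_pwDr ltr01 (normr_ge0 x)))).
  exists (maxn N (Num.truncn `|x|)) => // n /=; rewrite geq_max => /andP[/hN /= h nx].
  rewrite tri_in //; last by apply/ltW; apply: lt_le_trans (truncnS_gt _) _; rewrite ler_nat ltnS.
  rewrite opprB addrC subrK ger0_norm ?divr_ge0 //.
  move: h; rewrite ltr_pdivlMr ?ltr_pwDr //; apply: le_lt_trans.
  by rewrite mulrC ler_wpM2l // lerDl.
have u_mono : (u n)%:E @[n --> \oo] --> (\int[mu]_x (normsq (fourier f x))%:E)%E.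
  pose g n x := (tri n.+1%:R x * normsq (fourier f x))%:E.
  have h := @cvg_monotone_convergence _ _ R mu setT measurableT g.
  have -> : (fun n => (u n)%:E) = (fun n => \int[mu]_x g n x)%E.
    by apply/funext => n; rewrite /u /Rintegral fineK //; exact: integrable_fin_num (rn n).
  have -> : (\int[mu]_x (normsq (fourier f x))%:E = \int[mu]_x limn (g ^~ x))%E.
    apply: eq_integral => x _; apply/esym/cvg_lim => //.
    apply: cvg_EFin; first exact: nearW.
    rewrite -[X in _ --> X]mul1r; apply: cvgM; [exact: tri_cvg|exact: cvg_cst].
  apply: h.
  - by move=> n; apply/measurable_EFinP; apply: measurable_funM; [exact: mt|exact: mF].
  - by move=> n x _; rewrite lee_fin mulr_ge0 ?tri_ge0 ?normsq_ge0.
  - by move=> x _ n m nm; rewrite lee_fin ler_wpM2r ?normsq_ge0 //; exact: tri_mono.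
have u_lim : (u n)%:E @[n --> \oo] --> (fejerC * \int[mu]_x normsq (f x))%:E.
  by apply: cvg_EFin => //; exact: nearW.
by rewrite -(cvg_lim _ u_mono) // (cvg_lim _ u_lim).
Qed.

Lemma measurable_fun_normsq f : ccont f -> measurable_fun setT (fun x => (normsq (f x))%:E).
Proof. by move=> /measurable_normsq h; apply/measurable_EFinP; exact: h. Qed.

Definition ifourier f : R -> R[i] := fun x => fourier f (- x).

Lemma ifourier_ccont f : Cc f -> ccont (ifourier f).
Proof.
by move=> hf; apply: (ccont_comp (T := R)); [exact: opp_continuous|exact: fourier_ccont].
Qed.

Lemma iPlancherel f : Cc f ->
  (\int[mu]_x (normsq (ifourier f x))%:E =
   (fejerC * \int[mu]_x normsq (f x))%:E)%E.
Proof.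
move=> hf; have h0 x : (0 <= (normsq (fourier f x))%:E)%E by rewrite lee_fin normsq_ge0.
have h := ge0_integralN (measurable_fun_normsq (fourier_ccont hf)) h0.
exact: (etrans (esym h) (Plancherel hf)).
Qed.

Lemma ifourier_square_integrable f : Cc f -> square_integrable (ifourier f).
Proof.
move=> hf; have [m1 m2] := ccont_cmeas (ifourier_ccont hf).
by split => //; rewrite iPlancherel // ltry.
Qed.

End plancherel.

(** * Density of Fourier transforms *)

Section density.
Context {R : realType}.
Local Notation mu := (leb R).
Implicit Types (f g : R -> R[i]).

Definition cut (B x : R) : R := Num.max 0 (Num.min 1 (B + 1 - `|x|)).

Lemma cut_ge0 B x : 0 <= cut B x. Proof. by rewrite /cut le_max lexx. Qed.
Lemma cut_le1 B x : cut B x <= 1.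
Proof. by rewrite /cut ge_max ler01 ge_min lexx. Qed.
Lemma cut_in B x : `|x| <= B -> cut B x = 1.
Proof.
move=> h; have -> : cut B x = Num.max 0 1 by rewrite /cut; congr Num.max; apply/min_idPl; lra.
exact/max_idPr.
Qed.
Lemma cut_out B x : B + 1 <= `|x| -> cut B x = 0.
Proof. by move=> h; apply/max_idPl; rewrite ge_min; apply/orP; right; lra. Qed.

Lemma continuous_cut B : continuous (cut B).
Proof.
move=> x; apply: (@continuous_max _ _ (cst 0) (fun x => Num.min 1 (B + 1 - `|x|))).
  exact: cvg_cst.
apply: (@continuous_min _ _ (cst 1) (fun x => B + 1 - `|x|)); first exact: cvg_cst.
by apply: cvgB; [exact: cvg_cst|apply: cvg_norm; exact: cvg_id].
Qed.

Lemma Cc_cut B f : ccont f -> Cc (fun x => (cut B x)%:C * f x).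
Proof.
move=> cf; apply/CcP; split; first by apply: ccontM => //; exact/ccont_real/continuous_cut.
by exists (B + 1) => x xB; rewrite cut_out ?mul0r // ltW.
Qed.

Lemma C0_vanish f : C0 f -> forall e : R, 0 < e ->
  exists B, forall x, B <= `|x| -> normc (f x) <= e.
Proof.
move=> [_ /(@cvg_nmP R R[i]^o) hp /(@cvg_nmP R R[i]^o) hn] e e0.
have [P [_ hP]] := hp _ e0; have [N [_ hN]] := hn _ e0.
exists (Num.max (P + 1) (- N + 1)) => x; rewrite ge_max => /andP[xP xN].
have [x0|x0] := leP 0 x.
  have := hP x; rewrite sub0r nmN ger0_norm // in xP * => h.
  by apply/ltW/h; lra.
have := hN x; rewrite sub0r nmN ltr0_norm // in xN * => h.
by apply/ltW/h; lra.
Qed.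

(** Cut [f] off and take a Fejér mean of the result, divided by [fejerC]: it is the transform of a
    compactly supported function and uniformly close to [f]. This reaches all coefficients in
    [C_0(R)] from those for which the left action is given. *)
Lemma fourier_dense f (e : R) : C0 f -> 0 < e ->
  exists2 g, Cc g & forall x, normc (f x - fourier g x) <= e.
Proof.
move=> hf e0; have e2 : 0 < e / 2 by rewrite divr_gt0.
have [B hB] := C0_vanish hf e2; have [/ccontP cf _ _] := hf.
have hh := Cc_cut B cf; set h := (fun x => _) in hh.
have c0 := @fejerC_gt0 R; have e3 : 0 < fejerC * (e / 2) by rewrite mulr_gt0.
have [N N0 /(_ N _ (lexx N)) hN] := fejer_sum_cvg hh e3.
have hs := Cc_fejer_sum N0 hh.
(* The trailing [+ 0] puts the scalar multiple in the shape of [Cc_linear]. *)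
exists (fun t => fejerC^-1%:C * fejer_sum N h (- t) + 0).
  apply: Cc_linear; first exact: Cc_reflect.
  by apply/CcP; split; [exact: ccont_cst|exists 0].
move=> x; have -> : fourier (fun t => fejerC^-1%:C * fejer_sum N h (- t) + 0) x =
    fejerC^-1%:C * fourier (fejer_sum N h) (- x).
  rewrite -(fourier_reflect _ hs) /fourier -CintZ; last exact/Cc_intg/Cc_expi/Cc_reflect.
  by congr Cint; apply/funext => t; rewrite addr0 mulrCA.
have -> : f x - fejerC^-1%:C * fourier (fejer_sum N h) (- x) =
   (f x - h x) - fejerC^-1%:C * (fourier (fejer_sum N h) (- x) - fejerC%:C * h x).
  by rewrite mulrBr mulrA -rmorphM /= mulVf ?gt_eqF // mul1r opprB addrA subrK.
apply: le_trans (le_normcD _ _) _; rewrite normcN normcM normc_real ger0_norm; last first.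
  by rewrite invr_ge0 ltW.
rewrite [e]splitr; apply: lerD; last by rewrite ler_pdivrMl.
rewrite /h; have [xB|xB] := leP `|x| B.
  by rewrite cut_in // mul1r subrr normc0 ltW.
have -> : f x - (cut B x)%:C * f x = (1 - cut B x)%:C * f x by rewrite rmorphB /= mulrBl mul1r.
rewrite normcM normc_real ger0_norm ?subr_ge0 ?cut_le1 //.
rewrite -[e / 2]mul1r; apply: ler_pM; rewrite ?subr_ge0 ?cut_le1 ?normc_ge0 //.
  by rewrite lerBlDr lerDl cut_ge0.
by apply: hB; exact: ltW.
Qed.

Definition clip (n y : R) : R := Num.max (- n) (Num.min n y).

Lemma clip_bound n y : 0 <= n -> `|clip n y| <= n.
Proof.
move=> n0; rewrite ler_norml /clip le_max lexx /= ge_max ge_min lexx andbT.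
by lra.
Qed.

Lemma clip_id n y : `|y| <= n -> clip n y = y.
Proof.
rewrite ler_norml => /andP[h1 h2]; rewrite /clip.
by rewrite (min_idPr h2); exact/max_idPr.
Qed.

Lemma max_lip (a y z : R) : `|Num.max a y - Num.max a z| <= `|y - z|.
Proof.
have n1 := ler_norm (y - z); have n2 := ler_norm (z - y); rewrite (distrC z) in n2.
have n0 := normr_ge0 (y - z).
rewrite !maxEle; case: (leP a y) => h1; case: (leP a z) => h2; rewrite ler_norml.
all: by apply/andP; split; lra.
Qed.

Lemma min_lip (a y z : R) : `|Num.min a y - Num.min a z| <= `|y - z|.
Proof.
have n1 := ler_norm (y - z); have n2 := ler_norm (z - y); rewrite (distrC z) in n2.
have n0 := normr_ge0 (y - z).
rewrite !minEle; case: (leP a y) => h1; case: (leP a z) => h2; rewrite ler_norml.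
all: by apply/andP; split; lra.
Qed.

Lemma clip_lip n y z : `|clip n y - clip n z| <= `|y - z|.
Proof. exact: le_trans (max_lip _ _ _) (min_lip _ _ _). Qed.

Lemma continuous_clip n (k : R -> R) : continuous k -> continuous (fun x => clip n (k x)).
Proof.
move=> ck x; apply: (@continuous_max _ _ (cst (- n)) (fun x => Num.min n (k x))).
  exact: cvg_cst.
by apply: (@continuous_min _ _ (cst n) k); [exact: cvg_cst|exact: ck].
Qed.

(* Truncation, then approximation in [L^1] by a function truncated likewise. *)
Lemma real_L2_dense (g : R -> R) (e : R) : measurable_fun setT g ->
  rint (fun x => g x ^+ 2) -> 0 < e ->
  exists h : R -> R, [/\ continuous h, exists A, forall x, A < `|x| -> h x = 0,
    rint (fun x => (g x - h x) ^+ 2) & \int[mu]_x (g x - h x) ^+ 2 <= e].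
Proof.
move=> mg rg e0; have fin (I J : R) : I <= e / 4 -> J <= e / 2 -> 2 * I + J <= e by lra.
have e4 : 0 < e / 4 by rewrite divr_gt0.
have mb A : measurable_fun setT (@box R A) := rint_meas (rint_box A).
have mclip n (k : R -> R) : measurable_fun setT k -> measurable_fun setT (fun x => clip n (k x)).
  by move=> mk; apply: measurable_maxr => //; apply: measurable_minr.
pose G (n : nat) x : R := box n.+1%:R x * clip n.+1%:R (g x).
have mG n : measurable_fun setT (G n) by apply: measurable_funM => //; exact: mclip.
have gG n x : `|g x - G n x| <= `|g x|.
  rewrite /G /box indicE; case: (_ \in _); last by rewrite mul0r subr0.
  rewrite mul1r; have n0 : 0 <= n.+1%:R :> R by [].
  have := clip_lip n.+1%:R (g x) 0; rewrite subr0.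
  have -> : clip n.+1%:R 0 = 0 :> R by rewrite clip_id ?normr0.
  rewrite subr0 => _; rewrite /clip maxEle minEle.
  case: (leP n.+1%:R (g x)) => h1.
    have -> : - n.+1%:R <= n.+1%:R :> R by lra.
    by rewrite !ger0_norm; lra.
  case: (leP (- n.+1%:R) (g x)) => h2; first by rewrite subrr normr0.
  by rewrite !ler0_norm; lra.
have sqle (a b : R) : `|a| <= `|b| -> `|a ^+ 2| <= b ^+ 2.
  by move=> ab; rewrite normrX -(real_normK (num_real b)) ler_sqr ?nnegrE.
have rgG n : rint (fun x => (g x - G n x) ^+ 2).
  have m : measurable_fun setT (fun x => (g x - G n x) ^+ 2).
    by apply: measurable_funX; apply: measurable_funB => //; exact: mG.
  apply: le_integrable rg => //; first by apply/measurable_EFinP; exact: m.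
  by move=> x _; rewrite /= lee_fin; apply: le_trans (ler_norm _); exact: sqle.
have [n hn] : exists n, \int[mu]_x (g x - G n x) ^+ 2 <= e / 4.
  have : \int[mu]_x (g x - G n x) ^+ 2 @[n --> \oo] --> \int[mu]_x (cst 0 : R -> R) x.
    apply: (Rdominated_cvg _ _ _ rg) => [n||x|n x].
    - by apply: measurable_funX; apply: measurable_funB => //; exact: mG.
    - exact: measurable_cst.
    - apply/cvgrPdist_lt => d d0; exists (maxn (Num.truncn `|x|) (Num.truncn `|g x|)) => // n.
      rewrite /= geq_max => /andP[nx ng]; rewrite /G box_in.
        rewrite mul1r clip_id; first by rewrite subrr expr0n subr0 normr0.
        by apply/ltW; apply: lt_le_trans (truncnS_gt _) _; rewrite ler_nat ltnS.
      by apply/ltW; apply: lt_le_trans (truncnS_gt _) _; rewrite ler_nat ltnS.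
    - exact: sqle.
  move=> /cvgrPdist_lt /(_ _ e4) [N _ hN]; exists N.
  have := hN N (leqnn N); rewrite /= Rintegral_cst // mul0r sub0r normrN => /ltW.
  by apply: le_trans; exact: ler_norm.
pose a : R := n.+1%:R; have a0 : 0 < a by [].
pose E := `[- (a + 1), a + 1]%classic.
have mE : measurable (E : set (measurableTypeR R)) by exact: measurable_itv.
have Gb x : `|G n x| <= a.
  rewrite /G normrM -[leRHS]mul1r; apply: ler_pM => //; last exact/clip_bound/ltW.
  by rewrite /box indicE; case: (_ \in _); rewrite ?normr1 ?normr0.
have rG : rint (G n).
  apply: (@rint_supp _ _ a a) => // x xa; rewrite /G /box indicE memNset ?mul0r //= in_itv /= -ler_norml.
  by apply/negP; rewrite -ltNge.
have rGE : mu.-integrable E (EFin \o G n) by apply: (integrableS measurableT _ _ rG) => //; exact: measurable_itv.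
have fE : (mu E < +oo)%E.
  have -> : mu E = (if (- (a + 1))%:E < (a + 1)%:E then (a + 1)%:E - (- (a + 1))%:E else 0)%E.
    exact: (@lebesgue_measure_itv R `[- (a + 1), a + 1]).
  by case: ifP => // _; rewrite -EFinB ltry.
have [k_ [ck ik /fine_cvgP[fk kc]]] := approximation_continuous_integrable mE fE rGE.
have ee : 0 < e / 4 / (2 * a) by rewrite !divr_gt0 // mulr_gt0.
move/cvgrPdist_lt: kc => /(_ _ ee) [N1 _ hN1]; have [N2 _ hN2] := fk.
pose k := k_ (maxn N1 N2).
have kE : \int[mu]_(x in E) `|G n x - k x| <= e / 4 / (2 * a).
  have := hN1 (maxn N1 N2) (leq_maxl _ _); rewrite /= sub0r normrN => /ltW.
  by apply: le_trans; exact: ler_norm.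
have ckk : continuous k by exact: ck.
exists (fun x => cut a x * clip a (k x)).
have ch : continuous (fun x => cut a x * clip a (k x)).
  by move=> x; apply: cvgM; [exact: continuous_cut|exact: continuous_clip].
pose D : R -> R := (fun x => `|G n x - k x|) \_ E.
have mk : measurable_fun setT k := continuous_measurable_fun ckk.
have iD : mu.-integrable E (EFin \o (fun x => `|G n x - k x|)).
  apply: integrable_norm; have := integrableB mE rGE (ik (maxn N1 N2)); exact.
have rD : rint D.
  rewrite /rint /D -restrict_EFin.
  by apply/(integrable_mkcond (mu := mu) _ mE).
have DE : \int[mu]_x D x <= e / 4 / (2 * a) by rewrite -Rintegral_mkcond.
have D0 x : 0 <= D x by rewrite /D patchE; case: ifP.
(* Both functions are bounded by [a] and truncation does not increase distances. One factor of the
   square is thus at most [2 a] and the other at most [|G - k|], which turns the [L^1] approximation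
   into an [L^2] one. *)
have bound x : (G n x - cut a x * clip a (k x)) ^+ 2 <= 2 * a * D x.
  have Gx := Gb x; have cx := clip_bound (k x) (ltW a0).
  have c0 := cut_ge0 a x; have c1 := cut_le1 a x.
  have [xa|xa] := leP (a + 1) `|x|.
    rewrite cut_out // mul0r subr0 {1}/G.
    have -> : box n.+1%:R x = 0 :> R.
      rewrite /box indicE memNset //= in_itv /= -ler_norml; apply/negP; rewrite -ltNge.
      by apply: lt_le_trans xa; rewrite ltrDl.
    by rewrite mul0r expr0n /= !mulr_ge0 // ltW.
  have -> : D x = `|G n x - k x|.
    by rewrite /D patchE mem_set //= /E /= in_itv /= -ler_norml ltW.
  have d1 : `|G n x - cut a x * clip a (k x)| <= `|G n x - k x|.
    have [xa1|xa1] := leP `|x| a.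
      rewrite cut_in // mul1r -{1}(clip_id Gx); exact: clip_lip.
    have G0 : G n x = 0.
      rewrite /G /box indicE memNset ?mul0r //= in_itv /= -ler_norml; apply/negP.
      by rewrite -ltNge.
    rewrite G0 !sub0r !normrN normrM -[leRHS]mul1r; apply: ler_pM => //.
      by rewrite ger0_norm.
    have := clip_lip a (k x) 0; rewrite subr0 (@clip_id a 0) ?subr0 //.
    by rewrite normr0 ltW.
  have d2 : `|G n x - cut a x * clip a (k x)| <= 2 * a.
    have : `|cut a x * clip a (k x)| <= a.
      by rewrite normrM (ger0_norm c0) -[leRHS]mul1r; apply: ler_pM.
    have := ler_normB (G n x) (cut a x * clip a (k x)); lra.
  rewrite -real_normK ?num_real // expr2; apply: ler_pM => //.
(* From [(p - r)^2 <= 2 (p - q)^2 + 2 (q - r)^2]. The budget is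
   [2 * (e / 4) + 4 a * (e / (8 a)) = e]. *)
pose h2 x := 2 * (g x - G n x) ^+ 2 + (4 * a) * D x.
have rh2 : rint h2 by apply: rintD; exact: rintZ.
have hle x : (g x - cut a x * clip a (k x)) ^+ 2 <= h2 x.
  have := bound x; rewrite /h2; set p := g x; set q := G n x; set r := _ * clip _ _.
  have := sqr_ge0 ((p - q) - (q - r)); nra.
have rgh : rint (fun x => (g x - cut a x * clip a (k x)) ^+ 2).
  have m : measurable_fun setT (fun x => (g x - cut a x * clip a (k x)) ^+ 2).
    apply: measurable_funX; apply: measurable_funB => //; exact: continuous_measurable_fun.
  apply: le_integrable rh2 => //; first by apply/measurable_EFinP; exact: m.
  move=> x _; rewrite /= lee_fin ger0_norm ?sqr_ge0 //; apply: le_trans (hle x) (ler_norm _).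
split=> //.
- by exists (a + 1) => x xa; rewrite cut_out ?mul0r // ltW.
- apply: (@le_trans _ _ (\int[mu]_x h2 x)); first by apply: le_Rintegral => // x _; exact: hle.
  rewrite RintegralD //; [|exact: rintZ|exact: rintZ].
  rewrite !RintegralZl //; last exact: rgG.
  have : 4 * a * \int[mu]_x D x <= 4 * a * (e / 4 / (2 * a)) by rewrite ler_wpM2l // mulr_ge0 // ltW.
  have -> : 4 * a * (e / 4 / (2 * a)) = e / 2 by field; rewrite gt_eqF.
  exact: fin.
Qed.

Lemma square_integrable_rint f : square_integrable f ->
  rint (fun x => Re (f x) ^+ 2) /\ rint (fun x => Im (f x) ^+ 2).
Proof.
move=> [m1 m2 fin].
have rn : rint (fun x => normsq (f x)).
  apply/integrableP; split.
    have m : measurable_fun setT (fun x => normsq (f x)).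
      by apply: measurable_funD; exact: measurable_funX.
    by apply/measurable_EFinP; exact: m.
  apply: le_lt_trans fin; under eq_integral do rewrite /= ger0_norm ?normsq_ge0 //.
  by [].
split.
- apply: le_integrable rn => //.
    by apply/measurable_EFinP; exact: measurable_funX.
  by move=> x _; rewrite /= lee_fin !ger0_norm ?sqr_ge0 ?normsq_ge0 // lerDl sqr_ge0.
- apply: le_integrable rn => //.
    by apply/measurable_EFinP; exact: measurable_funX.
  by move=> x _; rewrite /= lee_fin !ger0_norm ?sqr_ge0 ?normsq_ge0 // lerDr sqr_ge0.
Qed.

Lemma rint_normsq f : square_integrable f -> rint (fun x => normsq (f x)).
Proof. by move=> /square_integrable_rint[h1 h2]; apply: rintD. Qed.

Lemma L2_dense f (e : R) : square_integrable f -> 0 < e ->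
  exists2 h, Cc h & \int[mu]_x normsq (f x - h x) <= e.
Proof.
move=> hf e0; have [m1 m2 _] := hf; have [r1 r2] := square_integrable_rint hf.
have e2 : 0 < e / 2 by rewrite divr_gt0.
have [h1 [c1 [A hA] i1 l1]] := real_L2_dense m1 r1 e2.
have [h2 [c2 [B hB] i2 l2]] := real_L2_dense m2 r2 e2.
exists (fun x => Complex (h1 x) (h2 x)).
  apply/CcP; split; first by split.
  exists (Num.max A B) => x; rewrite gt_max => /andP[xA xB].
  by rewrite hA // hB.
rewrite (_ : (fun x => normsq _) = (fun x => (Re (f x) - h1 x) ^+ 2 + (Im (f x) - h2 x) ^+ 2)).
  by rewrite RintegralD //; lra.
by apply/funext => x; rewrite /normsq cReD cImD cReN cImN.
Qed.

End density.

(** * The space L^2(R) and the dense range of the Fourier transform *)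

Section L2.
Context {R : realType} {H : hilbert R} {cls : (R -> R[i]) -> H}.
Hypothesis hL : is_L2R cls.
Local Notation mu := (leb R).
Implicit Types (f g : R -> R[i]).

Lemma square_integrable_linear (c : R[i]) f g :
  square_integrable f -> square_integrable g -> square_integrable (fun x => c * f x + g x).
Proof.
move=> hf hg; have [f1 f2 _] := hf; have [g1 g2 _] := hg.
have mc : cmeas (fun x => c * f x + g x).
  by apply: cmeasD => //; apply: cmeasM => //; split; exact: measurable_cst.
have [m1 m2] := mc; split => //.
have ri : rint (fun x => 2 * normsq c * normsq (f x) + 2 * normsq (g x)).
  by apply: rintD; apply: rintZ; exact: rint_normsq.
have /integrableP[_] := ri; apply: le_lt_trans; apply: ge0_le_integral => //.
- by move=> x _; rewrite lee_fin normsq_ge0.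
- have m : measurable_fun setT (fun x => normsq (c * f x + g x)).
    by apply: measurable_funD; exact: measurable_funX.
  by apply/measurable_EFinP; exact: m.
- apply: measurableT_comp => //; apply/measurable_EFinP; exact: rint_meas.
- move=> x _; rewrite /= lee_fin; apply: le_trans (ler_norm _).
  case: (f x) => a b; case: (g x) => p q; case: c {mc m1 m2 ri} => y z; rewrite /normsq /=.
  have := sqr_ge0 ((y * a - z * b) - p); have := sqr_ge0 ((y * b + z * a) - q).
  nra.
Qed.

Lemma cls_linear (c : R[i]) f g : square_integrable f -> square_integrable g ->
  cls (fun x => c * f x + g x) = c *: cls f + cls g.
Proof. by have [h _ _] := hL; exact: h. Qed.

Lemma cls_hip f g : square_integrable f -> square_integrable g ->
  hip (cls f) (cls g) = L2ip f g.
Proof. by have [_ h _] := hL; exact: h. Qed.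

Lemma cls_surj v : exists2 f, square_integrable f & cls f = v.
Proof. by have [_ _ h] := hL; exact: h. Qed.

Lemma cls_nm f : square_integrable f -> nm (cls f) ^+ 2 = \int[mu]_x normsq (f x).
Proof.
move=> hf; have := hip_nm (cls f); rewrite cls_hip // => /(congr1 (@complex.Re R)) /= <-.
by apply: eq_Rintegral => x _; rewrite mulJ_normsq.
Qed.

Lemma cls_zero f : square_integrable f -> (forall x, f x = 0) -> cls f = 0.
Proof.
move=> hf f0; apply: nm_eq0; apply/eqP; rewrite -sqrf_eq0 cls_nm //.
rewrite (_ : (fun x => normsq _) = cst 0); first by rewrite Rintegral_cst // mul0r.
by apply/funext => x; rewrite f0 /normsq /= expr0n addr0.
Qed.

Lemma clsB f g : square_integrable f -> square_integrable g ->
  cls (fun x => f x - g x) = cls f - cls g.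
Proof.
move=> hf hg; have := cls_linear (-1) hg hf; rewrite scaleN1r addrC => <-.
by congr cls; apply/funext => x; rewrite mulN1r addrC.
Qed.

Lemma Cc_cls_dense v (e : R) : 0 < e -> exists2 h, Cc h & nm (cls h - v) < e.
Proof.
move=> e0; have [f hf <-] := cls_surj v.
have e2 : 0 < (e / 2) ^+ 2 by rewrite exprn_gt0 // divr_gt0.
have [h hh hle] := L2_dense hf e2; exists h => //.
have hs := Cc_square_integrable hh.
have fh : square_integrable (fun x => f x - h x).
  by have := square_integrable_linear (-1) hs hf; under eq_fun do rewrite mulN1r addrC.
have e3 : 0 <= e / 2 by rewrite ltW // divr_gt0.
rewrite nmB -clsB //; move: hle; rewrite -(cls_nm fh) ler_sqr ?nnegrE ?nm_ge0 // => hle.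
by apply: le_lt_trans hle _; lra.
Qed.

Lemma nm_ifourier f : Cc f -> nm (cls (ifourier f)) ^+ 2 = fejerC * nm (cls f) ^+ 2.
Proof.
move=> hf; rewrite !cls_nm; [|exact: Cc_square_integrable|exact: ifourier_square_integrable].
by rewrite /Rintegral iPlancherel.
Qed.

(** Uniform convergence of Fejér means does not give [L^2] convergence on the whole line. With [a]
    the class of the mean, [|a|^2 <= C^2 |f|^2] and [Re <f, a> >= C |f|^2 - d] for [C = fejerC],
    hence [|a / C - f|^2 <= 2 d / C]. The choice of [d] makes this bound [(e / 4)^2]. *)
Lemma ifourier_dense v (e : R) : 0 < e -> exists2 h, Cc h & nm (cls (ifourier h) - v) < e.
Proof.
move=> e0; have e2 : 0 < e / 2 by rewrite divr_gt0.
have [f hf fv] := Cc_cls_dense v e2; have c0 := @fejerC_gt0 R.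
pose d := fejerC * (e / 4) ^+ 2 / 2.
have d0 : 0 < d by rewrite /d divr_gt0 // mulr_gt0 // exprn_gt0 // divr_gt0.
have [N N0 /(_ N (lexx N)) hN] := fejer_sum_ip_cvg hf d0.
have hs := Cc_fejer_sum N0 hf.
have [si sh] := (ifourier_square_integrable hs, Cc_square_integrable hf).
have h0 : Cc (fun _ : R => 0 : R[i]) by apply/CcP; split; [exact: ccont_cst|exists 0].
exists (fun x => fejerC^-1%:C * fejer_sum N f x + 0); first exact: Cc_linear.
have -> : ifourier (fun x => fejerC^-1%:C * fejer_sum N f x + 0) =
    (fun x => fejerC^-1%:C * ifourier (fejer_sum N f) x + ifourier (fun=> 0) x).
  by apply/funext => x; rewrite /ifourier fourier_linear.
rewrite (cls_linear fejerC^-1%:C si (ifourier_square_integrable h0)).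
rewrite (cls_zero (ifourier_square_integrable h0)); last first.
  move=> x; rewrite /ifourier /fourier -[RHS](@Cint0 R); congr Cint.
  by apply/funext => t; rewrite mulr0.
rewrite addr0; set a := cls (ifourier _).
(* Plancherel is used twice, for the inverse transform of the windowed function and for [f] itself;
   in between, the window is at most 1. *)
have na : nm a ^+ 2 <= fejerC * (fejerC * nm (cls f) ^+ 2).
  rewrite nm_ifourier //; apply: ler_wpM2l; first exact: ltW.
  rewrite !cls_nm //; last exact: Cc_square_integrable.
  have := Plancherel hf => P.
  have sF : square_integrable (fourier f).
    have [m1 m2] := ccont_cmeas (fourier_ccont hf).
    by split => //; rewrite P ltry.
  have -> : fejerC * \int[mu]_x normsq (f x) = \int[mu]_x normsq (fourier f x).
    by rewrite /Rintegral P.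
  apply: le_Rintegral => //; [exact: Cc_normsq_rint|exact: rint_normsq|].
  move=> x _; rewrite /fejer_sum -!sqr_normc_normsq normcM normc_real exprMn.
  rewrite ler_piMl ?sqr_ge0 // expr_le1 // ger0_norm ?tri_ge0 ?tri_le1 //.
have fa : fejerC * nm (cls f) ^+ 2 - d <= Re (hip (cls f) a).
  rewrite /a cls_hip // cls_nm // /L2ip.
  have := normRe_le (Cint mu (fun t => Num.conj (f t) * ifourier (fejer_sum N f) t) -
    (fejerC * \int[mu]_x normsq (f x))%:C).
  move=> /le_trans /(_ hN); rewrite cReD cReN ler_norml => /andP[h _].
  by move: h; rewrite /=; lra.
have key : nm (fejerC^-1%:C *: a - cls f) ^+ 2 <= (e / 4) ^+ 2.
  have iv0 : 0 <= fejerC^-1 :> R by rewrite invr_ge0 ltW.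
  rewrite nmB_sqr nmZ normc_real (ger0_norm iv0) hipZl conj_real cReM /= mul0r subr0.
  rewrite (Re_hip_sym a) exprMn.
  set r := Re _ in fa *; set p := nm a ^+ 2 in na *; set q := nm (cls f) ^+ 2 in na fa *.
  have i0 : 0 < fejerC^-1 :> R by rewrite invr_gt0.
  have k1 : fejerC^-1 ^+ 2 * p <= q.
    apply: (@le_trans _ _ (fejerC^-1 ^+ 2 * (fejerC * (fejerC * q)))).
      by rewrite ler_wpM2l // sqr_ge0.
    by rewrite le_eqVlt; apply/orP; left; apply/eqP; field; rewrite gt_eqF.
  have k2 : q - fejerC^-1 * d <= fejerC^-1 * r.
    have -> : q - fejerC^-1 * d = fejerC^-1 * (fejerC * q - d) by field; rewrite gt_eqF.
    by rewrite ler_wpM2l // ltW.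
  have k3 : fejerC^-1 * d = (e / 4) ^+ 2 / 2 by rewrite /d; field; rewrite gt_eqF.
  by lra.
have e40 : 0 <= e / 4 by rewrite ltW // divr_gt0.
move: key; rewrite ler_sqr ?nnegrE ?nm_ge0 // => key.
apply: le_lt_trans (nm_triangle (cls f) _ _) _; lra.
Qed.

End L2.

(** * Functions on Z_2 x (R x| <2>) *)

Section two_adic_integers.
Implicit Types (z w : Z2) (l : int) (n k m : nat).

Lemma Z2resD z w n : Z2res (Z2add z w) n = ((Z2res z n + Z2res w n) %% 2 ^ n)%N.
Proof. by []. Qed.

Lemma Z2resM z w n : Z2res (Z2mul z w) n = ((Z2res z n * Z2res w n) %% 2 ^ n)%N.
Proof. by []. Qed.

Lemma Z2res_int l n : Z2res (Z2int l) n = `|(l %% (2 ^ n)%N)%Z|%N.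
Proof. by []. Qed.

Lemma Z2_eq z w : (forall n, Z2res z n = Z2res w n) -> z = w.
Proof. by move=> h; apply: val_inj; apply/funext => n; exact: h. Qed.

Lemma Z2res_lt z n : (Z2res z n < 2 ^ n)%N.
Proof. by rewrite Z2resE ltn_mod expn_gt0. Qed.

Lemma Z2res_mod z m n : (m <= n)%N -> Z2res z m = (Z2res z n %% 2 ^ m)%N.
Proof.
move=> /subnKC <-; elim: (n - m)%N => [|d ih].
  by rewrite addn0 modn_small // Z2res_lt.
by rewrite addnS ih (Z2resE z (m + d)) modn_dvdm // dvdn_exp2l // leq_addr.
Qed.

Lemma Z2res_le z w m n : (m <= n)%N -> Z2res z n = Z2res w n -> Z2res z m = Z2res w m.
Proof. by move=> mn h; rewrite (Z2res_mod z mn) (Z2res_mod w mn) h. Qed.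

Lemma modn_divn2 a b n k : (2 ^ k %| a)%N -> (2 ^ k %| b)%N ->
  a = b %[mod 2 ^ (n + k)] -> (a %/ 2 ^ k)%N = (b %/ 2 ^ k)%N %[mod 2 ^ n].
Proof.
move=> /dvdnP[a' ->] /dvdnP[b' ->]; rewrite expnD -!muln_modl !mulnK ?expn_gt0 //.
by move/eqP; rewrite eqn_pmul2r ?expn_gt0 // => /eqP.
Qed.

(** Conversely, [z - l] has to be divided by [2^k]. Division costs [k] digits, so the residue of the
    quotient modulo [2^n] is read off at level [n + k]. *)
Lemma Z2cosetP l k z : Z2coset l k z <-> Z2res z k = Z2res (Z2int l) k.
Proof.
split=> [[w ->]|h].
  rewrite Z2resD Z2resM [Z2res (Z2int (2 ^+ k)) k]Z2res_int.
  have -> : (2 : int) ^+ k = (2 ^ k)%N by rewrite -natz natrX.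
  by rewrite modzz mul0n mod0n addn0 modn_small // Z2res_lt.
pose L n := Z2res (Z2int l) n.
(* A natural number representing [z - l] modulo [2^n]; the added [2^n] avoids truncated
   subtraction. *)
pose d n := (Z2res z n + (2 ^ n - L n))%N.
have LE n : (d n + L n)%N = Z2res z n %[mod 2 ^ n].
  by rewrite /d -addnA subnK ?modnDr // ltnW // Z2res_lt.
have dn n : (2 ^ k %| d (n + k)%N)%N.
  have : (d (n + k) + L (n + k))%N = (L (n + k))%N %[mod 2 ^ k].
    have := LE (n + k)%N => /(congr1 (modn^~ (2 ^ k)%N)); rewrite !modn_dvdm ?dvdn_exp2l ?leq_addl //.
    by move=> ->; rewrite -!Z2res_mod ?leq_addl.
  by rewrite -{2}[L _]add0n => /eqP; rewrite eqn_modDr mod0n => /eqP /eqP.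
have dd n : d (n + k)%N = d (n.+1 + k)%N %[mod 2 ^ (n + k)].
  apply/eqP; rewrite -(eqn_modDr (L (n + k)%N)) LE; apply/eqP.
  have -> : (d (n.+1 + k) + L (n + k))%N = (d (n.+1 + k) + L (n.+1 + k))%N %[mod 2 ^ (n + k)].
    by rewrite /L (@Z2res_mod _ (n + k) (n.+1 + k)) ?leq_add2r // modnDmr.
  have /(congr1 (modn^~ (2 ^ (n + k))%N)) := LE (n.+1 + k)%N.
  rewrite !modn_dvdm ?dvdn_exp2l ?leq_add2r // => ->.
  by rewrite (@Z2res_mod z (n + k) (n.+1 + k)) ?leq_add2r // modn_mod.
have hw n : ((d (n + k) %/ 2 ^ k) %% 2 ^ n = (d (n.+1 + k) %/ 2 ^ k %% 2 ^ n.+1) %% 2 ^ n)%N.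
  by rewrite modn_exp2; apply: modn_divn2.
exists (mkZ2 hw); apply: Z2_eq => n.
rewrite Z2resD Z2resM [Z2res (Z2int (2 ^+ k)) n]Z2res_int.
have -> : (2 : int) ^+ k = (2 ^ k)%N by rewrite -natz natrX.
rewrite modz_nat /= modnMml -[Z2res (mkZ2 hw) n]/((d (n + k) %/ 2 ^ k) %% 2 ^ n)%N.
rewrite modnMmr modnDmr mulnC divnK //.
rewrite -[in LHS](modn_small (Z2res_lt z n)) (@Z2res_mod z n (n + k)) ?leq_addr // modn_mod.
have /(congr1 (modn^~ (2 ^ n)%N)) := LE (n + k)%N.
rewrite !modn_dvdm ?dvdn_exp2l ?leq_addr // => <-.
by rewrite (@Z2res_mod (Z2int l) n (n + k)) ?leq_addr // modnDml addnC.
Qed.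

Lemma nbhs_Z2res z n : nbhs z [set w | Z2res w n = Z2res z n].
Proof.
have c : continuous (fun w : Z2 => (val w) n : nat).
  move=> w; apply: (@continuous_comp _ _ _ (val : Z2 -> _) (fun f => f n)).
    exact: initial_continuous.
  exact: (@proj_continuous _ (fun=> nat) n).
exact: (c z _ (discrete_set1 (val z n))).
Qed.

Lemma Z2_compact : compact [set: Z2].
Proof.
have cZ : compact Z2set.
  have cT := @tychonoff nat (fun=> nat) (fun n => [set k | (k < 2 ^ n)%N]).
  apply: (subclosed_compact _ (cT _)).
  - move=> x clx n; have cn m : nbhs x [set y : prod_topology (fun=> nat) | y m = x m].
      exact: (@proj_continuous _ (fun=> nat) m x _ (discrete_set1 (x m))).
    have [y [Zy [yn yn1]]] := clx _ (filterI (cn n) (cn n.+1)).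
    by rewrite -[x n]yn -[x n.+1]yn1.
  - by move=> n; apply: finite_compact; exact: finite_II.
  - by move=> x Zx n /=; rewrite Zx ltn_mod expn_gt0.
move=> F PF _; have [|x [Zx clx]] := cZ ((val : Z2 -> prod_topology (fun=> nat)) @ F) _.
  by apply: (@filterS _ F _ setT) filterT => w _ /=; have := valP w; rewrite inE.
exists (SigSub (mem_set Zx)); split => // A B FA.
rewrite nbhsE => -[_ [[V oV <-] /= Vx] VB].
have FvA : ((val : Z2 -> prod_topology (fun=> nat)) @ F) (val @` A).
  by apply: (@filterS _ F _ A) FA => w Aw; exists w.
have [_ [[w Aw <-] Vw]] := clx _ _ FvA (open_nbhs_nbhs (conj oV Vx)).
by exists w; split => //; apply: VB.
Qed.

(** Each [w] different from [z] is separated from it, together with a neighbourhood, by some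
    residue. Compactness of [Z_2] yields one modulus [2^k] that separates [z] from every point
    outside [U]. *)
Lemma nbhs_Z2_basis z (U : set Z2) : nbhs z U ->
  exists k, forall w, Z2res w k = Z2res z k -> U w.
Proof.
move=> nU; have := (compact_near_coveringP _).1 Z2_compact nat \oo
  (fun k w => U w \/ Z2res w k <> Z2res z k).
move=> /(_ _) [].
  move=> w _; have [->|wz] := pselect (w = z).
    exists (U, setT); first by split=> //; exact: filterT.
    by move=> [w' k] [/= h _]; left.
  have [n wn] : exists n, Z2res w n <> Z2res z n.
    by apply: contrapT => h; apply: wz; apply: Z2_eq => n; apply: contrapT => h2; apply: h; exists n.
  exists ([set w' | Z2res w' n = Z2res w n], [set k | (n <= k)%N]).
    by split; [exact: nbhs_Z2res|exists n].
  move=> [w' k] /= [h nk]; right => e; apply: wn.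
  by rewrite -h; exact: Z2res_le e.
move=> N _ hN; exists N => w h.
by have [//|] := hN N (leqnn N) w I.
Qed.

End two_adic_integers.

Section bimodule_functions.
Context {R : realType}.
Local Notation XD := (Xdom R).

Lemma locally_constant_ccont (T : topologicalType) (f : T -> R[i]) :
  (forall x, \forall y \near x, f y = f x) -> ccont f.
Proof.
move=> h; apply/ccontP => x; apply/cvg_nmP => e e0; have := h x; apply: filterS => y ->.
by rewrite subrr nm0.
Qed.

Lemma Cc_linear_top (T : topologicalType) (c : R[i]) (f g : T -> R[i]) :
  Cc f -> Cc g -> Cc (fun x => c * f x + g x).
Proof.
move=> [/ccontP cf kf] [/ccontP cg kg]; split.
  by apply/ccontP; apply: ccontD => //; apply: ccontM => //; exact: ccont_cst.
apply: (@subclosed_compact _ _ (closure [set x | f x != 0] `|` closure [set x | g x != 0])).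
- exact: closed_closure.
- exact: compactU.
- rewrite -closureU; apply: closure_subset => x /= h.
  have [fx|fx] := eqVneq (f x) 0; last by left.
  by right; move: h; rewrite fx mulr0 add0r.
Qed.

Lemma Cc_zero (T : topologicalType) : Cc (fun _ : T => 0 : R[i]).
Proof.
split; first exact/ccontP/ccont_cst.
rewrite (_ : [set x | _] = set0) ?closure0; first exact: compact0.
by apply/seteqP; split => // x /=; rewrite eqxx.
Qed.

Lemma Cc_sum (T : topologicalType) (I : Type) (r : seq I) (c : I -> R[i]) (f : I -> T -> R[i]) :
  (forall i, Cc (f i)) -> Cc (fun x => \sum_(i <- r) c i * f i x).
Proof.
move=> hf; elim: r => [|i r ih].
  by under eq_fun do rewrite big_nil; exact: Cc_zero.
by under eq_fun do rewrite big_cons; exact: Cc_linear_top.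
Qed.

Definition resb (l : int) (k : nat) (z : Z2) : bool := Z2res z k == Z2res (Z2int l) k.

Lemma X0_elemE l k (xi : R -> R[i]) m (q : XD) :
  X0_elem l k xi m q = (resb l k q.1)%:R * xi q.2.1 * (q.2.2 == m)%:R.
Proof.
rewrite /X0_elem indicE; congr (_%:R * _ * _); congr nat_of_bool.
by apply/idP/eqP; rewrite inE => /Z2cosetP.
Qed.

Lemma nbhs_Xdom (q : XD) k :
  \forall p \near q, Z2res p.1 k = Z2res q.1 k /\ p.2.2 = q.2.2.
Proof.
have h1 : \forall p \near q, Z2res p.1 k = Z2res q.1 k.
  exact: (@cvg_fst _ _ _ _ _ _ (nbhs_Z2res q.1 k)).
have h2 : \forall p \near q, p.2.2 = q.2.2.
  have c : continuous (fun p : XD => p.2.2).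
    move=> p; apply: (@continuous_comp _ _ _ (fun p : XD => p.2) snd); exact: cvg_snd.
  exact: (c q _ (discrete_set1 _)).
by apply: filterS2 h1 h2 => p.
Qed.

Lemma continuous_Xdom_real : continuous (fun p : XD => p.2.1).
Proof.
move=> p; apply: (@continuous_comp _ _ _ (fun p : XD => p.2) fst); first exact: cvg_snd.
exact: cvg_fst.
Qed.

Lemma Cc_Xdom (f : XD -> R[i]) (A : R) (m : int) : ccont f ->
  (forall q, f q != 0 -> `|q.2.1| <= A /\ q.2.2 = m) -> Cc f.
Proof.
move=> cf hf; split; first exact/ccontP.
pose K := [set: Z2] `*` (`[- A, A]%classic `*` [set m : discrete_topology int]).
have cK : compact K.
  by apply: compact_setX; [exact: Z2_compact|apply: compact_setX; [exact: segment_compact|exact: compact_set1]].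
apply: (subclosed_compact _ cK); first exact: closed_closure.
have clK : closed K.
  move=> q cl; split => //; split => /=.
  - apply: (@interval_closed R (BLeft (- A)) (BRight A)) => // B nB.
    have [p [[_ [h _]] Bp]] := cl _ (continuous_Xdom_real nB).
    by exists p.2.1.
  - have [p [[_ [_ h]] [_ h2]]] := cl _ (nbhs_Xdom q 0).
    by rewrite -h2.
rewrite [X in _ `<=` X](closure_id _).1 //; apply: closure_subset => q /hf[h1 h2].
by split => //; split => //=; rewrite in_itv /= -ler_norml.
Qed.

Lemma Cc_X0_elem l k (xi : R -> R[i]) m : Cc xi -> Cc (X0_elem l k xi m).
Proof.
move=> hxi; have [A _ hA] := Cc_supp hxi.
apply: (@Cc_Xdom _ A m).
  have -> : X0_elem l k xi m = (fun q : XD => (resb l k q.1)%:R * xi q.2.1 * (q.2.2 == m)%:R).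
    by apply/funext => q; exact: X0_elemE.
  apply: ccontM; [apply: ccontM|].
  - apply: locally_constant_ccont => q; have := nbhs_Xdom q k; apply: filterS => p [h _].
    by rewrite /resb h.
  - exact: (ccont_comp continuous_Xdom_real (Cc_ccont hxi)).
  - apply: locally_constant_ccont => q; have := nbhs_Xdom q k; apply: filterS => p [_ h].
    by rewrite h.
move=> q; rewrite X0_elemE => h; split; last first.
  have [//|ne] := eqVneq (q.2.2 : int) m.
  by move: h; rewrite (negbTE ne) mulr0 eqxx.
by rewrite leNgt; apply/negP => /hA xi0; move: h; rewrite xi0 mulr0 mul0r eqxx.
Qed.

Lemma Z2res_nat (r k : nat) : Z2res (Z2int r) k = (r %% 2 ^ k)%N.
Proof. by rewrite Z2res_int modz_nat. Qed.

Lemma resb_nat (r k : nat) z : (r < 2 ^ k)%N -> resb r k z = (Z2res z k == r).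
Proof. by move=> rk; rewrite /resb Z2res_nat modn_small. Qed.

(** Replaces [z] by its residue modulo [2^k] and keeps the dilations in [ms], see [trunc_sumE]. The
    factor [1 *] gives the terms the shape expected by [iota_sum]. *)
Definition trunc_sum (f : XD -> R[i]) (k : nat) (ms : seq int) : XD -> R[i] :=
  fun q => \sum_(i <- [seq (r, m) | r <- iota 0 (2 ^ k), m <- ms])
    1 * X0_elem i.1 k (fun t => f (Z2int i.1, (t, i.2))) i.2 q.

Lemma trunc_sumE f k ms q : uniq ms -> trunc_sum f k ms q =
  if (q.2.2 : int) \in ms then f (Z2int (Z2res q.1 k), q.2) else 0.
Proof.
move=> ums; rewrite /trunc_sum big_allpairs /=.
rewrite (bigD1_seq (Z2res q.1 k)) ?iota_uniq ?mem_iota ?add0n ?Z2res_lt //=.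
rewrite [X in _ + X]big1_seq ?addr0; last first.
  move=> r /andP[rk]; rewrite mem_iota add0n => /andP[_ r2]; apply: big1 => m _.
  by rewrite mul1r X0_elemE /= resb_nat // eq_sym (negbTE rk) !mul0r.
case: ifPn => [mm|mm].
  rewrite (bigD1_seq (q.2.2 : int)) //= [X in _ + X]big1 ?addr0; last first.
    by move=> m mk; rewrite mul1r X0_elemE /= [_ == m]eq_sym (negbTE mk) mulr0.
  rewrite mul1r X0_elemE /= resb_nat ?Z2res_lt // !eqxx mul1r mulr1.
  by case: q {mm} => [z [t m]].
rewrite big1_seq // => m /andP[_ mms]; rewrite mul1r X0_elemE /=.
have -> : ((q.2.2 : int) == m) = false.
  by apply/negbTE/eqP => e; move: mm; rewrite e mms.
by rewrite mulr0.
Qed.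

Lemma near_compact_int (N : nat) : exists ms : seq int, uniq ms /\
  forall m : int, `|m%:~R| <= N%:R :> R -> m \in ms.
Proof.
exists [seq i%:Z - N%:Z | i <- iota 0 (2 * N).+1]; split.
  rewrite map_inj_uniq ?iota_uniq // => a b /addIr; by case.
move=> m; rewrite -intr_norm pmulrn ler_int ler_norml => /andP[h1 h2].
apply/mapP; exists (absz (m + N%:Z)); last by rewrite gez0_abs; lia.
rewrite mem_iota; lia.
Qed.

(** The compact set is fixed before [e]: continuity for the inductive limit topology gives one
    constant per compact set, so all approximants must be supported in the same one. *)
Lemma X0_dense (f : XD -> R[i]) : Cc f -> exists2 K : set XD, compact K &
  (forall q, f q != 0 -> K q) /\
  forall e : R, 0 < e -> exists k ms,
    [/\ forall l m, Cc (fun t => f (Z2int l, (t, m))),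
     (forall q, trunc_sum f k ms q != 0 -> K q) &
     (forall q, normc (f q - trunc_sum f k ms q) < e)].
Proof.
move=> [/ccontP cf kf].
have cint : continuous (fun q : XD => (q.2.2 : int)%:~R : R).
  move=> q; apply: cvg_near_cst; have := nbhs_Xdom q 0; apply: filterS => p [_ h].
  by rewrite h.
have k1 : compact ((fun p : XD => p.2.1) @` closure [set x | f x != 0]).
  apply: continuous_compact kf; exact/continuous_subspaceT/continuous_Xdom_real.
have k2 : compact ((fun q : XD => (q.2.2 : int)%:~R : R) @` closure [set x | f x != 0]).
  apply: continuous_compact kf; exact/continuous_subspaceT.
have [A1 [_ hA1]] := compact_bounded k1.
have [A2 [_ hA2]] := compact_bounded k2.
pose N := (Num.truncn (Num.max `|A1| `|A2|)).+1; pose A : R := N%:R.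
have AA1 : A1 < A.
  by apply: le_lt_trans (truncnS_gt _); rewrite le_max ler_norm.
have AA2 : A2 < A.
  by apply: le_lt_trans (truncnS_gt _); rewrite le_max ler_norm orbT.
have s1 q : f q != 0 -> `|q.2.1| <= A.
  by move=> h; apply: (hA1 _ AA1); exists q => //; exact: subset_closure.
have s2 q : f q != 0 -> `|(q.2.2 : int)%:~R : R| <= A.
  by move=> h; apply: (hA2 _ AA2); exists q => //; exact: subset_closure.
have [ms [ums hms]] := near_compact_int N.
pose K := [set: Z2] `*` (`[- A, A]%classic `*` [set m : discrete_topology int | (m : int) \in ms]).
have cK : compact K.
  apply: compact_setX; [exact: Z2_compact|apply: compact_setX; [exact: segment_compact|]].
  apply: finite_compact; exact: (finite_seq ms).
have fK q : f q != 0 -> K q.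
  move=> h; split => //; split => /=; last exact/hms/s2.
  by rewrite in_itv /= -ler_norml; exact: s1.
exists K => //; split => // e e0; have e2 : 0 < e / 2 by rewrite divr_gt0.
(* Near [q] the function varies by less than [e / 2] on a product [V x W], and [V] contains a
   residue class. For [p] near [q] and large [k], truncating the first coordinate of [p] stays in
   [V]; compactness of [K] makes [k] uniform. *)
have [|N0 _ hN0] := (compact_near_coveringP _).1 cK nat \oo
  (fun k q => normc (f q - f (Z2int (Z2res q.1 k), q.2)) < e).
  move=> q _; have [[V W] [nV nW] VW] := ccont_near q cf e2.
  have [k0 hk0] := nbhs_Z2_basis nV.
  exists ([set p | (V `*` W) p /\ Z2res p.1 k0 = Z2res q.1 k0], [set k | (k0 <= k)%N]).
    split; last by exists k0.
    apply: filterI; first by exists (V, W).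
    by have := nbhs_Xdom q k0; apply: filterS => p [].
  move=> [p k] /= [[[Vp Wp] pq] k0k].
  have h1 : normc (f p - f q) < e / 2 by apply: (VW p).
  have h2 : normc (f (Z2int (Z2res p.1 k), p.2) - f q) < e / 2.
    apply: (VW (Z2int (Z2res p.1 k), p.2)); split => //=; apply: hk0.
    by rewrite Z2res_nat -Z2res_mod.
  have -> : f p - f (Z2int (Z2res p.1 k), p.2) =
     (f p - f q) - (f (Z2int (Z2res p.1 k), p.2) - f q) by ring.
  apply: le_lt_trans (le_normcD _ _) _; rewrite normcN; lra.
exists N0, ms; split.
- move=> l m; apply/CcP; split.
    apply: (ccont_comp (T := XD)) cf => t.
    exact: (cvg_pair (cvg_cst _) (cvg_pair cvg_id (cvg_cst _))).
  exists A => t tA; apply/eqP/negP => /negP /s1 /=; by rewrite leNgt tA.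
- move=> q; rewrite trunc_sumE //; case: ifPn => [mm h|]; last by rewrite eqxx.
  split => //; split => //=; rewrite in_itv /= -ler_norml; exact: (s1 _ h).
- move=> q; rewrite trunc_sumE //.
  have [Kq|Kq] := pselect (K q).
    by have -> : (q.2.2 : int) \in ms; [case: Kq => _ []|exact: (hN0 N0 (leqnn _))].
  have f0 : f q = 0 by apply/eqP/negP => /negP /fK.
  rewrite f0; case: ifPn => [mm|]; last by rewrite subrr normc0.
  (* The first factor of [K] is all of [Z_2], so changing the first coordinate cannot bring [q] into
     [K]. *)
  suff -> : f (Z2int (Z2res q.1 N0), q.2) = 0 by rewrite subrr normc0.
  apply/eqP/negP => /negP /s1 /= h; apply: Kq; split => //; split => //=.
  by rewrite in_itv /= -ler_norml.
Qed.

End bimodule_functions.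

(** * The representation of Q_2 on l^2(Z) *)

Section hilbert_sums.
Context {R : realType} {H : hilbert R}.

Lemma hip_suml (I : Type) (r : seq I) (F : I -> H) x :
  hip (\sum_(i <- r) F i) x = \sum_(i <- r) hip (F i) x.
Proof.
elim: r => [|i r ih]; first by rewrite !big_nil hip0l.
by rewrite !big_cons hipDl ih.
Qed.

Lemma hip_sumr (I : Type) (r : seq I) (F : I -> H) x :
  hip x (\sum_(i <- r) F i) = \sum_(i <- r) hip x (F i).
Proof.
elim: r => [|i r ih]; first by rewrite !big_nil hip0r.
by rewrite !big_cons hipDr ih.
Qed.

End hilbert_sums.

Lemma sum_int_single (V : nmodType) (F : int -> V) (n : int) (N : nat) :
  - N%:Z <= n < N%:Z -> (forall k, k <> n -> F k = 0) ->
  \sum_(0 <= k < N) (F k%:Z + F (- k.+1%:Z)) = F n.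
Proof.
move=> nN F0; rewrite big_split /=.
case: n nN F0 => n nN F0.
- rewrite (bigD1_seq n) ?iota_uniq ?mem_index_iota //=; last by lia.
  rewrite big1 ?addr0 => [|k /eqP kn]; last by apply: F0 => -[].
  by rewrite big1 ?addr0 // => k _; apply: F0.
- rewrite [X in X + _]big1 ?add0r => [|k _]; last by apply: F0.
  rewrite (bigD1_seq n) ?iota_uniq ?mem_index_iota //=; last by lia.
  by rewrite big1 ?addr0 ?NegzE // => k /eqP kn; apply: F0; rewrite NegzE; lia.
Qed.

Section l2_space.
Context {R : realType} {H : hilbert R} {vec : (int -> R[i]) -> H}.
Hypothesis hv : is_l2Z vec.

Local Notation d n := (vec (delta_seq R n)).

Lemma square_summable_delta n : square_summable (delta_seq R n).
Proof.
rewrite /square_summable.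
have -> : (fun k => (normsq (delta_seq R n k))%:E) =
    (fun k => if k \in [set n] then 1%E else 0%E).
  apply/funext => k; rewrite /delta_seq; case: (eqVneq k n) => [->|kn].
    by rewrite mem_set // /normsq /= expr1n expr0n addr0.
  by rewrite memNset ?/normsq /= ?expr0n ?addr0 //; exact/eqP.
by rewrite -esum_mkcond esum_set1 // ltry.
Qed.

Lemma hip_delta_vec n a : square_summable a -> hip (d n) (vec a) = a n.
Proof.
move=> ha; have [_ h _] := hv.
have /cvg_nmP hc := h _ _ (square_summable_delta n) ha.
apply/eqP; rewrite -subr_eq0; apply/eqP/(@nm_eq0 R R[i]^o).
apply/eqP; rewrite eq_le nm_ge0 andbT; apply/ler_addgt0Pl => e e0; rewrite addr0.
have [N _ hN] := hc _ e0; have := hN (N + `|n|.+1)%N (leq_addr _ _).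
rewrite (@sum_int_single _ (fun k => Num.conj (delta_seq R n k) * a k) n).
- by rewrite /delta_seq eqxx rmorph1 mul1r => /ltW.
- by lia.
- by move=> k /eqP kn; rewrite /delta_seq (negbTE kn) rmorph0 mul0r.
Qed.

Lemma hip_delta n m : hip (d n) (d m) = (n == m)%:R.
Proof. by rewrite hip_delta_vec //; exact: square_summable_delta. Qed.

(** The partial sums [S N] satisfy [<S N, S N> = <S N, vec a>], so
    [|S N - vec a|^2 = |vec a|^2 - |S N|^2], which tends to 0 by the limit formula for the inner
    product. *)
Lemma l2_ind (P : H -> Prop) : (forall n, P (d n)) ->
  (forall (c : R[i]) x y, P x -> P y -> P (c *: x + y)) ->
  (forall x, (forall e : R, 0 < e -> exists2 y, P y & nm (y - x) < e) -> P x) ->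
  forall x, P x.
Proof.
move=> Pd Plin Pcl x; have [_ h surj] := hv; have [a ha <-] := surj x; apply: Pcl => e e0.
have P0 : P 0 by have := Plin (-1) _ _ (Pd 0) (Pd 0); rewrite scaleN1r addNr.
pose S N : H := \sum_(0 <= k < N) (a k%:Z *: d k%:Z + a (- k.+1%:Z) *: d (- k.+1%:Z)).
have PS N : P (S N).
  rewrite /S; elim: N => [|N ih]; first by rewrite big_geq.
  by rewrite big_nat_recr //= addrC -addrA; apply: (Plin _ _ _ (Pd _)); apply: Plin.
pose T N : R[i] := \sum_(0 <= k < N) (Num.conj (a k%:Z) * a k%:Z + Num.conj (a (- k.+1%:Z)) * a (- k.+1%:Z)).
have hdS n N : - N%:Z <= n < N%:Z -> hip (d n) (S N) = a n.
  move=> nN; rewrite hip_sumr.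
  transitivity (a n * (n == n)%:R); last by rewrite eqxx mulr1.
  rewrite -(@sum_int_single _ (fun k => a k * (n == k)%:R) n N) //.
  - by apply: eq_bigr => k _; rewrite hipDr !hipZr !hip_delta.
  - by move=> k /eqP kn; rewrite eq_sym (negbTE kn) mulr0.
have hSv N : hip (S N) (vec a) = T N.
  rewrite hip_suml; apply: eq_bigr => k _.
  by rewrite hipDl !hipZl !hip_delta_vec.
have hSS N : hip (S N) (S N) = T N.
  rewrite {1}/S hip_suml; apply: eq_big_nat => k /andP[_ kN].
  by rewrite hipDl !hipZl !hdS //; lia.
have e2 : 0 < e ^+ 2 by rewrite exprn_gt0.
have /cvg_nmP /(_ _ e2) [N _ hN] := h _ _ ha ha.
exists (S N) => //; rewrite -ltr_sqr ?nnegrE ?nm_ge0 ?(ltW e0) //.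
rewrite nmB_sqr hSv.
have := congr1 (@complex.Re R) (hip_nm (S N)); rewrite hSS /= => <-.
have := congr1 (@complex.Re R) (hip_nm (vec a)) => /= <-.
have := hN N (leqnn N); rewrite -/(T N) => h1.
have := normRe_le (hip (vec a) (vec a) - T N); rewrite cReD cReN => h2.
have := le_lt_trans (le_trans (ler_norm _) h2) h1; lra.
Qed.

End l2_space.

Section fsum.
Context {R : realType} {A : cstar R} {H : hilbert R} (rho : rep A H).

(** A sum over a set takes the default value 0 when its support is infinite, whence the finiteness
    assumption. It is met because compactly supported profiles have finitely many overlapping
    shifts. *)
Lemma hip_rep_fsum (c : R[i]) (F : int -> A) (x y : H) (b : int) :
  finite_set [set k | F k <> 0] ->
  (forall k, k <> b -> hip x (rho (F k) y) = 0) ->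
  hip x (rho (c *: \sum_(k \in [set: int]) F k) y) = c * hip x (rho (F b) y).
Proof.
move=> fF h; rewrite repZl hipZr; congr (_ * _).
pose D := [set k | F k <> 0] `|` [set b].
have fD : finite_set D by rewrite finite_setU; split.
rewrite -(@fsbig_widen _ _ _ _ D) //; last first.
  by move=> k /= [_]; apply: contra_notP => h2; left.
rewrite fsbig_finite //.
have -> (r : seq int) : hip x (rho (\sum_(i <- r) F i) y) = \sum_(i <- r) hip x (rho (F i) y).
  apply: (big_morph (fun a => hip x (rho a y))) => [a a'|].
    by rewrite repDl hipDr.
  by rewrite rep0l hip0r.
rewrite (bigD1_seq b) ?finmap.fset_uniq //=; last first.
  by rewrite in_fset_set // inE; right.
by rewrite big1 ?addr0 // => k /eqP; exact: h.
Qed.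

End fsum.

Section lambda2.
Context {R : realType} {Q : cstar R} {one u s : Q}.
Hypothesis hQ : Q2_relations one u s.
Context {H : hilbert R} {vec : (int -> R[i]) -> H}.
Hypothesis hv : is_l2Z vec.
Context {lam : rep Q H}.
Hypothesis hlam : is_lambda2 u s vec lam.

Local Notation d n := (vec (delta_seq R n)).

Lemma cmul1l a : one ** a = a. Proof. by have [h _ _ _ _] := hQ; case: (h a). Qed.
Lemma cadj1 : one^† = one.
Proof.
have h := cmul1l one^†; have := congr1 (@cadj R Q) h.
by rewrite cadjM cadjK h.
Qed.

Lemma lam_u n : lam u (d n) = d (n + 1). Proof. by have [] := hlam n. Qed.
Lemma lam_s n : lam s (d n) = d (2 * n). Proof. by have [] := hlam n. Qed.

(** Representations are not assumed nondegenerate. The unit fixes [d n] because [d n] is the image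
    of [d (n - 1)] under [u]. *)
Lemma lam_one n : lam one (d n) = d n.
Proof. by have := lam_u (n - 1); rewrite subrK => <-; rewrite -rep_mul cmul1l. Qed.

Lemma lam_uadj n : lam u^† (d n) = d (n - 1).
Proof.
have [_ [uu _] _ _ _] := hQ; have := lam_u (n - 1); rewrite subrK => <-.
by rewrite -rep_mul uu lam_one.
Qed.

Lemma lam_upow m n : lam (upow one u m) (d n) = d (n + m).
Proof.
case: m => m.
- elim: m n => [|m ih] n /=; first by rewrite lam_one addr0.
  by rewrite rep_mul -/(cpow one u m) ih lam_u; congr (vec (delta_seq R _)); lia.
- rewrite /upow NegzE; elim: m.+1 n => [|k ih] n /=; first by rewrite lam_one; congr (vec (delta_seq R _)); lia.
  by rewrite rep_mul -/(cpow one u^† k) ih lam_uadj; congr (vec (delta_seq R _)); lia.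
Qed.

Lemma lam_spow k n : lam (cpow one s k) (d n) = d ((2 ^ k)%N%:Z * n).
Proof.
elim: k n => [|k ih] n /=; first by rewrite lam_one mul1r.
rewrite rep_mul -/(cpow one s k) ih lam_s; congr (vec (delta_seq R _)).
by rewrite expnS PoszM mulrA.
Qed.

Lemma lam_sadj_even n : lam s^† (d (2 * n)) = d n.
Proof.
by have [_ _ ss _ _] := hQ; rewrite -lam_s -rep_mul ss lam_one.
Qed.

(** Evaluate [s s^† + u s s^† u^† = one] at this vector: the second term already returns it, so
    [s s^†] kills it, and hence [s^†] does. *)
Lemma lam_sadj_odd n : lam s^† (d (2 * n + 1)) = 0.
Proof.
have [_ _ ss _ sum] := hQ.
have h : lam (s ** s^†) (d (2 * n + 1)) = 0.
  have := lam_one (2 * n + 1); rewrite -{1}sum repDl !rep_mul lam_uadj addrK.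
  rewrite lam_sadj_even lam_s lam_u => /(canRL (addrK _)); rewrite subrr.
  exact.
have := congr1 (lam s^†) h; rewrite rep0r -rep_mul cmulA ss.
by rewrite cmul1l.
Qed.

Lemma lam_spow_adj k n : lam (cpow one s k)^† (d n) =
  if ((2 ^ k)%N %| n)%Z then d (n %/ (2 ^ k)%N)%Z else 0.
Proof.
elim: k n => [|k ih] n; first by rewrite /= cadj1 lam_one divz1 dvd1z.
rewrite [cpow _ _ _]/= cadjM rep_mul -/(cpow one s k).
have [[m ->]|[m ->]] : (exists m, n = 2 * m) \/ (exists m, n = 2 * m + 1).
  have := divz_eq n 2; have := modz_ge0 n (isT : 2%:Z != 0); have := ltz_pmod n (isT : 0 < 2%:Z).
  move=> h1 h2 h3; have [h|h] : (n %% 2)%Z = 0 \/ (n %% 2)%Z = 1 by lia.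
  - by left; exists (n %/ 2)%Z; lia.
  - by right; exists (n %/ 2)%Z; lia.
- by rewrite lam_sadj_even ih expnS PoszM dvdz_mul2l // divzMpl.
- rewrite lam_sadj_odd rep0r; case: ifPn => // h; exfalso.
  have : (2%:Z %| 2 * m + 1)%Z by apply: dvdz_trans h; rewrite expnS PoszM dvdz_mulr.
  by move=> /dvdzP[q]; lia.
Qed.

Definition in_coset (l : int) (k : nat) (n : int) : bool := ((2 ^ k)%N %| n - l)%Z.

Lemma lam_proj l k n : lam (Q2proj one u s l k) (d n) = if in_coset l k n then d n else 0.
Proof.
rewrite /Q2proj !rep_mul lam_upow lam_spow_adj /in_coset; case: ifPn => h; last by rewrite !rep0r.
by rewrite lam_spow lam_upow mulrC divzK // subrK.
Qed.

End lambda2.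

(** * The space induced from l^2(Z) *)

Section dilations.
Context {R : realType}.
Local Notation mu := (leb R).

Definition dil (m n : int) (xi : R -> R[i]) : R -> R[i] :=
  fun y => xi (2 ^ (- m) * y + n%:~R).

Lemma exp2z_gt0 (m : int) : (0 : R) < 2 ^ m.
Proof. by rewrite exprz_gt0. Qed.

Lemma exp2z_neq0 (m : int) : (2 : R) ^ m != 0.
Proof. by rewrite gt_eqF // exp2z_gt0. Qed.

Lemma exp2z_complex (m : int) : (2 : R[i]) ^ m = (2 ^ m)%:C.
Proof. by rewrite fmorphXz rmorph_nat. Qed.

Lemma Cc_dil m n xi : Cc xi -> Cc (dil m n xi).
Proof. by apply: Cc_affine; exact: exp2z_neq0. Qed.

(** Substitute [t = 2^(-m1) y + n1]; the Jacobian cancels the prefactor [2^m1] of the inner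
    product. *)
Lemma L2ip_dil (xi1 xi2 : R -> R[i]) (m1 m2 n1 n2 : int) : Cc xi1 -> Cc xi2 ->
  (2 ^ m1 : R[i]) * L2ip xi1 (fun t => xi2 ((t - n1%:~R) * 2 ^ (m1 - m2) + n2%:~R))
  = L2ip (dil m1 n1 xi1) (dil m2 n2 xi2).
Proof.
move=> c1 c2; rewrite /L2ip (@Cint_affine R (2 ^ (- m1)) n1%:~R) ?exp2z_gt0 //; last first.
  apply: Cc_intg; apply: Cc_mull; first exact/ccontJ/Cc_ccont.
  have -> : (fun t => xi2 ((t - n1%:~R) * 2 ^ (m1 - m2) + n2%:~R)) =
     (fun t => xi2 (2 ^ (m1 - m2) * t + (n2%:~R - n1%:~R * 2 ^ (m1 - m2)))).
    by apply/funext => t; congr xi2; ring.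
  by apply: Cc_affine => //; exact: exp2z_neq0.
rewrite mulrA exp2z_complex -rmorphM -expfzDr ?subrr // rmorph1 mul1r.
congr Cint; apply/funext => y; congr (_ * xi2 _).
rewrite addrK mulrC mulrA -expfzDr //; congr (2 ^ _ * _ + _); lia.
Qed.

Lemma finite_int_bounded (N : nat) : finite_set [set b : int | `|b| <= N%:Z].
Proof.
apply: (@sub_finite_set _ _ ((fun n : nat => n%:Z - N%:Z) @` `I_(2 * N).+1)).
  by move=> b /= hb; exists (absz (b + N%:Z)); lia.
by apply: finite_image; exact: finite_II.
Qed.

(** Once [e |b|] exceeds [A + A' / c], the supports are disjoint. *)
Lemma finite_L2ip_shift (xi1 xi2 : R -> R[i]) (c e : R) : Cc xi1 -> Cc xi2 ->
  0 < c -> 0 < e ->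
  finite_set [set b : int | L2ip xi1 (fun t => xi2 ((t + e * b%:~R) * c)) <> 0].
Proof.
move=> /Cc_supp[A A0 hA] /Cc_supp[A' A'0 hA'] c0 e0.
pose N := (Num.truncn ((A + A' / c) / e)).+1.
apply: sub_finite_set (finite_int_bounded N) => b /= hb.
rewrite leNgt; apply/negP => Nb; apply: hb; rewrite /L2ip.
have h : A + A' / c < e * `|b%:~R : R|.
  rewrite -ltr_pdivrMl // mulrC; apply: lt_trans (truncnS_gt _) _.
  by rewrite -intr_norm pmulrn ltr_int.
rewrite (_ : (fun x => _) = fun=> 0) ?Cint0 //; apply/funext => t.
have [tA|tA] := ltP A `|t|; first by rewrite hA // rmorph0 mul0r.
rewrite hA' ?mulr0 // normrM (gtr0_norm c0) -ltr_pdivrMr //.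
have := ler_normB (t + e * b%:~R) t; rewrite addrAC subrr add0r normrM (gtr0_norm e0).
lra.
Qed.

End dilations.

Section inner_product.
Context {R : realType} {Q B : cstar R} {one u s : Q}.
Hypothesis hQ : Q2_relations one u s.
Context {j : (aff -> R -> R[i]) -> B} {X : imprimitivity B Q} {iota : (Xdom R -> R[i]) -> X}.
Hypothesis hX : is_bimodule_X j one u s iota.
Context {H : hilbert R} {vec : (int -> R[i]) -> H}.
Hypothesis hv : is_l2Z vec.
Context {lam : rep Q H}.
Hypothesis hlam : is_lambda2 u s vec lam.
Context {T : hilbert R} {tens : X -> H -> T}.
Hypothesis hT : is_interior_tensor lam tens.

Local Notation d n := (vec (delta_seq R n)).

(** Each word in the inner product sends [d n2] to a basis vector or to 0, so at most one index
    contributes: [2^(m2 - m1) n2 - n1] if [m1 <= m2], and [n2 - 2^(m1 - m2) n1] otherwise. The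
    projections produce the two coset conditions, and [L2ip_dil] makes the remaining coefficient
    symmetric in the two arguments. *)
Lemma hip_tens (l1 : int) (k1 : nat) xi1 (m1 n1 l2 : int) (k2 : nat) xi2 (m2 n2 : int) :
  Cc xi1 -> Cc xi2 ->
  hip (tens (iota (X0_elem l1 k1 xi1 m1)) (d n1)) (tens (iota (X0_elem l2 k2 xi2 m2)) (d n2))
  = if in_coset l1 k1 n1 && in_coset l2 k2 n2
    then L2ip (dil m1 n1 xi1) (dil m2 n2 xi2) else 0.
Proof.
move=> c1 c2; have [_ _ -> _] := hT.
have [m12|m21] := leP m1 m2.
- rewrite (X_rip_le hX) // /X0_ip_le.
  pose M := `|m2 - m1|%N; have Me : (m2 - m1) = M%:Z by rewrite /M; lia.
  have pM : (2 ^ (m2 - m1) : R) = ((2 ^ M)%N%:Z)%:~R.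
    by rewrite Me -exprnP -pmulrn natrX.
  have key b : lam (Q2proj one u s l1 k1 ** upow one u (- b) ** cpow one s M
     ** Q2proj one u s l2 k2) (d n2) = if in_coset l2 k2 n2 then
       if in_coset l1 k1 ((2 ^ M)%N%:Z * n2 - b) then d ((2 ^ M)%N%:Z * n2 - b) else 0 else 0.
    rewrite 3!rep_mul (lam_proj hQ hlam); case: ifP => _; last by rewrite !rep0r.
    by rewrite (lam_spow hQ hlam) (lam_upow hQ hlam) (lam_proj hQ hlam).
  rewrite (@hip_rep_fsum _ _ _ _ _ _ _ _ ((2 ^ M)%N%:Z * n2 - n1)); first last.
  + move=> b hb; rewrite repZl hipZr key; case: ifP => _; last by rewrite hip0r mulr0.
    case: ifP => _; last by rewrite hip0r mulr0.
    rewrite (hip_delta hv); case: eqP => [e|_]; last by rewrite mulr0.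
    by case: hb; rewrite e; ring.
  + apply: sub_finite_set (finite_L2ip_shift c1 c2 (exp2z_gt0 (m1 - m2)) (@ltr01 R)) => b /= hb hb'.
    apply: hb; rewrite (_ : L2ip _ _ = 0) ?scale0r //.
    rewrite -[RHS]hb'; congr L2ip; apply/funext => t; by rewrite mul1r.
  rewrite repZl hipZr key opprB addrCA subrr addr0.
  have [h2|h2] := boolP (in_coset l2 k2 n2); last by rewrite andbF hip0r !mulr0.
  have [h1|h1] := boolP (in_coset l1 k1 n1); last by rewrite hip0r !mulr0.
  rewrite (hip_delta hv) eqxx mulr1 -L2ip_dil //; congr (_ * L2ip _ _).
  apply/funext => t; congr xi2; rewrite rmorphB rmorphM /= -pM.
  have : (2 : R) ^ (m2 - m1) * 2 ^ (m1 - m2) = 1 by rewrite -expfzDr // (_ : m2 - m1 + (m1 - m2) = 0) ?expr0z //; lia.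
  move: ((2 : R) ^ _) ((2 : R) ^ _) => b a ab; transitivity ((t - n1%:~R) * b + a * b * n2%:~R); first by ring.
  by rewrite ab mul1r.
- rewrite (X_rip_ge hX) ?(ltW m21) // /X0_ip_ge.
  pose M := `|m1 - m2|%N; have Me : (m1 - m2) = M%:Z by rewrite /M; lia.
  have pM : (2 ^ (m1 - m2) : R) = ((2 ^ M)%N%:Z)%:~R.
    by rewrite Me -exprnP -pmulrn natrX.
  have key b : lam (Q2proj one u s l1 k1 ** (cpow one s M)^† ** upow one u (- b)
     ** Q2proj one u s l2 k2) (d n2) = if in_coset l2 k2 n2 then
       if ((2 ^ M)%N %| n2 - b)%Z then
       if in_coset l1 k1 ((n2 - b) %/ (2 ^ M)%N)%Z then d ((n2 - b) %/ (2 ^ M)%N)%Z else 0 else 0 else 0.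
    rewrite 3!rep_mul (lam_proj hQ hlam); case: ifP => _; last by rewrite !rep0r.
    rewrite (lam_upow hQ hlam) (lam_spow_adj hQ hlam); case: ifP => _; last by rewrite !rep0r.
    by rewrite (lam_proj hQ hlam).
  rewrite (@hip_rep_fsum _ _ _ _ _ _ _ _ (n2 - (2 ^ M)%N%:Z * n1)); first last.
  + move=> b hb; rewrite repZl hipZr key; case: ifP => _; last by rewrite hip0r mulr0.
    case: ifP => hd; last by rewrite hip0r mulr0.
    case: ifP => _; last by rewrite hip0r mulr0.
    rewrite (hip_delta hv); case: eqP => [e|_]; last by rewrite mulr0.
    by case: hb; rewrite e mulrC divzK //; ring.
  + apply: sub_finite_set (finite_L2ip_shift c1 c2 (exp2z_gt0 (m1 - m2)) (exp2z_gt0 (m2 - m1))) => b /= hb hb'.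
    by apply: hb; rewrite hb' scale0r.
  have p0 : (2 ^ M)%N%:Z != 0 by rewrite eqz_nat -lt0n expn_gt0.
  rewrite repZl hipZr key opprB addrCA subrr addr0 dvdz_mulr // mulKz //.
  have [h2|h2] := boolP (in_coset l2 k2 n2); last by rewrite andbF hip0r !mulr0.
  have [h1|h1] := boolP (in_coset l1 k1 n1); last by rewrite hip0r !mulr0.
  rewrite (hip_delta hv) eqxx mulr1 -L2ip_dil //; congr (_ * L2ip _ _).
  apply/funext => t; congr xi2; rewrite rmorphB rmorphM /= -pM.
  have : (2 : R) ^ (m2 - m1) * 2 ^ (m1 - m2) = 1 by rewrite -expfzDr // (_ : m2 - m1 + (m1 - m2) = 0) ?expr0z //; lia.
  move: ((2 : R) ^ _) ((2 : R) ^ _) => b a ab; transitivity (t * b + a * b * (n2%:~R - b * n1%:~R)); first by ring.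
  by rewrite ab mul1r; ring.
Qed.
End inner_product.

Section induced_space.
Context {R : realType} {Q B : cstar R} {one u s : Q}.
Hypothesis hQ : Q2_relations one u s.
Context {j : (aff -> R -> R[i]) -> B} {X : imprimitivity B Q} {iota : (Xdom R -> R[i]) -> X}.
Hypothesis hX : is_bimodule_X j one u s iota.
Context {H : hilbert R} {vec : (int -> R[i]) -> H}.
Hypothesis hv : is_l2Z vec.
Context {lam : rep Q H}.
Hypothesis hlam : is_lambda2 u s vec lam.
Context {T : hilbert R} {tens : X -> H -> T}.
Hypothesis hT : is_interior_tensor lam tens.

Local Notation d n := (vec (delta_seq R n)).

Lemma tens_linear_l (c : R[i]) x y h : tens (c *: x + y) h = c *: tens x h + tens y h.
Proof. by have [t _ _ _] := hT. Qed.

Lemma tens_linear_r (c : R[i]) x h k : tens x (c *: h + k) = c *: tens x h + tens x k.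
Proof. by have [_ t _ _] := hT. Qed.

Lemma tens0l h : tens 0 h = 0.
Proof. by have := tens_linear_l (-1) 0 0 h; rewrite !scaleN1r !addNr. Qed.

Lemma tensBl x y h : tens (x - y) h = tens x h - tens y h.
Proof. by rewrite addrC -scaleN1r tens_linear_l scaleN1r addrC. Qed.

Lemma tensBr x h k : tens x (h - k) = tens x h - tens x k.
Proof. by rewrite addrC -scaleN1r tens_linear_r scaleN1r addrC. Qed.

(** Cauchy-Schwarz together with [rep_contractive] applied to [rip x x]. It allows approximation in
    either argument of [tens]. *)
Lemma nm_tens x h : nm (tens x h) <= nm x * nm h.
Proof.
have [_ _ hh _] := hT.
rewrite -ler_sqr ?nnegrE ?mulr_ge0 ?nm_ge0 //.
have := hh x x h h; rewrite hip_nm => /(congr1 (@complex.Re R)) /= ->.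
apply: le_trans (CauchySchwarz_Re _ _) _.
apply: le_trans (ler_wpM2l (nm_ge0 _) (rep_contractive lam _ _)) _.
have -> : nm (rip x x) = nm x ^+ 2.
  by have := rip_norm x; rewrite !nmE -rmorphXn /= => /(congr1 (@complex.Re R)) /= ->.
by rewrite exprMn [nm h ^+ 2]expr2 mulrCA.
Qed.

Lemma iota_zero (phi : Xdom R -> R[i]) : (forall q, phi q = 0) -> iota phi = 0.
Proof.
move=> h; have := X_linear hX (-1) (@Cc_zero R (Xdom R)) (@Cc_zero R (Xdom R)).
by rewrite scaleN1r addNr => <-; congr iota; apply/funext => q; rewrite h mulr0 addr0.
Qed.

Lemma iota_sum (I : Type) (r : seq I) (c : I -> R[i]) (f : I -> Xdom R -> R[i]) :
  (forall i, Cc (f i)) ->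
  iota (fun q => \sum_(i <- r) c i * f i q) = \sum_(i <- r) c i *: iota (f i).
Proof.
move=> hf; elim: r => [|i r ih].
  by rewrite big_nil iota_zero // => q; rewrite big_nil.
rewrite big_cons -ih -(X_linear hX) //; last exact: Cc_sum.
by congr iota; apply/funext => q; rewrite big_cons.
Qed.

Lemma tens_sum (I : Type) (r : seq I) (c : I -> R[i]) (x : I -> X) h :
  tens (\sum_(i <- r) c i *: x i) h = \sum_(i <- r) c i *: tens (x i) h.
Proof.
elim: r => [|i r ih]; first by rewrite !big_nil tens0l.
by rewrite !big_cons tens_linear_l ih.
Qed.

Definition wvec (eta : R -> R[i]) : T := tens (iota (X0_elem 0 0 eta 0)) (d 0).

Lemma dil0 (xi : R -> R[i]) : dil 0 0 xi = xi.
Proof. by apply/funext => y; rewrite /dil oppr0 expr0z mul1r addr0. Qed.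

Lemma wvec_hip eta zeta : Cc eta -> Cc zeta -> hip (wvec eta) (wvec zeta) = L2ip eta zeta.
Proof. by move=> c1 c2; rewrite (hip_tens hQ hX hv hlam hT) // /in_coset subrr !dvdz0 !dil0. Qed.

Lemma wvec_linear (c : R[i]) eta zeta : Cc eta -> Cc zeta ->
  wvec (fun y => c * eta y + zeta y) = c *: wvec eta + wvec zeta.
Proof.
move=> c1 c2; rewrite /wvec -tens_linear_l -(X_linear hX); [|exact: Cc_X0_elem|exact: Cc_X0_elem].
congr tens; congr iota; apply/funext => q; rewrite /X0_elem; ring.
Qed.

(** By [hip_tens], the tensor and [wvec (dil m n xi)] have the same inner products with themselves
    and with each other when the coset condition holds; otherwise the tensor has norm 0. *)
Lemma tens_elem l k xi m n : Cc xi ->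
  tens (iota (X0_elem l k xi m)) (d n) = if in_coset l k n then wvec (dil m n xi) else 0.
Proof.
move=> cx; have cd := Cc_dil m n cx.
have e0 : in_coset 0 0 0 by rewrite /in_coset subrr dvdz0.
case: ifPn => h.
  by apply: hip_eq_nm; rewrite /wvec !(hip_tens hQ hX hv hlam hT) // h e0 /= !dil0.
apply: nm_eq0; apply/eqP; rewrite -sqrf_eq0; apply/eqP.
have := hip_tens hQ hX hv hlam hT l k m n l k m n cx cx.
by rewrite (negbTE h) hip_nm => /(congr1 (@complex.Re R)).
Qed.

Definition wdense (v : T) : Prop :=
  forall e : R, 0 < e -> exists2 eta, Cc eta & nm (wvec eta - v) < e.

Lemma wdense_linear (c : R[i]) v z : wdense v -> wdense z -> wdense (c *: v + z).
Proof.
move=> hv1 hz e e0.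
have c0 : 0 < 2 * (normc c + 1) by rewrite mulr_gt0 // ltr_wpDl ?normc_ge0.
have [|eta ce he] := hv1 (e / (2 * (normc c + 1))); first by rewrite divr_gt0.
have [|zeta cz hz1] := hz (e / 2); first by rewrite divr_gt0.
exists (fun y => c * eta y + zeta y); first exact: Cc_linear.
rewrite wvec_linear // opprD addrACA -scalerBr; apply: le_lt_trans (nmD _ _) _.
rewrite nmZ; move: he; rewrite ltr_pdivlMr // => he.
have := normc_ge0 c; have := nm_ge0 (wvec eta - v).
move: (nm _) he hz1 => a he; move: (nm _) => b hb a0 n0; nra.
Qed.

Lemma wdense_closed v :
  (forall e : R, 0 < e -> exists2 z, wdense z & nm (z - v) < e) -> wdense v.
Proof.
move=> h e e0; have e2 : 0 < e / 2 by rewrite divr_gt0.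
have [z /(_ _ e2)[eta ce h1] h2] := h _ e2; exists eta => //.
apply: le_lt_trans (nm_triangle z _ _) _; lra.
Qed.

Lemma wdense_wvec eta : Cc eta -> wdense (wvec eta).
Proof. by move=> ce e e0; exists eta; rewrite ?subrr ?nm0. Qed.

Lemma wdense0 : wdense 0.
Proof.
have := wdense_wvec (@Cc_zero R R) => h.
by have := wdense_linear (-1) h h; rewrite scaleN1r addNr.
Qed.

Lemma wdense_sum (I : Type) (r : seq I) (c : I -> R[i]) (v : I -> T) :
  (forall i, wdense (v i)) -> wdense (\sum_(i <- r) c i *: v i).
Proof.
move=> h; elim: r => [|i r ih]; first by rewrite big_nil; exact: wdense0.
by rewrite big_cons; exact: wdense_linear.
Qed.

Lemma nm_delta n : nm (d n) = 1.
Proof.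
apply/eqP; rewrite -(@eqrXn2 _ 2) ?nm_ge0 // expr1n; apply/eqP.
have := hip_delta hv n n; rewrite hip_nm eqxx => /(congr1 (@complex.Re R)); exact.
Qed.

(** The approximants of [X0_dense] are finite combinations of elementary functions, settled by
    [tens_elem]; [X_indlim] turns uniform closeness on a fixed compact set into closeness in [X]. *)
Lemma wdense_iota phi n : Cc phi -> wdense (tens (iota phi) (d n)).
Proof.
move=> cp; apply: wdense_closed => e e0.
have [K kK [pK hK]] := X0_dense cp.
have [M hM] := X_indlim hX kK.
(* The constant [M] is a complex number of unspecified sign; this is a positive real substitute. *)
have m1 : 0 < `|Re M| + 1 by rewrite ltr_wpDl.
have [|k [ms [cs sK sp]]] := hK (e / (`|Re M| + 1)); first by rewrite divr_gt0.
have ct : Cc (trunc_sum phi k ms).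
  by apply: Cc_sum => i; apply: Cc_X0_elem; exact: cs.
exists (tens (iota (trunc_sum phi k ms)) (d n)).
  rewrite /trunc_sum iota_sum => [|i]; last by apply: Cc_X0_elem; exact: cs.
  rewrite tens_sum; apply: wdense_sum => i.
  rewrite tens_elem; last exact: cs.
  by case: ifP => _; [apply/wdense_wvec/Cc_dil/cs|exact: wdense0].
rewrite -tensBl; apply: le_lt_trans (nm_tens _ _) _; rewrite nm_delta mulr1 nmB.
set c := e / _ in sp.
have h : `|iota phi - iota (trunc_sum phi k ms)| <= M * c%:C.
  have -> : iota phi - iota (trunc_sum phi k ms) = iota (fun q => (-1) * trunc_sum phi k ms q + phi q).
    by rewrite (X_linear hX) // scaleN1r addrC.
  apply: hM.
  - exact: Cc_linear_top.
  - move=> q; have [t0|/sK //] := eqVneq (trunc_sum phi k ms q) 0.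
      by rewrite t0 mulr0 add0r => /pK.
  - move=> q; rewrite mulN1r addrC; have := ltW (sp q); rewrite -lecR; apply: le_trans.
    by case: (_ - _) => a b; rewrite normc_def.
have h' : nm (iota phi - iota (trunc_sum phi k ms)) <= Re M * c.
  by move: h; rewrite nmE lecE cReM /= mulr0 subr0 => /andP[].
apply: le_lt_trans h' _; apply: le_lt_trans (ler_wpM2r _ (ler_norm _)) _.
  by rewrite divr_ge0 ?ltW.
by rewrite /c mulrA ltr_pdivrMr // mulrC ltr_pM2l // ltrDl.
Qed.

(** [l2_ind] reduces the second argument to a basis vector; then the density of the image of [iota]
    settles the first. *)
Lemma wdense_tens x h : wdense (tens x h).
Proof.
move: h; apply: (l2_ind hv).
- move=> n; apply: wdense_closed => e e0.
  have : closure [set x | exists2 phi, Cc phi & x = iota phi] x by rewrite (X_dense hX).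
  move=> /closure_nmP /(_ _ e0)[y [phi cp ->] hy].
  exists (tens (iota phi) (d n)); first exact: wdense_iota.
  by rewrite -tensBl; apply: le_lt_trans (nm_tens _ _) _; rewrite nm_delta mulr1.
- by move=> c h k hh hk; rewrite tens_linear_r; exact: wdense_linear.
- move=> h hh; apply: wdense_closed => e e0.
  have x1 : 0 < nm x + 1 by rewrite ltr_wpDl ?nm_ge0.
  have [|y hy1 hy2] := hh (e / (nm x + 1)); first by rewrite divr_gt0.
  exists (tens x y) => //; rewrite -tensBr; apply: le_lt_trans (nm_tens _ _) _.
  move: hy2; rewrite ltr_pdivlMr // => hy2.
  have := nm_ge0 (y - h); have := nm_ge0 x; move: (nm x) x1 (nm _) hy2 => a a1 b; nra.
Qed.

Lemma wvec_dense v (e : R) : 0 < e -> exists2 eta, Cc eta & nm (wvec eta - v) < e.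
Proof.
move: e; apply: wdense_closed => e e0; have [_ _ _ hd] := hT.
have : closure (lspan [set v | exists x h, v = tens x h]) v by rewrite hd.
move=> /closure_nmP /(_ _ e0)[y [n [c [x [hx ->]]]] hy].
exists (\sum_(i < n) c i *: x i) => //; apply: wdense_sum => i.
by have [y1 [h ->]] := hx i; exact: wdense_tens.
Qed.

End induced_space.

(** * The left action *)

Section aff_shifts.
Context {R : realType}.
Local Notation mu := (leb R).
Implicit Types (f eta : R -> R[i]).

Lemma Cc_correlation f eta (c : R) : Cc f -> Cc eta ->
  Cc (fun t => Cint mu (fun s => f s * eta (t + s * c))).
Proof.
move=> cf ce; have [A A0 hA] := Cc_supp cf; have [A' A'0 hA'] := Cc_supp ce.
apply/CcP; split.
  apply: (@Cint_param _ _ (fun t s => f s * eta (t + s * c)) A) => [|t s /hA ->]; last by rewrite mul0r.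
  apply: ccontM.
    by apply: (ccont_comp (T := R)) (Cc_ccont cf) => p; exact: cvg_snd.
  apply: (ccont_comp (T := R)) (Cc_ccont ce) => p.
  apply: cvgD; first exact: cvg_fst.
  by apply: cvgM; [exact: cvg_snd|exact: cvg_cst].
exists (A' + A * `|c|) => t ht; rewrite (_ : (fun s => _) = fun=> 0) ?Cint0 //.
apply/funext => s; have [sA|sA] := ltP A `|s|; first by rewrite hA // mul0r.
rewrite hA' ?mulr0 //.
have := ler_normB (t + s * c) (s * c); rewrite addrK normrM => h.
have : `|s| * `|c| <= A * `|c| by apply: ler_wpM2r.
by move: h ht; lra.
Qed.

Lemma Cint_expi_shift eta (a c s : R) : Cc eta -> 0 < c ->
  Cint mu (fun y => expi (y * a) * eta (c * (y + s)))
  = expi (- (s * a)) * (c^-1)%:C * fourier eta (a / c).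
Proof.
move=> ce c0; have ci : Cc (fun u : R => expi (u * (a / c)) * eta u) by exact: Cc_expi.
rewrite /fourier (Cint_affine (c * s) c0 (Cc_intg ci)) mulrA -[_ * _ * c%:C]mulrA -rmorphM mulVf ?gt_eqF //.
rewrite mulr1 -CintZ; last exact: (intg_affine (c * s) c0 (Cc_intg ci)).
congr Cint; apply/funext => y; rewrite mulrA -expiD; congr (expi _ * eta _); last by ring.
by field; rewrite gt_eqF.
Qed.

(** The function [zeta] of the overview: the profile [left_profile] of the left action, living at
    dilation [2^(- g.2)], moved back to dilation 1 by [dil]. *)
Definition aff_shift f (g : aff) eta : R -> R[i] := fun y =>
  (Num.sqrt (2 ^ g.2))%:C * expi (y * ratr (val g.1))
  * Cint mu (fun s => expi (s * ratr (val g.1)) * f s * eta (2 ^ g.2 * y + s * 2 ^ g.2)).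

Lemma Cc_shift_int f (c d : R) eta : c != 0 -> Cc f -> Cc eta ->
  Cc (fun y => Cint mu (fun s => expi (s * d) * f s * eta (c * y + s * c))).
Proof.
move=> c0 cf ce; have := Cc_correlation c (Cc_expi d cf) ce.
by move=> /(Cc_affine 0 c0); under eq_fun do rewrite addr0.
Qed.

Lemma Cc_aff_shift f g eta : Cc f -> Cc eta -> Cc (aff_shift f g eta).
Proof.
move=> cf ce; rewrite /aff_shift; apply: Cc_mull.
  by apply: ccontM; [exact: ccont_cst|exact: ccont_expiM].
by apply: Cc_shift_int => //; exact: exp2z_neq0.
Qed.

(** After exchanging the integrals, the one over [y] is a dilated transform of [eta] times a
    character in [s]; that character combines with [e(s d)] to [e(s x)], and the integral over [s]
    becomes [fourier f x]. *)
Lemma ifourier_aff_shift f g eta x : Cc f -> Cc eta ->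
  ifourier (aff_shift f g eta) x = fourier f x * (Num.sqrt (2 ^ (- g.2)))%:C
    * ifourier eta (2 ^ (- g.2) * (x - ratr (val g.1))).
Proof.
move=> cf ce; have [A A0 hA] := Cc_supp cf; have [A' A'0 hA'] := Cc_supp ce.
have [M M0 hM] := Cc_bounded cf; have [L L0 hL] := Cc_bounded ce.
set c : R := 2 ^ g.2; set d : R := ratr _; have c0 : 0 < c := exp2z_gt0 g.2.
have cV : 2 ^ (- g.2) = c^-1 :> R by rewrite -invr_expz.
rewrite /ifourier cV.
pose G (y s : R) := expi (y * (d - x)) * (expi (s * d) * (f s * eta (c * (y + s)))).
have hs y : Cc (fun s => f s * eta (c * (y + s))).
  apply: Cc_mulr => //; apply: (ccont_comp (T := R)) (Cc_ccont ce) => s.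
  by apply: cvgM; [exact: cvg_cst|apply: cvgD; [exact: cvg_cst|exact: cvg_id]].
have GE y : Cint mu (G y) = expi (y * (d - x)) *
    Cint mu (fun s => expi (s * d) * f s * eta (c * y + s * c)).
  rewrite /G CintZ; last exact/Cc_intg/Cc_expi/hs.
  by congr (_ * Cint _ _); apply/funext => s; rewrite mulrA mulrDr (mulrC s c).
have e1 : fourier (aff_shift f g eta) (- x) =
    (Num.sqrt c)%:C * Cint mu (fun y => Cint mu (G y)).
  rewrite /fourier -CintZ.
    congr Cint; apply/funext => y; rewrite GE /aff_shift -/c -/d mulrDr expiD; ring.
  under eq_fun do rewrite GE.
  by apply/Cc_intg/Cc_expi/Cc_shift_int => //; rewrite gt_eqF.
rewrite e1 (@Cint_Fubini _ G (Num.max A (A' / c + A)) (M * L)); first last.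
- move=> y s; rewrite !gt_max => h.
  have [sA|sA] := ltP A `|s|; first by rewrite /G hA // mul0r !mulr0.
  have {h} h : A' / c + A < `|y| by case: h => /andP[h1 h2] //; move: sA; rewrite leNgt h1.
  rewrite /G hA' ?mulr0 // normrM gtr0_norm // mulrC -ltr_pdivrMr //.
  have := ler_normB (y + s) s; rewrite addrK; lra.
- move=> y s; rewrite /G !normcM !normc_expi !mul1r.
  by apply: ler_pM => //; exact: normc_ge0.
- apply: cmeasM.
    apply: (cmeas_comp (g := fun p : R * R => p.1 * (d - x))); last exact/ccont_cmeas/ccont_expi.
    by apply: measurable_funM.
  apply: cmeasM.
    apply: (cmeas_comp (g := fun p : R * R => p.2 * d)); last exact/ccont_cmeas/ccont_expi.
    by apply: measurable_funM.
  apply: cmeasM; first by apply: cmeas_comp => //; exact: Cc_cmeas.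
  apply: (cmeas_comp (g := fun p : R * R => c * (p.1 + p.2))); last exact: Cc_cmeas.
  by apply: measurable_funM => //; apply: measurable_funD.
set h := fourier eta _.
have -> : (fun s => Cint mu (G ^~ s)) = fun s => (c^-1)%:C * h * (expi (s * x) * f s).
  apply/funext => s; rewrite /G.
  transitivity (expi (s * d) * f s * Cint mu (fun y => expi (y * (d - x)) * eta (c * (y + s)))).
    rewrite -CintZ; first by congr Cint; apply/funext => y; ring.
    apply/Cc_intg/Cc_expi; have := Cc_affine (c * s) (lt0r_neq0 c0) ce.
    by under eq_fun do rewrite -mulrDr.
  rewrite Cint_expi_shift // /h.
  have -> : - (c^-1 * (x - d)) = (d - x) / c by ring.
  have -> : s * x = s * d + - (s * (d - x)) by ring.
  rewrite expiD; ring.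
rewrite CintZ; last exact/Cc_intg/Cc_expi.
rewrite -/(fourier f x).
(* The Jacobian of the dilation turns the factor [c^(1/2)] of the left action into the factor
   [c^(-1/2)] of [pi]. *)
have e : Num.sqrt c * c^-1 = Num.sqrt c^-1.
  rewrite sqrtrV ?(ltW c0) //; have s0 : Num.sqrt c != 0 by rewrite gt_eqF // sqrtr_gt0.
  by rewrite -[X in _ / X](sqr_sqrtr (ltW c0)); field.
rewrite -e rmorphM; ring.
Qed.

End aff_shifts.

(** The phase is locally constant in [z]: it only sees the residue modulo the 2-part of the
    denominator of [q]. *)
Lemma p2_resb z r q : Z2res z (logn 2 `|denq q|%N) = Z2res r (logn 2 `|denq q|%N) -> p2 z q = p2 r q.
Proof. by move=> h; rewrite /p2 !Z2resM h. Qed.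

Lemma p2_0 q : p2 (Z2int 0) q = 0.
Proof. by rewrite /p2 Z2resM Z2res_nat mod0n muln0 mod0n mul0r. Qed.

Section left_profiles.
Context {R : realType}.
Local Notation mu := (leb R).

Definition left_profile (f : R -> R[i]) (g : aff) (eta : R -> R[i]) : R -> R[i] := fun t =>
  (Num.sqrt (2 ^ g.2))%:C * expi (t * 2 ^ (- g.2) * ratr (val g.1))
  * Cint mu (fun s => expi (s * ratr (val g.1)) * f s * eta (t + s * 2 ^ g.2)).

Lemma left_profileE f g eta : dil (- g.2) 0 (left_profile f g eta) = aff_shift f g eta.
Proof.
apply/funext => y; rewrite /dil /left_profile /shift opprK addr0; congr (_ * expi (_ * _) * _).
by rewrite mulrAC -expfzDr // subrr mul1r.
Qed.

Lemma Cc_left_profile f g eta : Cc f -> Cc eta -> Cc (left_profile f g eta).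
Proof.
move=> cf ce; apply: Cc_mull.
  apply: ccontM; first exact: ccont_cst.
  by under eq_fun do rewrite -mulrA; exact: ccont_expiM.
by apply: Cc_correlation => //; exact: Cc_expi.
Qed.

(** The result lives at the single dilation [2^(- g.2)], where the phase is that of [z D], constant
    on cosets of [2^k Z_2]. Splitting over these cosets gives elementary functions. *)
Lemma X0_left_elem f (g : aff) eta :
  let D := 2 ^ (- g.2) * val g.1 in let k := logn 2 `|denq D|%N in
  X0_left f g (X0_elem 0 0 eta 0) = fun q => \sum_(r <- iota 0 (2 ^ k))
    expi (- ratr (p2 (Z2int r) D)) * X0_elem r k (left_profile f g eta) (- g.2) q.
Proof.
move=> D k; apply/funext => -[z [t m]].
rewrite (bigD1_seq (Z2res z k)) ?iota_uniq ?mem_iota ?add0n ?Z2res_lt //=.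
rewrite [X in _ + X]big1_seq ?addr0; last first.
  move=> r /andP[rk]; rewrite mem_iota add0n => /andP[_ r2].
  by rewrite X0_elemE /= resb_nat // eq_sym (negbTE rk) !mul0r mulr0.
rewrite X0_elemE /= resb_nat ?Z2res_lt // eqxx mul1r /X0_left /=.
have z0 : resb 0 0 z.
  by rewrite /resb; have := Z2res_lt z 0; have := Z2res_lt (Z2int 0) 0; lia.
case: eqP => [->|mg].
  rewrite mulr1 -/D (@p2_resb z (Z2int (Z2res z k))); last first.
    by rewrite Z2res_nat modn_small // Z2res_lt.
  rewrite /left_profile -!mulrA mulrCA; congr (_ * (_ * (_ * Cint _ _))).
  by apply/funext => x; rewrite X0_elemE /= z0 mul1r opprK addNr eqxx mulr1 mulrA.
rewrite mulr0 mulr0 (_ : (fun x => _) = fun=> 0) ?Cint0 ?mulr0 //.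
apply/funext => x; rewrite X0_elemE /=; case: eqP => [e|_]; last by rewrite !mulr0.
by case: mg; rewrite -[m](addrK g.2) e sub0r.
Qed.

End left_profiles.

Section left_action.
Context {R : realType} {Q B : cstar R} {one u s : Q}.
Hypothesis hQ : Q2_relations one u s.
Context {j : (aff -> R -> R[i]) -> B} {X : imprimitivity B Q} {io : (Xdom R -> R[i]) -> X}.
Hypothesis hX : is_bimodule_X j one u s io.
Context {H : hilbert R} {vec : (int -> R[i]) -> H}.
Hypothesis hv : is_l2Z vec.
Context {lam : rep Q H}.
Hypothesis hlam : is_lambda2 u s vec lam.
Context {T : hilbert R} {tens : X -> H -> T}.
Hypothesis hT : is_interior_tensor lam tens.
Context {Ind : rep B T}.
Hypothesis hI : is_induced tens Ind.
Local Notation d n := (vec (delta_seq R n)).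

(** Tensoring with [d 0] annihilates every coset except that of 0, where the phase is [e(0) = 1];
    the 2-adic factor thus leaves no trace. *)
Lemma Ind_wvec f g eta : Cc f -> Cc eta ->
  Ind (j (cp_elem (fourier f) g)) (wvec (iota := io) (vec := vec) (tens := tens) eta) =
  wvec (iota := io) (vec := vec) (tens := tens) (aff_shift f g eta).
Proof.
move=> cf ce; rewrite {1}/wvec hI (X_lact hX g cf erefl); last exact: Cc_X0_elem.
have cp := Cc_left_profile g cf ce.
rewrite X0_left_elem (iota_sum hX); last by move=> r; exact: Cc_X0_elem.
rewrite (tens_sum hT); set k := logn _ _.
rewrite (bigD1_seq 0%N) ?iota_uniq ?mem_iota ?add0n ?expn_gt0 //=.
rewrite [X in _ + X]big1_seq ?addr0; last first.
  move=> r /andP[r0]; rewrite mem_iota add0n => /andP[_ r2].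
  rewrite (tens_elem hQ hX hv hlam hT) // /in_coset sub0r.
  have -> : ((2 ^ k)%N %| - r%:Z)%Z = false; last by rewrite scaler0.
  by rewrite dvdzE abszN gtnNdvd // lt0n.
rewrite (tens_elem hQ hX hv hlam hT) // /in_coset subrr dvdz0 left_profileE.
by rewrite p2_0 rmorph0 oppr0 expi0 scale1r.
Qed.

End left_action.

(** * The crossed product *)

Section C0_functions.
Context {R : realType}.
Implicit Types (f : R -> R[i]).

Lemma C0P f : C0 f <-> ccont f /\
  forall e : R, 0 < e -> exists A, forall x, A <= `|x| -> normc (f x) <= e.
Proof.
split=> [hf|[cf hf]].
  split; last exact: C0_vanish.
  by have [/ccontP ? _ _] := hf.
split; first exact/ccontP.
- apply/(@cvg_nmP R R[i]^o) => e e0; have e2 : 0 < e / 2 by rewrite divr_gt0.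
  have [A hA] := hf _ e2; near=> x; rewrite sub0r nmN.
  apply: le_lt_trans (hA x _) _; last by lra.
  have xA : A < x by near: x; apply: nbhs_pinfty_gt; exact: num_real.
  exact: le_trans (ltW xA) (ler_norm _).
- apply/(@cvg_nmP R R[i]^o) => e e0; have e2 : 0 < e / 2 by rewrite divr_gt0.
  have [A hA] := hf _ e2; near=> x; rewrite sub0r nmN.
  apply: le_lt_trans (hA x _) _; last by lra.
  have xA : x < - A by near: x; apply: nbhs_ninfty_lt; exact: num_real.
  by rewrite -normrN; apply: le_trans (ler_norm _); lra.
Unshelve. all: by end_near. Qed.

Lemma C0_zero : C0 (fun _ : R => 0 : R[i]).
Proof.
apply/C0P; split; first exact: ccont_cst.
by move=> e e0; exists 0 => x _; rewrite normc0 ltW.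
Qed.

Lemma C0_conj f : C0 f -> C0 (fun x => Num.conj (f x)).
Proof.
move=> /C0P[cf hf]; apply/C0P; split; first exact: ccontJ.
move=> e /hf[A hA]; exists A => x /hA.
by case: (f x) => a b /=; rewrite sqrrN.
Qed.

Lemma C0_affine f (a b : R) : a != 0 -> C0 f -> C0 (fun x => f (a * (x - b))).
Proof.
move=> a0 /C0P[cf hf]; apply/C0P; split.
  apply: (ccont_comp (T := R)) cf => x.
  by apply: cvgM; [exact: cvg_cst|apply: cvgB; [exact: cvg_id|exact: cvg_cst]].
move=> e /hf[A hA]; exists (A / `|a| + `|b|) => x hx; apply: hA.
rewrite normrM mulrC -ler_pdivrMr ?normr_gt0 //.
by have := ler_normD (x - b) b; rewrite subrK; lra.
Qed.

Lemma C0_linear (c : R[i]) f g : C0 f -> C0 g -> C0 (fun x => c * f x + g x).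
Proof.
move=> /C0P[cf hf] /C0P[cg hg]; apply/C0P; split.
  by apply: ccontD => //; apply: ccontM => //; exact: ccont_cst.
move=> e e0; have c0 := normc_ge0 c.
have [|A hA] := hf (e / (2 * (normc c + 1))); first by rewrite divr_gt0 // mulr_gt0 // ltr_wpDl.
have [|A' hA'] := hg (e / 2); first by rewrite divr_gt0.
exists (Num.max A A') => x; rewrite ge_max => /andP[/hA h1 /hA' h2].
apply: le_trans (le_normcD _ _) _; rewrite normcM.
move: h1; rewrite ler_pdivlMr ?mulr_gt0 ?ltr_wpDl // => h1.
have := normc_ge0 (f x); move: (normc (f x)) h1 (normc (g x)) h2.
move=> a h1 b h2 a0; nra.
Qed.

Lemma C0_bounded_mul f g : C0 f -> C0 g -> C0 (fun x => f x * g x).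
Proof.
move=> /C0P[cf hf] /C0P[cg hg]; apply/C0P; split; first exact: ccontM.
move=> e e0; have [A hA] := hf _ e0; have [A' hA'] := hg 1 ltr01.
exists (Num.max A A') => x; rewrite ge_max => /andP[/hA h1 /hA' h2].
by rewrite normcM -[e]mulr1; apply: ler_pM => //; exact: normc_ge0.
Qed.

(* A real root [k] of [2 M k - k^2 = |f|^2]. *)
Definition quasi_root (M : R) f (x : R) : R := M - Num.sqrt (M ^+ 2 - normsq (f x)).

(** For [0 <= t <= M] one has [0 <= M - sqrt (M^2 - t^2) <= t], so the root vanishes at infinity
    together with [f]. *)
Lemma C0_quasi_root (M : R) f : 0 < M -> (forall x, normc (f x) <= M) -> C0 f ->
  C0 (fun x => (quasi_root M f x)%:C).
Proof.
move=> M0 fM /C0P[cf hf]; apply/C0P; split.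
  apply: ccont_real => x; apply: cvgB; first exact: cvg_cst.
  have cm : continuous (fun y => M ^+ 2 - normsq (f y)).
    by move=> y; apply: cvgB; [exact: cvg_cst|exact: continuous_normsq].
  exact: (continuous_comp (cm x) (@sqrt_continuous R _)).
move=> e e0; have [|A hA] := hf (Num.min e M); first by rewrite lt_min e0.
exists A => x /hA; rewrite le_min => /andP[xe xM]; rewrite normc_real /quasi_root.
have n0 := normc_ge0 (f x); rewrite -sqr_normc_normsq.
move: (normc (f x)) n0 xe xM => t t0 te tM.
have r0 : 0 <= M ^+ 2 - t ^+ 2 by rewrite subr_ge0 ler_sqr ?nnegrE // ltW.
have s1 := sqrtr_ge0 (M ^+ 2 - t ^+ 2); have s2 := sqr_sqrtr r0.
have s3 : Num.sqrt (M ^+ 2 - t ^+ 2) <= M.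
  by rewrite -ler_sqr ?nnegrE ?s2 ?(ltW M0) // gerBl sqr_ge0.
rewrite ger0_norm ?subr_ge0 //.
have h : M - Num.sqrt (M ^+ 2 - t ^+ 2) <= t.
  have : M - t <= Num.sqrt (M ^+ 2 - t ^+ 2).
    by rewrite -ler_sqr ?nnegrE ?subr_ge0 // s2; nra.
  lra.
exact: le_trans h te.
Qed.

Lemma quasi_rootE (M : R) f x : normc (f x) <= M ->
  (2 * M) * quasi_root M f x - quasi_root M f x ^+ 2 = normsq (f x).
Proof.
move=> fM; rewrite /quasi_root.
have r0 : 0 <= M ^+ 2 - normsq (f x).
  by rewrite subr_ge0 -sqr_normc_normsq ler_sqr ?nnegrE ?normc_ge0 // (le_trans (normc_ge0 _) fM).
have := sqr_sqrtr r0; move: (Num.sqrt _) => a h.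
have -> : normsq (f x) = M ^+ 2 - a ^+ 2 by rewrite h; ring.
ring.
Qed.

End C0_functions.

Section affine_group.

Lemma aff_ext (g h : aff) : val g.1 = val h.1 -> g.2 = h.2 -> g = h.
Proof. by case: g h => [a m] [b n] /= /val_inj -> ->. Qed.

Lemma is_half0 : is_half 0.
Proof. by exists 0, 0%N; rewrite mul0r. Qed.

Definition aff1 : aff := (mkZhalf is_half0, 0).

Lemma expz2V (m : int) : (2 : rat) ^ (- m) * 2 ^ m = 1.
Proof. by rewrite -expfzDr // addNr. Qed.

Lemma aff_mulKV g h : aff_mul g (aff_mul (aff_inv g) h) = h.
Proof.
apply: aff_ext => /=; last by lia.
have := expz2V g.2; move: (2 ^ _) (2 ^ _) (val g.1) (val h.1) => a b c d e.
transitivity (c + (a * b) * (d - c)); first by ring.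
by rewrite e mul1r addrC subrK.
Qed.

Lemma aff_mulVK g h : aff_mul (aff_inv g) (aff_mul g h) = h.
Proof.
apply: aff_ext => /=; last by lia.
have := expz2V g.2; move: (2 ^ _) (2 ^ _) (val g.1) (val h.1) => a b c d e.
by rewrite mulrDr !mulrA e mul1r addKr.
Qed.

Lemma aff_invK g : aff_inv (aff_inv g) = g.
Proof.
apply: aff_ext => /=; last by lia.
by rewrite mulrN opprK mulrA expz2V mul1r.
Qed.

Lemma aff_mulVg g : aff_mul (aff_inv g) g = aff1.
Proof. by apply: aff_ext => /=; rewrite ?addNr //. Qed.

Lemma aff_mul11 : aff_mul aff1 aff1 = aff1.
Proof. by apply: aff_ext => /=; rewrite ?mulr0 ?addr0. Qed.

Lemma aff_inv1 : aff_inv aff1 = aff1.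
Proof. by apply: aff_ext => /=; rewrite ?mulr0 ?oppr0. Qed.

Lemma aff_act1 (R : realType) (f : R -> R[i]) : aff_act aff1 f = f.
Proof. by apply/funext => x; rewrite /aff_act /= oppr0 expr0z mul1r rmorph0 subr0. Qed.

End affine_group.

Section crossed_product.
Context {R : realType}.
Implicit Types (f : R -> R[i]) (g : aff).

Lemma CcG_elem f g : C0 f -> CcG (cp_elem f g).
Proof.
move=> hf; split.
  apply: (sub_finite_set _ (finite_set1 g)) => h [x]; rewrite /cp_elem.
  by case: (eqVneq h g) => [-> //|_]; rewrite eqxx.
by move=> h; rewrite /cp_elem; case: eqP => // _; exact: C0_zero.
Qed.

Lemma C0_aff_act f g : C0 f -> C0 (aff_act g f).
Proof. by apply: C0_affine; rewrite gt_eqF // exprz_gt0. Qed.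

Lemma cp_mul_elem f f' g g' : cp_mul (cp_elem f g) (cp_elem f' g') =
  cp_elem (fun x => f x * aff_act g f' x) (aff_mul g g').
Proof.
apply/funext => k; apply/funext => x; rewrite /cp_mul.
rewrite -(@fsbig_widen _ _ _ _ [set g]) //; last first.
  by move=> h [_ /= /eqP /negbTE hg]; rewrite /cp_elem hg mul0r.
rewrite fsbig_set1 /cp_elem eqxx.
have -> : (aff_mul (aff_inv g) k == g') = (k == aff_mul g g').
  by apply/eqP/eqP => [<-|->]; rewrite ?aff_mulKV ?aff_mulVK.
by case: eqP => // _; rewrite /aff_act mulr0.
Qed.

Lemma cp_adj_elem f g : cp_adj (cp_elem f g) =
  cp_elem (aff_act (aff_inv g) (fun x => Num.conj (f x))) (aff_inv g).
Proof.
apply/funext => k; apply/funext => x; rewrite /cp_adj /cp_elem.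
have -> : (k == aff_inv g) = (aff_inv k == g).
  by apply/eqP/eqP => [->|<-]; rewrite aff_invK.
case: eqP => [<-|_]; last by rewrite /aff_act rmorph0.
by rewrite aff_invK.
Qed.

Context {B : cstar R} {j : (aff -> R -> R[i]) -> B}.
Hypothesis hj : cp_hom j.

Lemma cp_linear (c : R[i]) F F' : CcG F -> CcG F' ->
  j (fun g x => c * F g x + F' g x) = c *: j F + j F'.
Proof. by have [h _ _] := hj; exact: h. Qed.

Lemma cp_elem_linear (c : R[i]) f f' g : C0 f -> C0 f' ->
  j (cp_elem (fun x => c * f x + f' x) g) = c *: j (cp_elem f g) + j (cp_elem f' g).
Proof.
move=> hf hf'; rewrite -cp_linear; [|exact: CcG_elem|exact: CcG_elem].
congr j; apply/funext => h; apply/funext => x; rewrite /cp_elem.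
by case: eqP => // _; rewrite mulr0 addr0.
Qed.

Lemma cp_elem0 g : j (cp_elem (fun _ => 0) g) = 0.
Proof.
have := cp_elem_linear (-1) g C0_zero C0_zero.
by under eq_fun do rewrite mulr0 addr0; rewrite scaleN1r addNr.
Qed.

Lemma cp_elemM f f' g g' : C0 f -> C0 f' ->
  j (cp_elem f g) ** j (cp_elem f' g') =
  j (cp_elem (fun x => f x * aff_act g f' x) (aff_mul g g')).
Proof.
move=> hf hf'; have [_ h _] := hj.
by rewrite -h ?cp_mul_elem //; exact: CcG_elem.
Qed.

Lemma cp_elem_adj f g : C0 f -> (j (cp_elem f g))^† =
  j (cp_elem (aff_act (aff_inv g) (fun x => Num.conj (f x))) (aff_inv g)).
Proof. by move=> hf; have [_ _ h] := hj; rewrite -h ?cp_adj_elem //; exact: CcG_elem. Qed.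

(** With [f'] the translate of [f] by the inverse of [g], the product of the adjoint with the
    element is [|f'|^2] at the neutral element. It has the form [2 M k - k^2] with [k] real in
    [C_0(R)], and [rep_quasi_sqrt] applies. No estimate for [j] enters. *)
Lemma rep_cp_elem_bound (H : hilbert R) (rho : rep B H) f g (M : R) v :
  C0 f -> 0 < M -> (forall x, normc (f x) <= M) ->
  nm (rho (j (cp_elem f g)) v) <= M * nm v.
Proof.
move=> hf M0 fM; pose gV := aff_inv g; pose f' := aff_act gV f.
have f'M x : normc (f' x) <= M by exact: fM.
have hf' : C0 f' by exact: C0_aff_act.
have hk := C0_quasi_root M0 f'M hf'.
set k := fun x => _ in hk.
have hfs : C0 (aff_act gV (fun x => Num.conj (f x))) by apply: C0_aff_act; exact: C0_conj.
have adjk : (j (cp_elem k aff1))^† = j (cp_elem k aff1).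
  rewrite cp_elem_adj // aff_inv1 aff_act1; congr (j (cp_elem _ _)).
  by apply/funext => x; rewrite conj_real.
rewrite -ler_sqr ?nnegrE ?mulr_ge0 ?nm_ge0 ?(ltW M0) // exprMn.
have := rep_nm_sqr rho (j (cp_elem f g)) v => /(congr1 (@complex.Re R)) /= ->.
apply: (rep_quasi_sqrt rho v adjk).
rewrite cp_elem_adj // !cp_elemM // aff_mulVg aff_mul11 aff_act1.
have hkk := C0_bounded_mul hk hk.
(* Adding the zero element gives both combinations the shape of [cp_elem_linear]. *)
have -> : (2 * M)%:C *: j (cp_elem k aff1) - j (cp_elem (fun x => k x * k x) aff1) =
    (-1) *: j (cp_elem (fun x => k x * k x) aff1) + ((2 * M)%:C *: j (cp_elem k aff1) + j (cp_elem (fun=> 0) aff1)).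
  by rewrite cp_elem0 addr0 scaleN1r addrC.
rewrite -cp_elem_linear //; last exact: C0_zero.
rewrite -cp_elem_linear //; last by apply: C0_linear => //; exact: C0_zero.
congr (j (cp_elem _ _)); apply/funext => x.
transitivity (normsq (f' x))%:C; first by rewrite -mulJ_normsq.
rewrite -(quasi_rootE (f'M x)) /k rmorphB rmorphXn !rmorphM /=; ring.
Qed.

(** Induction over a list enumerating the support. Membership in [CcG] is carried along because [j]
    is only specified there. *)
Lemma cp_restrict_ind (P : B -> Prop) : P 0 ->
  (forall (c : R[i]) b b', P b -> P b' -> P (c *: b + b')) ->
  (forall f g, C0 f -> P (j (cp_elem f g))) ->
  forall F, CcG F -> P (j F).
Proof.
move=> P0 Plin Pe F [fF hF].
have key (r : seq aff) : CcG (fun g x => if g \in r then F g x else 0) /\ P (j (fun g x => if g \in r then F g x else 0)).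
  elim: r => [|g r [ih1 ih2]].
    have h : CcG (fun (g : aff) (x : R) => if g \in [::] then F g x else 0).
      split=> [|g]; last exact: C0_zero.
      by apply: (sub_finite_set _ fF) => g [x]; rewrite eqxx.
    split=> //; have := cp_linear (-1) h h; rewrite scaleN1r addNr => e.
    by rewrite (_ : (fun g x => _) = (fun (g : aff) (x : R) => -1 * 0 + 0)) ?e //; apply/funext => g; apply/funext => x; rewrite mulr0 addr0.
  have [gr|gr] := boolP (g \in r).
    rewrite (_ : (fun h x => _) = (fun h x => if h \in r then F h x else 0)) //.
    apply/funext => h; apply/funext => x; rewrite inE; case: eqP => [->|] //; by rewrite gr.
  rewrite (_ : (fun h x => _) = (fun h x => 1 * cp_elem (F g) g h x + if h \in r then F h x else 0)); last first.
    apply/funext => h; apply/funext => x; rewrite inE /cp_elem mul1r.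
    by case: eqP => [->|]; rewrite ?(negbTE gr) ?addr0 ?add0r.
  split; last by rewrite cp_linear //; [apply: Plin => //; exact: Pe|exact: CcG_elem].
  have [f1 c1] := CcG_elem g (hF g); have [f2 c2] := ih1.
  split; last by move=> h; apply: C0_linear.
  apply: (sub_finite_set (B := [set h | exists x, cp_elem (F g) g h x != 0] `|` [set h | exists x, (if h \in r then F h x else 0) != 0])); last by rewrite finite_setU.
  move=> h [x hx] /=; have [e|e] := eqVneq (cp_elem (F g) g h x) 0; last by left; exists x.
  by right; exists x; move: hx; rewrite e mulr0 add0r.
have [_] := key (finmap.enum_fset (fset_set [set g | exists x, F g x != 0])).
rewrite (_ : (fun g x => _) = F) //; apply/funext => g; apply/funext => x.
case: ifPn => //; rewrite in_fset_set // notin_setE /= => h.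
by apply/esym/eqP/negP => /negP h'; apply: h; exists x.
Qed.

End crossed_product.

(** * Intertwining *)

Section intertwining.
Context {R : realType} {B : cstar R} {H K : hilbert R} (rho : rep B H) (sigma : rep B K).
Context (I : Type) (a : I -> H) (w : I -> K).
Hypothesis lin : forall (c : R[i]) i k, exists m,
  a m = c *: a i + a k /\ w m = c *: w i + w k.

(** Phrased on the relation, so that it is stable under limits in [b]; once the relation is the
    graph of a map [U], it says that [U] intertwines the actions of [b]. *)
Definition intertwined (b : B) : Prop :=
  forall x z, graph_closure a w x z -> graph_closure a w (rho b x) (sigma b z).

Lemma intertwined_gen b : (forall i, exists m, rho b (a i) = a m /\ sigma b (w i) = w m) ->
  intertwined b.
Proof.
move=> h x z g e e0; have b1 : 0 < nm b + 1 by rewrite ltr_wpDl ?nm_ge0.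
have [|i [h1 h2]] := g (e / (nm b + 1)); first by rewrite divr_gt0.
have [m [am wm]] := h i; exists m; rewrite -am -wm -repBr -repBr.
move: h1 h2; rewrite !ltr_pdivlMr // => h1 h2.
have := nm_ge0 b; have := nm_ge0 (a i - x); have := nm_ge0 (w i - z) => p1 p2 p3.
split; apply: le_lt_trans (rep_contractive _ _ _) _; nra.
Qed.

Lemma intertwined_linear (c : R[i]) b b' : intertwined b -> intertwined b' ->
  intertwined (c *: b + b').
Proof.
move=> h h' x z g; rewrite !repDl !repZl.
by apply: graph_closure_linear => //; [exact: h|exact: h'].
Qed.

(** Closeness is measured by the two operators rather than by the norm of [B], since
    [rep_cp_elem_bound] gives precisely such estimates. *)
Lemma intertwined_approx b :
  (forall e : R, 0 < e -> exists b', [/\ intertwined b',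
     forall x, nm (rho (b' - b) x) <= e * nm x & forall z, nm (sigma (b' - b) z) <= e * nm z]) ->
  intertwined b.
Proof.
move=> h x z g e e0; have [p1 p2] := (nm_ge0 x, nm_ge0 z).
have d0 : 0 < 2 * (nm x + nm z + 1) by nra.
have [|b' [ib' h1 h2]] := h (e / (2 * (nm x + nm z + 1))); first by rewrite divr_gt0.
have [|i [h3 h4]] := ib' _ _ g (e / 2); first by rewrite divr_gt0.
have e1 : e / (2 * (nm x + nm z + 1)) * (nm x + nm z + 1) = e / 2.
  by field; rewrite gt_eqF //; nra.
have r0 : 0 < e / (2 * (nm x + nm z + 1)) by rewrite divr_gt0.
exists i; split.
- apply: le_lt_trans (nm_triangle (rho b' x) _ _) _; rewrite -repBl.
  have := h1 x; nra.
- apply: le_lt_trans (nm_triangle (sigma b' z) _ _) _; rewrite -repBl.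
  have := h2 z; nra.
Qed.

Lemma intertwined_closed b :
  (forall e : R, 0 < e -> exists2 b', intertwined b' & nm (b' - b) < e) -> intertwined b.
Proof.
move=> h; apply: intertwined_approx => e e0; have [b' ib' hb'] := h _ e0; exists b'; split => // x.
- apply: le_trans (rep_contractive _ _ _) _; apply: ler_wpM2r; [exact: nm_ge0|exact: ltW].
- apply: le_trans (rep_contractive _ _ _) _; apply: ler_wpM2r; [exact: nm_ge0|exact: ltW].
Qed.

Lemma intertwined0 : intertwined 0.
Proof.
apply: intertwined_closed => e e0.
exists 0; last by rewrite subrr nm0.
move=> x z g; rewrite !rep0l; move=> d d0.
have [|i [_ _]] := g d => //.
have [m [am wm]] := lin (-1) i i; exists m.
by rewrite am wm !scaleN1r !addNr !subr0 !nm0.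
Qed.

(** Three closures: sup-norm limits of transforms at a fixed group element, finite sums over the
    group, and norm limits in [B]. *)
Lemma intertwined_crossed_product (j : (aff -> R -> R[i]) -> B) :
  is_crossed_product j ->
  (forall f g, Cc f -> intertwined (j (cp_elem (fourier f) g))) ->
  forall b, intertwined b.
Proof.
move=> [hj dj _] h b.
have hC0 f g : C0 f -> intertwined (j (cp_elem f g)).
  move=> cf; apply: intertwined_approx => e e0; have [k ck hk] := fourier_dense cf e0.
  have e1 : j (cp_elem (fourier k) g) - j (cp_elem f g) =
      j (cp_elem (fun x => -1 * f x + fourier k x) g).
    rewrite cp_elem_linear // ?scaleN1r 1?addrC //; exact: fourier_C0.
  have cd : C0 (fun x => -1 * f x + fourier k x).
    by apply: C0_linear => //; exact: fourier_C0.
  have bd x : normc (-1 * f x + fourier k x) <= e.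
    by rewrite mulN1r addrC -normcN opprB.
  exists (j (cp_elem (fourier k) g)); split; first exact: h.
  - by move=> x; rewrite e1; apply: rep_cp_elem_bound.
  - by move=> x; rewrite e1; apply: rep_cp_elem_bound.
apply: intertwined_closed => e e0.
have : closure [set b | exists2 F, CcG F & b = j F] b by rewrite dj.
move=> /closure_nmP /(_ _ e0)[y [F cF ->] hy]; exists (j F) => //.
apply: (cp_restrict_ind hj) cF => //; [exact: intertwined0|exact: intertwined_linear].
Qed.

End intertwining.

Theorem theorem9p1 (R : realType)
  (Q : cstar R) (one u s : Q) (hQ : is_Q2 one u s)
  (B : cstar R) (j : (aff -> R -> R[i]) -> B) (hB : is_crossed_product j)
  (X : imprimitivity B Q) (iota : (Xdom R -> R[i]) -> X)
  (hX : is_bimodule_X j one u s iota)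
  (l2Z : hilbert R) (vec : (int -> R[i]) -> l2Z) (hl2Z : is_l2Z vec)
  (lambda2 : rep Q l2Z) (hlambda2 : is_lambda2 u s vec lambda2)
  (L2R : hilbert R) (cls : (R -> R[i]) -> L2R) (hL2R : is_L2R cls)
  (pi : rep B L2R) (hpi : is_pi j cls pi)
  (T : hilbert R) (tens : X -> l2Z -> T)
  (hT : is_interior_tensor lambda2 tens)
  (Ind : rep B T) (hInd : is_induced tens Ind) :
  unitarily_equivalent pi Ind.
Proof.
have [hQr _ _] := hQ.
pose I := {eta : R -> R[i] | Cc eta}.
(* By [nm_ifourier] the inverse transform multiplies norms by the square root of [fejerC]; this
   factor makes the correspondence isometric. *)
pose c : R[i] := (Num.sqrt (@fejerC R))^-1%:C.
have C0 := @fejerC_gt0 R.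
pose a (i : I) : L2R := c *: cls (ifourier (sval i)).
pose w (i : I) : T := wvec (iota := iota) (vec := vec) (tens := tens) (sval i).
have lin (k : R[i]) (i1 i2 : I) : exists m, a m = k *: a i1 + a i2 /\ w m = k *: w i1 + w i2.
  case: i1 i2 => [f hf] [g hg]; exists (exist _ _ (Cc_linear k hf hg)); split => /=.
    rewrite /a /= scalerA mulrC -scalerA -scalerDr; congr (_ *: _).
    rewrite -(cls_linear hL2R); [|exact: ifourier_square_integrable|exact: ifourier_square_integrable].
    by congr cls; apply/funext => x; rewrite /ifourier fourier_linear.
  by rewrite /w /= (wvec_linear hX hT).
have iso i : nm (a i) = nm (w i).
  case: i => [f hf]; rewrite /a /w /=; apply/eqP; rewrite -(@eqrXn2 _ 2) ?nm_ge0 //; apply/eqP.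
  rewrite nmZ normc_real exprMn (nm_ifourier hL2R hf) ger0_norm ?invr_ge0 ?sqrtr_ge0 //.
  rewrite exprVn sqr_sqrtr ?(ltW C0) // mulrA mulVf ?gt_eqF // mul1r.
  have := hip_nm (cls f); rewrite (cls_hip hL2R); [|exact: Cc_square_integrable|exact: Cc_square_integrable].
  rewrite -(wvec_hip hQr hX hl2Z hlambda2 hT hf hf) hip_nm => /(congr1 (@complex.Re R)); exact: esym.
have da x (e : R) : 0 < e -> exists i, nm (a i - x) < e.
  move=> e0; have s0 : 0 < Num.sqrt (@fejerC R) by rewrite sqrtr_gt0.
  (* Target and tolerance are both scaled to compensate the factor [c]. *)
  have [|f hf hfx] := ifourier_dense hL2R ((Num.sqrt (@fejerC R))%:C *: x) (e := e * Num.sqrt (@fejerC R)).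
    by rewrite mulr_gt0.
  exists (exist _ f hf); rewrite /a /=.
  have -> : x = c *: ((Num.sqrt (@fejerC R))%:C *: x).
    by rewrite scalerA -rmorphM mulVf ?gt_eqF // scale1r.
  rewrite -scalerBr nmZ normc_real ger0_norm ?invr_ge0 ?ltW //.
  by rewrite mulrC ltr_pdivrMr.
have dw z (e : R) : 0 < e -> exists i, nm (w i - z) < e.
  by move=> /(wvec_dense hQr hX hl2Z hlambda2 hT z)[f hf h]; exists (exist _ f hf).
(* On generators both sides are indexed by the same function [aff_shift f g eta]:
   [ifourier_aff_shift] shows it for [pi], [Ind_wvec] for the induced representation. *)
have inter b : intertwined pi Ind a w b.
  apply: (intertwined_crossed_product lin hB) => f g hf; apply: intertwined_gen => -[eta heta].
  exists (exist _ _ (Cc_aff_shift g hf heta)); rewrite /a /w /=; split; last first.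
    exact: (Ind_wvec hQr hX hl2Z hlambda2 hT hInd).
  rewrite repZr (hpi _ _ _ (fourier_C0 hf) (ifourier_square_integrable heta)).
  by congr (_ *: cls _); apply/funext => x; rewrite ifourier_aff_shift.
have [U [hU Ulin Uhip Usurj]] := graph_closure_unitary lin iso da dw.
exists U; split => // b x.
by apply: (graph_closure_fun lin iso (hU _)); exact: inter.
Qed.
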